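(* Let $p:\mathcal X\to Y$ be a proper holomorphic surjection between complex manifolds with $\dim\mathcal X=m+n$, $\dim Y=m$, $\mathcal X$ Kähler, $Y$ compact, and $dp$ surjective at every point. Let $(L,h)$ be a Hermitian holomorphic line bundle over $\mathcal X$ whose curvature $\Theta$ is positive on every fiber $\mathcal X_t=p^{-1}(t)$, and let $\Theta_{\mathcal H}$ be the horizontal component of $\Theta$. For an integer $1\le k\le m$, the following are equivalent: (A) $\Theta$ has at least $n+k$ positive eigenvalues at every point of $\mathcal X$. (B) $\Theta_{\mathcal H}$ has at least $k$ positive eigenvalues at every point of $\mathcal X$. (C) There exists a positive $\beta\in C^\infty(\mathcal X,p^*(\wedge^{1,1}T^*Y))$ such that, at every point of $\mathcal X$, the sum of any $m-k+1$ eigenvalues of $\Theta_{\mathcal H}$ with respect to $\beta$ is positive. Moreover, when $k=1$, the condition on $\beta$ in (C) can be rephrased as $\Theta_{\mathcal H}\wedge\beta^{m-1}>0$, or equivalently as $\Theta^{n+1}\wedge\beta^{m-1}>0$.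
   Context: Use local coordinates $(t_1,\dots,t_m)$ on $Y$ and $(t_1,\dots,t_m,z_1,\dots,z_n)$ on $\mathcal X$ (with $p(t,z)=t$), and write $h=e^{-\phi}$ locally, $\phi_{i\bar j}=\phi_{t_i\bar t_j}$, $\phi_{\lambda\bar\mu}=\phi_{z_\lambda\bar z_\mu}$, $\phi_{i\bar\mu}=\phi_{t_i\bar z_\mu}$, $\phi_{\lambda\bar j}=\phi_{z_\lambda\bar t_j}$. The curvature $\Theta$ has as its coefficient matrix the complex Hessian of $\phi$. ''$\Theta$ is positive on every fiber'' means $(\phi_{\lambda\bar\mu})$ is positive definite; let $(\phi^{\lambda\bar\mu})$ denote its inverse. Then $\Theta=\Theta_{\mathcal H}+\Theta_{\mathcal V}$ with the (coordinate-independent) horizontal and vertical components $$\Theta_{\mathcal H}=\sum_{i,j}\Big(\phi_{i\bar j}-\sum_{\lambda,\mu}\phi_{i\bar\mu}\phi^{\lambda\bar\mu}\phi_{\lambda\bar j}\Big)dt_i\wedge d\bar t_j,\qquad \Theta_{\mathcal V}=\sum_{\lambda,\mu}\phi_{\lambda\bar\mu}\,\delta z_\lambda\wedge\delta\bar z_\mu,$$ where $\delta z_\lambda=dz_\lambda+\sum_{i,\mu}\phi^{\lambda\bar\mu}\phi_{i\bar\mu}dt_i$. Thus $\Theta_{\mathcal H}\in C^\infty(\mathcal X,p^*(\wedge^{1,1}T^*Y))$. A form $\beta\in C^\infty(\mathcal X,p^*(\wedge^{1,1}T^*Y))$, locally $\beta=i\sum_{i,j}\beta_{i\bar j}\,dt_i\wedge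 d\bar t_j$ with coefficients functions on $\mathcal X$, is called positive if the matrix $(\beta_{i\bar j})$ is positive definite at every point. The eigenvalues of $\Theta_{\mathcal H}$ with respect to $\beta$ at a point are the $m$ (real) eigenvalues, counted with multiplicity, of the Hermitian coefficient matrix of $\Theta_{\mathcal H}$ relative to the Hermitian matrix $(\beta_{i\bar j})$. The number of positive eigenvalues of $\Theta$ (resp. $\Theta_{\mathcal H}$) at a point means that of its Hermitian coefficient matrix. In the wedge products $\Theta_{\mathcal H}\wedge\beta^{m-1}$ and $\Theta^{n+1}\wedge\beta^{m-1}$ the usual factor $i$ is included in the real forms (i.e. $\Theta$ is read as $i\partial\bar\partial\phi$), so the first is a section of $p^*(\wedge^{m,m}T^*Y)$ and the second is an $(n+m,n+m)$-form on $\mathcal X$; ''$>0$'' means a positive multiple, at every point, of $\bigwedge_{k=1}^m i\,dt_k\wedge d\bar t_k$ and of $\bigwedge_{k=1}^m i\,dt_k\wedge d\bar t_k\wedge\bigwedge_{\lambda=1}^n i\,dz_\lambda\wedge d\bar z_\lambda$, respectively. *)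

(* Defs.v *)
From HB Require Import structures.
From mathcomp Require Import all_boot all_order all_algebra.
From mathcomp Require Import complex.
From mathcomp Require Import all_classical all_reals all_analysis.

Set Implicit Arguments.
Unset Strict Implicit.
Unset Printing Implicit Defensive.

Import Order.TTheory GRing.Theory Num.Theory.
Import numFieldNormedType.Exports.
Local Open Scope ring_scope.

(* The complex numbers, packaged as a [numClosedFieldType] so that the topology
   that the analysis library puts on such a field is inferred for [Cplx R] and
   for the row vectors ['rV[Cplx R]_N]. *)
Definition Cplx (R : realType) : numClosedFieldType := R[i].

Section Calculus.
Variable R : realType.
Local Notation C := (Cplx R).

Definition toC (r : R) : C := real_complex R r.
Definition reC (z : C) : R := complex.Re z.
Definition imC (z : C) : R := complex.Im z.

Variable N : nat.
Implicit Types (f : 'rV[C]_N -> C) (V : set 'rV[C]_N) (v x : 'rV[C]_N).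

(* The derivative of [f] at [x] in the direction [v] of the underlying real
   vector space. *)
Definition rderivable v f x : Prop :=
  derivable (fun r : R => reC (f (x + toC r *: v))) 0 1 /\
  derivable (fun r : R => imC (f (x + toC r *: v))) 0 1.

Definition rderive v f x : C :=
  toC (derive1 (fun r : R => reC (f (x + toC r *: v))) 0) +
  'i * toC (derive1 (fun r : R => imC (f (x + toC r *: v))) 0).

(* With z_a = x_a + i y_a, the real directions of d/dx_a and d/dy_a. *)
Definition dirx (a : 'I_N) : 'rV[C]_N := delta_mx 0 a.
Definition diry (a : 'I_N) : 'rV[C]_N := 'i *: delta_mx 0 a.

Fixpoint Ck (k : nat) V f : Prop :=
  (forall x, V x -> {for x, continuous f}) /\
  if k is k'.+1 then
    forall a : 'I_N,
      [/\ forall x, V x -> rderivable (dirx a) f x,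
          forall x, V x -> rderivable (diry a) f x,
          Ck k' V (rderive (dirx a) f) &
          Ck k' V (rderive (diry a) f)]
  else True.

Definition Cinf V f : Prop := forall k, Ck k V f.

(* Wirtinger derivatives d/dz_a and d/d\bar z_a. *)
Definition dz (a : 'I_N) f x : C :=
  (rderive (dirx a) f x - 'i * rderive (diry a) f x) / 2.
Definition dzbar (a : 'I_N) f x : C :=
  (rderive (dirx a) f x + 'i * rderive (diry a) f x) / 2.

Definition holo V f : Prop :=
  Cinf V f /\ forall x a, V x -> dzbar a f x = 0.

Definition holo_vec M V (F : 'rV[C]_N -> 'rV[C]_M) : Prop :=
  forall b, holo V (fun x => F x 0 b).

(* Vectors are rows: the complex differential of F at x is v |-> v *m jac F x. *)
Definition jac M (F : 'rV[C]_N -> 'rV[C]_M) x : 'M[C]_(N, M) :=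
  \matrix_(a, b) dz a (fun y => F y 0 b) x.

(* The matrix (f_{a \bar b}) of d^2 f / dz_a d\bar z_b. *)
Definition cplx_hessian f x : 'M[C]_N :=
  \matrix_(a, b) dz a (dzbar b f) x.

End Calculus.

Section LinearAlgebra.
Variable C : numClosedFieldType.

Definition adjmx p q (A : 'M[C]_(p, q)) : 'M[C]_(q, p) := map_mx Num.conj A^T.

(* The Hermitian form of B is sum_(a, b) B_{a \bar b} v_a \bar v_b. *)
Definition posdef N (B : 'M[C]_N) : Prop :=
  adjmx B = B /\
  forall v : 'rV[C]_N, v != 0 -> 0 < (v *m B *m adjmx v) 0 0.

Definition eigenvalues N (A : 'M[C]_N) : seq C :=
  sval (closed_field_poly_normal (char_poly A)).

(* On the complex numbers [0 < z] means that z is real and positive. *)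
Definition num_pos_eigenvalues N (A : 'M[C]_N) : nat :=
  count (fun z => 0 < z) (eigenvalues A).

(* The roots of det (A - z B), for invertible B. *)
Definition rel_eigenvalues N (B A : 'M[C]_N) : seq C :=
  eigenvalues (invmx B *m A).

(* Subsequences of size q correspond to the choices of q indices. *)
Definition sums_pos (q : nat) (s : seq C) : Prop :=
  forall t, subseq t s -> size t = q -> 0 < \sum_(z <- t) z.

(* Given the blocks (A_{i \bar j}), (A_{i \bar mu}), (A_{lambda \bar j}),
   (A_{lambda \bar mu}) of A, this is the matrix of
   A_{i \bar j} -
     sum_(lambda, mu) A_{i \bar mu} A^{lambda \bar mu} A_{lambda \bar j}.
   The inverse (A^{lambda \bar mu}) is normalised by
   sum_mu A^{lambda \bar mu} A_{nu \bar mu} = delta_(lambda, nu), so that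
   A^{lambda \bar mu} is the (mu, lambda) entry of [invmx]. *)
Definition horizontal_part m n (A : 'M[C]_(m + n)) : 'M[C]_m :=
  ulsubmx A - ursubmx A *m invmx (drsubmx A) *m dlsubmx A.

End LinearAlgebra.

Section Exterior.
Variable C : numClosedFieldType.

(* The exterior algebra on generators e_0, ..., e_(p-1): [u S] is the
   coefficient of the product of the e_i, i in S, in increasing order. *)
Definition ext p := {ffun {set 'I_p} -> C}.

Definition ext_one p : ext p := [ffun S : {set 'I_p} => (S == finset.set0)%:R].
Definition ext_gen p (i : 'I_p) : ext p := [ffun S : {set 'I_p} => (S == [set i]%SET)%:R].

Definition crossings p (A B : {set 'I_p}) : nat :=
  #|[set ab : 'I_p * 'I_p |
      [&& ab.1 \in A, ab.2 \in B & (ab.2 < ab.1)%N]]%SET|.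

Definition wedge p (u v : ext p) : ext p :=
  [ffun S : {set 'I_p} => \sum_(A : {set 'I_p} | A \subset S)
     (-1) ^+ crossings A (S :\: A)%SET * u A * v (S :\: A)%SET].

Definition ext_pow p (u : ext p) (k : nat) : ext p :=
  iter k (wedge u) (ext_one p).

(* Forms in N complex variables: the generators are dz_0, ..., dz_(N-1)
   followed by their conjugates. *)
Definition form_dz N (a : 'I_N) : ext (N + N) := ext_gen (lshift N a).
Definition form_dzbar N (a : 'I_N) : ext (N + N) := ext_gen (rshift N a).

(* i sum_(a, b) A_{a \bar b} dz_a /\ d\bar z_b *)
Definition form11 N (A : 'M[C]_N) : ext (N + N) :=
  \sum_a \sum_b ('i * A a b) *: wedge (form_dz a) (form_dzbar b).

Definition vol_form N : ext (N + N) :=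
  \big[@wedge (N + N)/ext_one (N + N)]_(a < N)
     ('i *: wedge (form_dz a) (form_dzbar a)).

Definition positive_top N (w : ext (N + N)) : Prop :=
  exists2 c : C, 0 < c & w = c *: vol_form N.

End Exterior.

Section Manifolds.
Local Open Scope classical_set_scope.
Variable R : realType.
Local Notation C := (Cplx R).

(* The values of [ch_to] outside [ch_dom] and of [ch_from] outside [ch_cod]
   are irrelevant. *)
Record chart (T : topologicalType) (N : nat) := Chart {
  ch_dom : set T;
  ch_cod : set 'rV[C]_N;
  ch_to : T -> 'rV[C]_N;
  ch_from : 'rV[C]_N -> T;
  ch_dom_open : open ch_dom;
  ch_cod_open : open ch_cod;
  ch_toP : forall x, ch_dom x -> ch_cod (ch_to x);
  ch_fromP : forall z, ch_cod z -> ch_dom (ch_from z);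
  ch_toK : forall x, ch_dom x -> ch_from (ch_to x) = x;
  ch_fromK : forall z, ch_cod z -> ch_to (ch_from z) = z;
  ch_to_cont : forall x, ch_dom x -> {for x, continuous ch_to};
  ch_from_cont : forall z, ch_cod z -> {for z, continuous ch_from} }.

Definition transition_holo T N (c c' : chart T N) : Prop :=
  holo_vec (ch_cod c `&` ch_from c @^-1` ch_dom c')
           (fun z => ch_to c' (ch_from c z)).

Definition compatible T N (c c' : chart T N) : Prop :=
  transition_holo c c' /\ transition_holo c' c.

Record complexManifold (N : nat) := ComplexManifold {
  mfd_space :> topologicalType;
  mfd_hausdorff : hausdorff_space mfd_space;
  mfd_second_countable : @second_countable mfd_space;
  atlas : set (chart mfd_space N);
  atlas_cover : forall x, exists2 c, atlas c & ch_dom c x;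
  atlas_compat : forall c c', atlas c -> atlas c' -> compatible c c';
  atlas_maximal : forall c, (forall c', atlas c' -> compatible c c') ->
                  atlas c }.

Section OneManifold.
Variables (N : nat) (X : complexManifold N).

(* For open W. *)
Definition smooth_on (W : set X) (f : X -> C) : Prop :=
  forall c, atlas c ->
    Cinf (ch_cod c `&` ch_from c @^-1` W) (fun z => f (ch_from c z)).

Definition holo_on (W : set X) (f : X -> C) : Prop :=
  forall c, atlas c ->
    holo (ch_cod c `&` ch_from c @^-1` W) (fun z => f (ch_from c z)).

(* (dz'_b / dz_a)_{a, b} at x, for charts c = (z_a) and c' = (z'_b). *)
Definition transition_jac (c c' : chart X N) (x : X) : 'M[C]_N :=
  jac (fun z => ch_to c' (ch_from c z)) (ch_to c x).

(* g c x is the coefficient matrix at x, in the chart c, of the form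
   i sum_(a, b) g_{a \bar b} dz_a /\ d\bar z_b. The last condition expresses
   that this form is closed. *)
Record is_kahler_form (g : chart X N -> X -> 'M[C]_N) : Prop := {
  kahler_smooth : forall c, atlas c -> forall a b,
    smooth_on (ch_dom c) (fun x => g c x a b);
  kahler_posdef : forall c, atlas c -> forall x, ch_dom c x ->
    posdef (g c x);
  kahler_change : forall c c', atlas c -> atlas c' ->
    forall x, ch_dom c x -> ch_dom c' x ->
    g c x = transition_jac c c' x *m g c' x *m adjmx (transition_jac c c' x);
  kahler_closed : forall c, atlas c -> forall z, ch_cod c z ->
    forall a b e,
    dz a (fun y => g c (ch_from c y) b e) z =
      dz b (fun y => g c (ch_from c y) a e) z /\
    dzbar a (fun y => g c (ch_from c y) e b) z =
      dzbar b (fun y => g c (ch_from c y) e a) z }.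

Definition kahler_manifold : Prop := exists g, is_kahler_form g.

Record localFrame (E : X -> lmodType C) := LocalFrame {
  fr_dom : set X;
  fr_sec : forall x, E x }.

(* A holomorphic line bundle: a family of complex lines with a holomorphic
   structure given by local frames with holomorphic transition functions. *)
Record lineBundle := LineBundle {
  fibre :> X -> lmodType C;
  frames : set (localFrame fibre);
  frame_open : forall e, frames e -> open (fr_dom e);
  frame_basis : forall e, frames e -> forall x, fr_dom e x ->
    fr_sec e x != 0 /\ forall v : fibre x, exists s : C, v = s *: fr_sec e x;
  frame_cover : forall x, exists2 e, frames e & fr_dom e x;
  frame_compat : forall e e', frames e -> frames e' ->
    exists2 s : X -> C, holo_on (fr_dom e `&` fr_dom e') s &
      forall x, fr_dom e x -> fr_dom e' x -> fr_sec e' x = s x *: fr_sec e x }.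

Record hermMetric (L : lineBundle) := HermMetric {
  herm :> forall x, {dot (L x) for Num.conj};
  herm_smooth : forall e : localFrame L, frames e ->
    smooth_on (fr_dom e) (fun x => herm x (fr_sec e x) (fr_sec e x)) }.

(* The weight phi of h = e^{-phi} in the frame e. *)
Definition weight (L : lineBundle) (h : hermMetric L) (e : localFrame L)
    (x : X) : C :=
  toC (- ln (reC (h x (fr_sec e x) (fr_sec e x)))).

(* The coefficient matrix of the curvature at x, in the chart c. *)
Definition curvature (L : lineBundle) (h : hermMetric L) (e : localFrame L)
    (c : chart X N) (x : X) : 'M[C]_N :=
  cplx_hessian (fun z => weight h e (ch_from c z)) (ch_to c x).

End OneManifold.

Section Maps.
Variables (N M : nat) (X : complexManifold N) (Y : complexManifold M).
Variable p : X -> Y.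

Definition chart_expr (c : chart X N) (d : chart Y M) : 'rV[C]_N -> 'rV[C]_M :=
  fun z => ch_to d (p (ch_from c z)).

Definition holo_map : Prop :=
  continuous p /\
  forall c d, atlas c -> atlas d ->
    holo_vec (ch_cod c `&` ch_from c @^-1` (p @^-1` ch_dom d))
             (chart_expr c d).

Definition surjective_differential (x : X) : Prop :=
  forall c d, atlas c -> atlas d -> ch_dom c x -> ch_dom d (p x) ->
    forall u : 'rV[C]_M, exists v : 'rV[C]_N,
      v *m jac (chart_expr c d) (ch_to c x) = u.

Definition proper_map : Prop :=
  forall K : set Y, compact K -> compact (p @^-1` K).

(* A smooth section beta of p^*(Lambda^{1,1} T^*Y) over X:
   beta = i sum_(i, j) (hf_coef d x)_{i \bar j} dt_i /\ d\bar t_j at the points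
   x over the domain of the chart d = (t_i) of Y. *)
Record horizontalForm := HorizontalForm {
  hf_coef :> chart Y M -> X -> 'M[C]_M;
  hf_smooth : forall d, atlas d -> forall i j,
    smooth_on (p @^-1` ch_dom d) (fun x => hf_coef d x i j);
  hf_change : forall d d', atlas d -> atlas d' ->
    forall x, ch_dom d (p x) -> ch_dom d' (p x) ->
    hf_coef d x = transition_jac d d' (p x) *m hf_coef d' x
                    *m adjmx (transition_jac d d' (p x)) }.

Definition positive_form (beta : horizontalForm) : Prop :=
  forall d, atlas d -> forall x, ch_dom d (p x) -> posdef (beta d x).

End Maps.

Section Fibration.
Variables (m n : nat).
Variables (X : complexManifold (m + n)) (Y : complexManifold m) (p : X -> Y).
Variables (L : lineBundle X) (h : hermMetric L).

(* c = (t, z) and d = t are charts with p(t, z) = t; the first m coordinates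
   of c are t. *)
Definition adapted (c : chart X (m + n)) (d : chart Y m) : Prop :=
  [/\ atlas c, atlas d &
      forall x, ch_dom c x ->
        ch_dom d (p x) /\ lsubmx (ch_to c x) = ch_to d (p x)].

Definition positive_on_fibres : Prop :=
  forall c d (e : localFrame L), adapted c d -> frames e ->
  forall x, ch_dom c x -> fr_dom e x -> posdef (drsubmx (curvature h e c x)).

Definition curvature_H (e : localFrame L) (c : chart X (m + n)) (x : X) :
    'M[C]_m :=
  horizontal_part (curvature h e c x).

(* The number of positive eigenvalues of the curvature, that of its horizontal
   part, and the conditions below on [beta] do not depend on the chosen charts
   and frames, so they are required for all of them. *)
Definition curvature_pos_ge (q : nat) : Prop :=
  forall x c (e : localFrame L), atlas c -> frames e ->
  ch_dom c x -> fr_dom e x ->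
  (q <= num_pos_eigenvalues (curvature h e c x))%N.

Definition curvature_H_pos_ge (q : nat) : Prop :=
  forall x c d (e : localFrame L), adapted c d -> frames e ->
  ch_dom c x -> fr_dom e x ->
  (q <= num_pos_eigenvalues (curvature_H e c x))%N.

Definition eigen_sums_pos (beta : horizontalForm p) (q : nat) : Prop :=
  forall x c d (e : localFrame L), adapted c d -> frames e ->
  ch_dom c x -> fr_dom e x ->
  sums_pos q (rel_eigenvalues (beta d x) (curvature_H e c x)).

Definition wedge_H_pos (beta : horizontalForm p) : Prop :=
  forall x c d (e : localFrame L), adapted c d -> frames e ->
  ch_dom c x -> fr_dom e x ->
  positive_top (wedge (form11 (curvature_H e c x))
                      (ext_pow (form11 (beta d x)) (m - 1))).

(* As a form on X, [beta d x] only involves dt_i and d\bar t_j. *)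
Definition wedge_pos (beta : horizontalForm p) : Prop :=
  forall x c d (e : localFrame L), adapted c d -> frames e ->
  ch_dom c x -> fr_dom e x ->
  positive_top (wedge (ext_pow (form11 (curvature h e c x)) n.+1)
                      (ext_pow (form11 (block_mx (beta d x) 0 0 0 : 'M[C]_(m + n)))
                               (m - 1))).

End Fibration.
End Manifolds.

(* Main.v *)
Require Import Defs.
From HB Require Import structures.
From mathcomp Require Import all_boot all_order all_algebra.
From mathcomp Require Import fingroup perm.
From mathcomp Require Import complex.
From mathcomp Require Import all_classical all_reals all_analysis.
From mathcomp Require Import zify ring lra.

Set Implicit Arguments.
Unset Strict Implicit.
Unset Printing Implicit Defensive.

Import Order.TTheory GRing.Theory Num.Theory.
Import numFieldNormedType.Exports.
Local Open Scope classical_set_scope.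
Local Open Scope ring_scope.

(** Work in coordinates adapted to the fibration, where the Schur decomposition
    Theta = T diag (Theta_H, Theta_V) T^* with T unipotent and Sylvester's law of
    inertia give (A) <-> (B).

    (C) -> (B): if all sums of m - k + 1 relative eigenvalues are positive, at
    least k of them are positive, and by simultaneous diagonalisation their signs
    are those of the eigenvalues of Theta_H.

    (B) -> (C): let G be the horizontal part of a Kaehler form and l_1, ..., l_m the
    eigenvalues of Theta_H relative to G. By compactness, |l_i| <= Lam and at least
    k of the l_i are >= del, for constants Lam, del > 0. The form
    beta = G (2 Lam - G^-1 Theta_H)^N is positive and independent of the choice of
    adapted coordinates; the eigenvalues of Theta_H relative to beta are the
    l_i / (2 Lam - l_i)^N, among which, for large N, the k large positive ones
    dominate the negative ones.

    For k = 1, both wedge products are positive multiples of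
    tr (adj beta Theta_H) times the volume form, by expansion into mixed
    determinants. *)

(** * Hermitian matrices *)

(** The obstacle in (B) to (C) is smoothness: the eigenspaces of Theta_H need not vary smoothly
    where eigenvalues cross, so beta cannot be prescribed on each of them separately. A power of 2
    Lam - G^-1 Theta_H reweights them just as well, is rational in the matrix entries and transforms
    correctly under coordinate changes, so the pointwise formula is already global. The shift 2 Lam
    keeps the weights 2 Lam - l_i in [Lam, 3 Lam] and decreasing in l_i: an l_i >= del is divided by
    at most (2 Lam - del)^N, a negative one by at least (2 Lam)^N. Any m - k + 1 of them include one
    of the first kind, against at most m - k bad ones, so (2 Lam / (2 Lam - del))^N only has to
    exceed (m - k) Lam / del.

    The constants Lam and del are found without continuity of eigenvalues: both bounds are rephrased
    as positive definiteness, an open condition.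

    (A) speaks of all charts and (B) only of adapted ones, so adapted charts must be shown to exist.
    They come from a holomorphic inverse function theorem, for which a calculus of Wirtinger
    derivatives is built on real partial derivatives. *)

Section HermitianForms.
Variable C : numClosedFieldType.

Lemma adjmxK p q (A : 'M[C]_(p, q)) : adjmx (adjmx A) = A.
Proof. by apply/matrixP => i j; rewrite !mxE conjCK. Qed.

Lemma adjmxM p q r (A : 'M[C]_(p, q)) (B : 'M[C]_(q, r)) :
  adjmx (A *m B) = adjmx B *m adjmx A.
Proof. by rewrite /adjmx trmx_mul map_mxM. Qed.

Lemma adjmxD p q (A B : 'M[C]_(p, q)) : adjmx (A + B) = adjmx A + adjmx B.
Proof. by apply/matrixP => i j; rewrite !mxE rmorphD. Qed.

Lemma adjmxN p q (A : 'M[C]_(p, q)) : adjmx (- A) = - adjmx A.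
Proof. by apply/matrixP => i j; rewrite !mxE rmorphN. Qed.

Lemma adjmx1 p : adjmx (1%:M : 'M[C]_p) = 1%:M.
Proof. by rewrite /adjmx trmx1 map_mx1. Qed.

Lemma adjmx0 p q : adjmx (0 : 'M[C]_(p, q)) = 0.
Proof. by apply/matrixP => i j; rewrite !mxE conjC0. Qed.

Lemma adjmx_unit p (A : 'M[C]_p) : (adjmx A \in unitmx) = (A \in unitmx).
Proof. by rewrite /adjmx map_unitmx unitmx_tr. Qed.

Lemma adjmx_inv p (A : 'M[C]_p) : adjmx (invmx A) = invmx (adjmx A).
Proof. by rewrite /adjmx trmx_inv map_invmx. Qed.

Lemma adjmx_block p q r s (A : 'M[C]_(p, r)) (B : 'M[C]_(p, s)) (D : 'M[C]_(q, r))
    (E : 'M[C]_(q, s)) :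
  adjmx (block_mx A B D E) = block_mx (adjmx A) (adjmx D) (adjmx B) (adjmx E).
Proof. by rewrite /adjmx tr_block_mx map_block_mx. Qed.

Lemma adjmx_diag_real p (d : 'rV[C]_p) :
  (forall i, d 0 i \is Num.real) -> adjmx (diag_mx d) = diag_mx d.
Proof.
move=> dr; apply/matrixP => i j; rewrite !mxE eq_sym rmorphMn /=.
have [->|_] := eqVneq i j; last by rewrite !mulr0n.
by rewrite (CrealP (dr j)).
Qed.

Lemma form_congr p q (W : 'M[C]_(q, p)) (A : 'M[C]_p) (v : 'rV[C]_q) :
  v *m (W *m A *m adjmx W) *m adjmx v = (v *m W) *m A *m adjmx (v *m W).
Proof. by rewrite adjmxM !mulmxA. Qed.

Lemma form_diag p (d v : 'rV[C]_p) :
  (v *m diag_mx d *m adjmx v) 0 0 = \sum_i d 0 i * `|v 0 i| ^+ 2.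
Proof.
rewrite mul_mx_diag mxE; apply: eq_bigr => i _.
by rewrite !mxE normCK mulrCA mulrA.
Qed.

Lemma posdef_diag p (d : 'rV[C]_p) :
  (forall i, 0 < d 0 i) -> posdef (diag_mx d).
Proof.
move=> d0; split; first by apply: adjmx_diag_real => i; exact: gtr0_real.
move=> v; rewrite form_diag => vN0.
have [i vi] : exists i, v 0 i != 0.
  apply/existsP; apply: contraNT vN0; rewrite negb_exists => /forallP v0.
  by apply/eqP/rowP => i; rewrite mxE; apply/eqP; have := v0 i; rewrite negbK.
rewrite (bigD1 i)//= ltr_wpDr//.
  by apply: sumr_ge0 => j _; rewrite mulr_ge0 ?exprn_ge0// ltW.
by rewrite mulr_gt0// exprn_gt0// normr_gt0.
Qed.

Lemma posdef_congr p q (G : 'M[C]_p) (W : 'M[C]_(q, p)) :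
  posdef G -> row_free W -> posdef (W *m G *m adjmx W).
Proof.
move=> [Gh Gp] Wf; split; first by rewrite !adjmxM adjmxK Gh mulmxA.
by move=> v vN0; rewrite form_congr Gp// mulmx_free_eq0.
Qed.

Lemma posdef_unit p (G : 'M[C]_p) : posdef G -> G \in unitmx.
Proof.
move=> [_ Gp]; rewrite -row_free_unit -kermx_eq0; apply/rowV0P => v.
move=> /sub_kermxP vG; apply/eqP; apply: contraT => /Gp.
by rewrite vG mul0mx mxE ltxx.
Qed.

Lemma spectral_decomp p (A : 'M[C]_p) : adjmx A = A ->
  exists U, exists d : 'rV[C]_p,
    [/\ U *m adjmx U = 1%:M, forall i, d 0 i \is Num.real &
        A = adjmx U *m diag_mx d *m U].
Proof.
move=> Ah; have Aherm : A \is hermsymmx.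
  by apply/is_hermitianmxP; rewrite expr0 scale1r -[LHS]Ah.
exists (spectralmx A), (spectral_diag A); split.
- exact/unitarymxP/spectral_unitarymx.
- by move=> i; exact: (mxOverP (hermitian_spectral_diag_real Aherm)).
- have /hermitian_normalmx/orthomx_spectralP := Aherm.
  by rewrite (invmx_unitary (spectral_unitarymx A)).
Qed.

(** A square root [Q] of [G] reduces [G] to the identity and [H] to the Hermitian matrix [K]; the
    unitary matrix that diagonalises [K] leaves the identity unchanged. *)
Lemma simultaneous_diag p (G H : 'M[C]_p) : posdef G -> adjmx H = H ->
  exists S, exists d : 'rV[C]_p,
    [/\ S \in unitmx, forall i, d 0 i \is Num.real,
        G = adjmx S *m S & H = adjmx S *m diag_mx d *m S].
Proof.
move=> Gp Hh; have [Gh _] := Gp.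
have [U [g [UU gr GE]]] := spectral_decomp Gh.
have Uu : U \in unitmx by apply: (mulmx1_unit UU).1.
have g0 i : 0 < g 0 i.
  have := Gp.2 (delta_mx 0 i *m U).
  rewrite mulmx_free_eq0 ?row_free_unit//.
  have -> : delta_mx 0 i != 0 :> 'rV[C]_p.
    by apply/eqP => /rowP/(_ i)/eqP; rewrite !mxE !eqxx oner_eq0.
  move=> /(_ isT); rewrite -form_congr.
  have -> : U *m G *m adjmx U = diag_mx g.
    by rewrite GE !mulmxA UU mul1mx -mulmxA UU mulmx1.
  rewrite form_diag (bigD1 i)//= big1.
    by rewrite !mxE !eqxx normr1 expr1n mulr1 addr0.
  by move=> j ji; rewrite !mxE eqxx (negPf ji) normr0 expr0n mulr0.
pose r : 'rV[C]_p := \row_i sqrtC (g 0 i).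
have rr i : r 0 i \is Num.real by rewrite mxE realE sqrtC_ge0 ltW.
pose Q := adjmx U *m diag_mx r.
have QQ : G = Q *m adjmx Q.
  rewrite /Q adjmxM adjmxK adjmx_diag_real// GE !mulmxA.
  congr (_ *m _); rewrite -mulmxA; congr (_ *m _).
  rewrite mulmx_diag; congr diag_mx; apply/rowP => i.
  by rewrite !mxE -expr2 sqrtCK.
have Qu : Q \in unitmx.
  by have := posdef_unit Gp; rewrite QQ unitmx_mul => /andP[].
pose K := invmx Q *m H *m adjmx (invmx Q).
have Kh : adjmx K = K by rewrite /K !adjmxM adjmxK Hh mulmxA.
have [V [d [VV dr KE]]] := spectral_decomp Kh.
have Vu : V \in unitmx by apply: (mulmx1_unit VV).1.
have VV' : adjmx V *m V = 1%:M by apply: mulmx1C.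
exists (V *m adjmx Q), d; split=> //.
- by rewrite unitmx_mul Vu adjmx_unit.
- by rewrite adjmxM adjmxK !mulmxA -(mulmxA Q) VV' mulmx1.
- rewrite adjmxM adjmxK.
  have -> : Q *m adjmx V *m diag_mx d *m (V *m adjmx Q) = Q *m K *m adjmx Q.
    by rewrite KE !mulmxA.
  rewrite /K !mulmxA mulmxV// mul1mx -mulmxA adjmx_inv mulVmx ?adjmx_unit//.
  by rewrite mulmx1.
Qed.

Lemma char_poly_similar p (S A : 'M[C]_p) : S \in unitmx ->
  char_poly (invmx S *m A *m S) = char_poly A.
Proof.
move=> Su; rewrite /char_poly.
have -> : char_poly_mx (invmx S *m A *m S) =
   map_mx polyC (invmx S) *m char_poly_mx A *m map_mx polyC S.
  rewrite /char_poly_mx mulmxBr mulmxBl !map_mxM; congr (_ - _).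
  by rewrite mul_mx_scalar -scalemxAl -map_mxM mulVmx// map_mx1 scalemx1.
rewrite !det_mulmx mulrAC -det_mulmx -map_mxM mulVmx// map_mx1 det1.
by rewrite mul1r.
Qed.

(** [eigenvalues] is a list obtained by choice; the characteristic polynomial determines it only up
    to order. *)
Lemma eigenvalues_perm p (A : 'M[C]_p) s :
  char_poly A = \prod_(z <- s) ('X - z%:P) -> perm_eq (eigenvalues A) s.
Proof.
rewrite /eigenvalues; case: closed_field_poly_normal => r /= E1 E2.
apply: prod_XsubC_eq; rewrite -E2 E1.
by rewrite (monicP (char_poly_monic A)) scale1r.
Qed.

Lemma char_poly_eigenvalues p (A : 'M[C]_p) :
  char_poly A = \prod_(z <- eigenvalues A) ('X - z%:P).
Proof.
rewrite /eigenvalues; case: closed_field_poly_normal => r /= {1}->.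
by rewrite (monicP (char_poly_monic A)) scale1r.
Qed.

Lemma eigenvalues_diag p (S : 'M[C]_p) (d : 'rV[C]_p) : S \in unitmx ->
  perm_eq (eigenvalues (invmx S *m diag_mx d *m S)) [seq d 0 i | i : 'I_p].
Proof.
move=> Su; apply: eigenvalues_perm; rewrite char_poly_similar//.
rewrite char_poly_trig; last exact: diag_mx_is_trig.
rewrite big_map big_enum /=; apply: eq_bigr => i _.
by rewrite !mxE eqxx mulr1n.
Qed.

Lemma size_eigenvalues p (A : 'M[C]_p) : size (eigenvalues A) = p.
Proof.
have := size_char_poly A; rewrite char_poly_eigenvalues size_prod_XsubC.
by case.
Qed.

Lemma sum_eigenvalues p (A : 'M[C]_p) : \sum_(z <- eigenvalues A) z = \tr A.
Proof.
case: p A => [|p] A.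
  rewrite [eigenvalues A]size0nil ?size_eigenvalues// big_nil.
  by rewrite /mxtrace big_ord0.
have := char_poly_trace A (ltn0Sn p).
rewrite char_poly_eigenvalues -[X in X.-1](size_eigenvalues A).
by rewrite coefPn_prod_XsubC ?size_eigenvalues// => /oppr_inj.
Qed.

Lemma count_map_ord p (P : pred C) (d : 'I_p -> C) :
  count P [seq d i | i : 'I_p] = #|[pred i | P (d i)]|.
Proof.
rewrite count_map cardE size_filter /enum_mem count_filter; apply: eq_count => x.
by rewrite !inE andbT.
Qed.

Section Inertia.
Variables (p : nat) (S : 'M[C]_p) (d : 'rV[C]_p).
Hypotheses (Su : S \in unitmx) (dr : forall i, d 0 i \is Num.real).
Let A := adjmx S *m diag_mx d *m S.
Let P := [pred i | 0 < d 0 i].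

(** Dimension count: more than [#|P|] rows admit a nonzero combination without component along the
    positive diagonal entries, and there the form is nonpositive. *)
Lemma inertia_le r (W : 'M[C]_(r, p)) :
  posdef (W *m A *m adjmx W) -> (r <= #|P|)%N.
Proof.
move=> [_ Wp]; rewrite leqNgt; apply/negP => ltr.
pose W' := W *m adjmx S.
pose K := \matrix_(i < r, j < #|P|) W' i (enum_val j).
have : kermx K != 0.
  by rewrite kermx_eq0 /row_free neq_ltn (leq_ltn_trans (rank_leq_col _)).
case/rowV0Pn => u /sub_kermxP uK uN0; have := Wp u uN0.
suff : (u *m (W *m A *m adjmx W) *m adjmx u) 0 0 <= 0.
  by move=> /le_lt_trans h /h; rewrite ltxx.
rewrite form_congr.
have -> : u *m W *m A *m adjmx (u *m W) = u *m W *m adjmx S *m diag_mx d *m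
    adjmx (u *m W *m adjmx S) by rewrite (adjmxM _ (adjmx S)) adjmxK !mulmxA.
rewrite form_diag; apply: sumr_le0 => i _.
have [di|] := boolP (0 < d 0 i); last first.
  rewrite -real_leNgt ?real0//; first by move=> di; rewrite mulr_le0_ge0 ?exprn_ge0.
have E : (u *m K) 0 (enum_rank_in (A := P) di i) = 0 by rewrite uK mxE.
rewrite mxE in E.
suff -> : (u *m W *m adjmx S) 0 i = 0 by rewrite normr0 expr0n mulr0.
rewrite -mulmxA mxE -[RHS]E; apply: eq_bigr => j _.
by rewrite [in RHS]mxE enum_rankK_in.
Qed.

Lemma inertia_ge r : (r <= #|P|)%N ->
  exists W : 'M[C]_(r, p), posdef (W *m A *m adjmx W).
Proof.
move=> rP; pose f (i : 'I_r) : 'I_p := enum_val (widen_ord rP i).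
have fI : injective f by move=> i j /enum_val_inj/(congr1 val)/= /val_inj.
have fP i : 0 < d 0 (f i) by have := enum_valP (widen_ord rP i).
exists (rowsub f 1%:M *m invmx (adjmx S)).
set W := rowsub f 1%:M.
suff -> : W *m invmx (adjmx S) *m A *m adjmx (W *m invmx (adjmx S)) =
   diag_mx (\row_i d 0 (f i)).
  by apply: posdef_diag => i; rewrite mxE.
rewrite adjmxM adjmx_inv adjmxK /A !mulmxA mulmxKV ?adjmx_unit//.
rewrite mulmxK//; apply/matrixP => i j; rewrite mul_mx_diag !mxE.
rewrite (bigD1 (f i))//= big1 => [|k ki]; last first.
  by rewrite !mxE eq_sym (negPf ki) mul0r mul0r.
rewrite !mxE eqxx mul1r addr0 conjC_nat mulr_natr.
by rewrite (inj_eq fI) eq_sym.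
Qed.

End Inertia.

(** Counting by test subspaces instead of eigenvalues: invariance under congruence and, positive
    definiteness being an open condition, stability under perturbation can then be read off. *)
Lemma num_pos_eigenvaluesP p (A : 'M[C]_p) r : adjmx A = A ->
  (r <= num_pos_eigenvalues A)%N <->
  exists W : 'M[C]_(r, p), posdef (W *m A *m adjmx W).
Proof.
move=> /spectral_decomp[U [d [UU dr ->]]].
have Uu : U \in unitmx by apply: (mulmx1_unit UU).1.
have -> : num_pos_eigenvalues (adjmx U *m diag_mx d *m U) =
          #|[pred i | 0 < d 0 i]|.
  rewrite /num_pos_eigenvalues -count_map_ord; apply/seq.permP.
  have <- : invmx U = adjmx U by rewrite -[RHS](mulKmx Uu) UU mulmx1.
  exact: eigenvalues_diag.
by split=> [|[W]]; [exact: inertia_ge | exact: inertia_le].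
Qed.

(** [S] is only invertible, so the [d i] need not be eigenvalues; the test subspaces see only their
    signs. *)
Lemma num_pos_eigenvalues_diag p (S : 'M[C]_p) (d : 'rV[C]_p) :
  S \in unitmx -> (forall i, d 0 i \is Num.real) ->
  num_pos_eigenvalues (adjmx S *m diag_mx d *m S) = #|[pred i | 0 < d 0 i]|.
Proof.
move=> Su dr; have Ah : adjmx (adjmx S *m diag_mx d *m S) =
    adjmx S *m diag_mx d *m S.
  by rewrite !adjmxM adjmxK adjmx_diag_real// mulmxA.
apply/eqP; rewrite eqn_leq; apply/andP; split.
  have /(num_pos_eigenvaluesP _ Ah)[W] := leqnn (num_pos_eigenvalues
    (adjmx S *m diag_mx d *m S)).
  exact: inertia_le.
by apply/(num_pos_eigenvaluesP _ Ah); exact: inertia_ge.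
Qed.

Lemma num_pos_eigenvalues_congr p (S A : 'M[C]_p) :
  S \in unitmx -> adjmx A = A ->
  num_pos_eigenvalues (S *m A *m adjmx S) = num_pos_eigenvalues A.
Proof.
move=> Su /spectral_decomp[U [d [UU dr ->]]].
have Uu : U \in unitmx by apply: (mulmx1_unit UU).1.
have -> : S *m (adjmx U *m diag_mx d *m U) *m adjmx S =
   adjmx (U *m adjmx S) *m diag_mx d *m (U *m adjmx S).
  by rewrite adjmxM adjmxK !mulmxA.
by rewrite !num_pos_eigenvalues_diag// unitmx_mul Uu adjmx_unit.
Qed.

Lemma num_pos_eigenvalues_posdef p (G : 'M[C]_p) : posdef G ->
  num_pos_eigenvalues G = p.
Proof.
move=> Gp; apply/eqP; rewrite eqn_leq; apply/andP; split.
  by rewrite /num_pos_eigenvalues -[leqRHS](size_eigenvalues G) count_size.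
apply/num_pos_eigenvaluesP; first by case: Gp.
by exists 1%:M; rewrite mul1mx adjmx1 mulmx1.
Qed.

Lemma posdef_det_gt0 p (G : 'M[C]_p) : posdef G -> 0 < \det G.
Proof.
move=> Gp; have [S [d [Su _ -> _]]] := simultaneous_diag Gp Gp.1.
rewrite det_mulmx /adjmx det_map_mx det_tr mulrC -normCK.
by rewrite exprn_gt0// normr_gt0 -unitfE -unitmxE.
Qed.

End HermitianForms.

(** * Schur complements and the horizontal part *)

Section HorizontalPart.
Variable C : numClosedFieldType.

Lemma num_pos_eigenvalues_block_diag m n (H : 'M[C]_m) (D : 'M[C]_n) :
  num_pos_eigenvalues (block_mx H 0 0 D) =
  (num_pos_eigenvalues H + num_pos_eigenvalues D)%N.
Proof.
rewrite /num_pos_eigenvalues -count_cat; apply/seq.permP.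
apply: eigenvalues_perm.
rewrite big_cat /= -!char_poly_eigenvalues /char_poly char_block_diag_mx.
by rewrite det_ublock.
Qed.

Section Schur.
Variables (m n : nat) (A : 'M[C]_(m + n)).
Hypotheses (Ah : adjmx A = A) (Dp : posdef (drsubmx A)).
Let T := block_mx 1%:M (ursubmx A *m invmx (drsubmx A)) 0 1%:M.

Lemma adjmx_ursubmx : adjmx (ursubmx A) = dlsubmx A.
Proof. by apply/matrixP => i j; rewrite -[in RHS]Ah !mxE. Qed.

Lemma adjmx_dlsubmx : adjmx (dlsubmx A) = ursubmx A.
Proof. by rewrite -adjmx_ursubmx adjmxK. Qed.

Lemma adjmx_ulsubmx : adjmx (ulsubmx A) = ulsubmx A.
Proof. by apply/matrixP => i j; rewrite -[in RHS]Ah !mxE. Qed.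

Lemma block_ldl :
  A = T *m block_mx (horizontal_part A) 0 0 (drsubmx A) *m adjmx T.
Proof.
have Du := posdef_unit Dp.
rewrite /T adjmx_block !adjmx1 adjmx0 adjmxM adjmx_inv Dp.1 adjmx_ursubmx.
rewrite !mulmx_block !mul1mx !mul0mx !mulmx1 !mulmx0 !add0r !addr0.
rewrite mulmxKV// mulKVmx// mulmxA.
by rewrite /horizontal_part subrK submxK.
Qed.

Lemma horizontal_part_herm : adjmx (horizontal_part A) = horizontal_part A.
Proof.
rewrite /horizontal_part adjmxD adjmxN !adjmxM adjmx_inv Dp.1.
by rewrite adjmx_ursubmx adjmx_dlsubmx adjmx_ulsubmx mulmxA.
Qed.

Lemma schur_unit : T \in unitmx.
Proof. by rewrite unitmxE det_ublock !det1 mulr1 unitr1. Qed.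

Lemma num_pos_eigenvalues_schur :
  num_pos_eigenvalues A = (num_pos_eigenvalues (horizontal_part A) + n)%N.
Proof.
rewrite {1}block_ldl num_pos_eigenvalues_congr ?schur_unit//; last first.
  by rewrite adjmx_block !adjmx0 horizontal_part_herm Dp.1.
by rewrite num_pos_eigenvalues_block_diag (num_pos_eigenvalues_posdef Dp).
Qed.

End Schur.

Lemma posdef_drsubmx m n (A : 'M[C]_(m + n)) : posdef A -> posdef (drsubmx A).
Proof.
move=> Ap; have := posdef_congr (W := row_mx 0 1%:M) Ap.
have -> : row_mx 0 1%:M *m A = row_mx (dlsubmx A) (drsubmx A).
  by rewrite -{1}[A]submxK mul_row_block !mul0mx !mul1mx !add0r.
have -> : adjmx (row_mx 0 1%:M) = col_mx 0 1%:M :> 'M[C]_(m + n, n).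
  by rewrite /adjmx tr_row_mx trmx0 trmx1 map_col_mx map_mx0 map_mx1.
rewrite mul_row_col mulmx0 mulmx1 add0r; apply.
by apply/row_freeP; exists (col_mx 0 1%:M); rewrite mul_row_col mul0mx mul1mx add0r.
Qed.

(** The horizontal part is the restriction of [A] to the [A]-orthogonal complement of the vertical
    directions, spanned by the rows of [row_mx 1%:M 0 *m invmx T]. *)
Lemma posdef_horizontal_part m n (A : 'M[C]_(m + n)) :
  posdef A -> posdef (horizontal_part A).
Proof.
move=> Ap; have Dp := posdef_drsubmx Ap; have Ah := Ap.1.
have Tu := schur_unit A.
have := block_ldl Ah Dp; set T := block_mx 1%:M _ _ _ => E.
have E2 : block_mx (horizontal_part A) 0 0 (drsubmx A) =
    invmx T *m A *m adjmx (invmx T).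
  rewrite [X in _ = _ *m X *m _]E !mulmxA mulVmx// mul1mx -mulmxA adjmx_inv mulmxV ?adjmx_unit//.
  by rewrite mulmx1.
have := posdef_congr (W := row_mx 1%:M 0 *m invmx T) Ap.
rewrite adjmxM !mulmxA -(mulmxA (row_mx _ _)) -(mulmxA (row_mx _ _)) -E2.
rewrite mul_row_block !mul0mx !mul1mx !addr0.
have -> : adjmx (row_mx 1%:M 0) = col_mx 1%:M 0 :> 'M[C]_(m + n, m).
  by rewrite /adjmx tr_row_mx trmx0 trmx1 map_col_mx map_mx0 map_mx1.
rewrite mul_row_col mulmx0 mulmx1 addr0; apply.
apply/row_freeP; exists (T *m col_mx 1%:M 0).
by rewrite mulmxA mulmxKV// mul_row_col mul0mx mul1mx addr0.
Qed.

(** This is behind the coordinate independence of Theta_H: Jacobians between adapted charts are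
    block triangular, and in the Schur complement every term containing [K] or [M] cancels. *)
Lemma horizontal_part_congr m n (A B : 'M[C]_(m + n)) (j : 'M[C]_m) K M :
  A = block_mx j K 0 M *m B *m adjmx (block_mx j K 0 M) ->
  drsubmx A \in unitmx -> drsubmx B \in unitmx ->
  horizontal_part A = j *m horizontal_part B *m adjmx j.
Proof.
rewrite -{1}[B]submxK adjmx_block adjmx0 !mulmx_block !mul0mx !mulmx0 !add0r.
move=> AE; rewrite /horizontal_part AE.
rewrite block_mxKul block_mxKur block_mxKdl block_mxKdr.
set Ba := ulsubmx B; set Bb := ursubmx B; set Bc := dlsubmx B.
set Bd := drsubmx B => Du Bdu.
(* [M] is a factor of the vertical block of [A], which is invertible. *)
have Mu : M \in unitmx by move: Du; rewrite !unitmx_mul => /andP[/andP[]].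
have -> : invmx (M *m Bd *m adjmx M) =
    invmx (adjmx M) *m invmx Bd *m invmx M.
  apply: (can_inj (mulKmx Du)); rewrite mulmxV// !mulmxA.
  by rewrite mulmxK ?adjmx_unit// mulmxK// mulmxV.
have -> : (j *m Bb + K *m Bd) *m adjmx M *m
    (invmx (adjmx M) *m invmx Bd *m invmx M) =
    (j *m Bb *m invmx Bd + K) *m invmx M.
  by rewrite !mulmxA mulmxK ?adjmx_unit// mulmxDl mulmxK.
have -> : M *m Bc *m adjmx j + M *m Bd *m adjmx K =
    M *m (Bc *m adjmx j + Bd *m adjmx K) by rewrite mulmxDr !mulmxA.
rewrite (mulmxA _ M) mulmxKV// !(mulmxDl, mulmxDr) !(mulmxN, mulNmx) !mulmxA.
rewrite (mulmxKV Bdu) !opprD.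
set x1 := j *m Ba *m _; set x2 := K *m Bc *m _; set x3 := j *m Bb *m adjmx K.
set x4 := K *m Bd *m _; set y := j *m Bb *m _ *m _ *m _.
rewrite (addrC (- y)) (addrC (- x2)) !addrA !(addrAC _ (- y)).
by congr (_ - y); rewrite (addrAC _ x4) !addrK.
Qed.

End HorizontalPart.

(** * Sums of relative eigenvalues *)

Section RelativeEigenvalues.
Variable C : numClosedFieldType.

Lemma rel_eigenvalues_diag p (S : 'M[C]_p) (q d : 'rV[C]_p) : S \in unitmx ->
  (forall i, q 0 i != 0) ->
  perm_eq (rel_eigenvalues (adjmx S *m diag_mx q *m S)
                           (adjmx S *m diag_mx d *m S))
          [seq d 0 i / q 0 i | i : 'I_p].
Proof.
move=> Su q0; rewrite /rel_eigenvalues.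
pose r : 'rV[C]_p := \row_i (q 0 i)^-1.
have rq : diag_mx r *m diag_mx q = 1%:M.
  rewrite mulmx_diag -diag_const_mx; congr diag_mx.
  by apply/rowP => i; rewrite !mxE mulVf.
have Qu : diag_mx q \in unitmx by have [] := mulmx1_unit rq.
have -> : invmx (adjmx S *m diag_mx q *m S) *m (adjmx S *m diag_mx d *m S) =
          invmx S *m diag_mx (\row_i (d 0 i / q 0 i)) *m S.
  have Bu : adjmx S *m diag_mx q *m S \in unitmx.
    by rewrite !unitmx_mul adjmx_unit Su Qu.
  apply: (can_inj (mulKmx Bu)); rewrite mulKVmx// !mulmxA mulmxK//.
  congr (_ *m _); rewrite -mulmxA mulmx_diag; congr (_ *m diag_mx _).
  by apply/rowP => i; rewrite !mxE mulrC divfK.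
have := eigenvalues_diag (\row_i (d 0 i / q 0 i)) Su.
by congr perm_eq; apply: eq_map => i; rewrite mxE.
Qed.

(** At most [m - k] entries fail to be at least [a], so a choice of [m - k + 1] entries contains one
    that is; each of the other [m - k] is at least [- b]. *)
Lemma sums_pos_criterion (s : seq C) (m k : nat) (a b : C) :
  size s = m -> (1 <= k <= m)%N -> 0 <= b ->
  all (fun z => (z \is Num.real) && (- b <= z)) s ->
  (k <= count (fun z => (a <= z)%R) s)%N ->
  b *+ (m - k) < a -> sums_pos (m - k + 1) s.
Proof.
move=> ss /andP[k1 km] b0 sb ka ab t ts tq.
have tb : all (fun z => (z \is Num.real) && (- b <= z)) t.
  by apply/allP => z zt; apply: (allP sb); exact: (mem_subseq ts).
have : has (fun z => a <= z) t.
  rewrite has_count lt0n; apply: contraL ka => /eqP t0; rewrite -ltnNge.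
  set P := fun z : C => (a <= z)%R.
  have := leq_count_subseq (predC P) ts.
  have := count_predC P s; have := count_predC P t; rewrite t0 ss tq.
  move: (count P s) (count (predC P) s) (count (predC P) t); lia.
move=> /hasP[z zt az].
rewrite (perm_big _ (perm_to_rem zt)) big_cons.
have : - (b *+ (m - k)) <= \sum_(j <- rem z t) j.
  have <- : size (rem z t) = (m - k)%N by rewrite size_rem// tq addn1.
  have : all (fun z => (z \is Num.real) && (- b <= z)) (rem z t).
    by apply/allP => y /mem_rem yt; exact: (allP tb).
  elim: (rem z t) => [|y u IH] /=; first by rewrite big_nil mulr0n oppr0.
  rewrite big_cons mulrS opprD => /andP[/andP[_ by_] /IH h].
  exact: lerD.
move=> h; rewrite -[ltLHS](subrr (b *+ (m - k))); apply: ltr_leD => //.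
exact: lt_le_trans az.
Qed.

(** With fewer than [k] positive entries, the nonpositive ones alone provide [m - k + 1] terms. *)
Lemma sums_pos_count (s : seq C) (m k : nat) :
  size s = m -> (1 <= k <= m)%N -> all (fun z => z \is Num.real) s ->
  sums_pos (m - k + 1) s -> (k <= count (fun z => (0 < z)%R) s)%N.
Proof.
move=> ss /andP[k1 km] sr sp; rewrite leqNgt; apply/negP => ck.
pose np := [seq z <- s | ~~ (0 < z)].
have sz : (m - k + 1 <= size np)%N.
  rewrite size_filter.
  have := count_predC (fun z => (0 < z)%R) s; rewrite ss; move: ck.
  rewrite -[count (predC _) s]/(count (fun z => ~~ (0 < z)%R) s).
  move: (count (fun z => (0 < z)%R) s) (count _ s) => u v; lia.
have := sp (take (m - k + 1) np) _ (size_takel sz).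
have -> : subseq (take (m - k + 1) np) s.
  exact: (subseq_trans (take_subseq _ _) (filter_subseq _ _)).
move=> /(_ isT); suff : \sum_(z <- take (m - k + 1) np) z <= 0.
  by move=> /le_lt_trans h /h; rewrite ltxx.
rewrite big_seq; apply: sumr_le0 => z /mem_take.
rewrite mem_filter => /andP[z0 zs]; rewrite real_leNgt ?real0//.
exact: (allP sr).
Qed.

Lemma sums_pos_all (s : seq C) : sums_pos (size s) s <-> 0 < \sum_(z <- s) z.
Proof.
split=> [/(_ s (subseq_refl s) erefl)//|s0 t ts /eqP].
by rewrite (size_subseq_leqif ts).2 => /eqP ->.
Qed.

(** The only subsequence of full length is the whole list, so the condition bears on the trace of
    [invmx B *m A]. Multiplication by the positive [\det B] replaces the inverse by the adjugate,
    which is what mixed determinants produce. *)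
Lemma sums_pos_tr m (B A : 'M[C]_m) : posdef B ->
  sums_pos m (rel_eigenvalues B A) <-> 0 < \tr (\adj B *m A).
Proof.
move=> Bp; have := sums_pos_all (rel_eigenvalues B A).
rewrite /rel_eigenvalues size_eigenvalues sum_eigenvalues => ->.
rewrite /invmx (posdef_unit Bp) -scalemxAl linearZ /=.
by rewrite pmulr_rgt0// invr_gt0 posdef_det_gt0.
Qed.

Lemma sums_pos_num_pos m k (B A : 'M[C]_m) :
  posdef B -> adjmx A = A -> (1 <= k <= m)%N ->
  sums_pos (m - k + 1) (rel_eigenvalues B A) -> (k <= num_pos_eigenvalues A)%N.
Proof.
move=> Bp Ah km; have [S [d [Su dr BE AE]]] := simultaneous_diag Bp Ah.
have BE' : B = adjmx S *m diag_mx (const_mx 1) *m S.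
  by rewrite BE diag_const_mx mulmx1.
have := rel_eigenvalues_diag (q := const_mx 1) d Su.
rewrite -AE -BE' => pe; have {}pe := pe (fun i => eq_ind_r (fun z => z != 0) (oner_neq0 C) (mxE _ _ _ _)).
move=> /sums_pos_count sp.
have -> : num_pos_eigenvalues A = count (fun z => (0 < z)%R) (rel_eigenvalues B A).
  rewrite (seq.permP pe) {1}AE num_pos_eigenvalues_diag// count_map_ord.
  by apply: eq_card => i; rewrite !inE mxE invr1 mulr1.
apply: sp => //; first last.
- rewrite (perm_all _ pe); apply/allP => z /mapP[i _ ->].
  by rewrite mxE invr1 mulr1.
- by rewrite /rel_eigenvalues size_eigenvalues.
Qed.

End RelativeEigenvalues.

(** * Reweighting a metric by a power of an endomorphism *)

Section DeformedMetric.
Variable C : numClosedFieldType.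

Definition deform m (Lam : C) N (G H : 'M[C]_m) : 'M[C]_m :=
  G *m ((2 * Lam)%:M - invmx G *m H) ^+ N.

Lemma conj_expr m (S A : 'M[C]_m) N : S \in unitmx ->
  (invmx S *m A *m S) ^+ N = invmx S *m A ^+ N *m S.
Proof.
move=> Su; elim: N => [|N IH]; first by rewrite !expr0 mulmx1 mulVmx.
by rewrite !exprS IH -!mulmxE !mulmxA mulmxK.
Qed.

Lemma diag_mx_expr m (d : 'rV[C]_m) N :
  diag_mx d ^+ N = diag_mx (\row_i d 0 i ^+ N).
Proof.
elim: N => [|N IH].
  have -> : \row_i d 0 i ^+ 0 = const_mx 1 by apply/rowP => i; rewrite !mxE.
  by rewrite expr0 diag_const_mx.
rewrite exprS IH -mulmxE mulmx_diag; congr diag_mx.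
by apply/rowP => i; rewrite !mxE exprS.
Qed.

(* In a basis where [G] is the identity and [H] is diagonal, the eigenvalues of
   [H] relative to [deform Lam N G H] are the [d i / (2 Lam - d i) ^ N]: large [N]
   favours the large positive ones. *)
Lemma deformed_metric m k N (G H : 'M[C]_m) (S : 'M[C]_m) (d : 'rV[C]_m)
    (Lam del : C) :
  S \in unitmx -> (forall i, d 0 i \is Num.real) ->
  G = adjmx S *m S -> H = adjmx S *m diag_mx d *m S ->
  (1 <= k <= m)%N -> (forall i, `|d 0 i| <= Lam) -> 0 < del ->
  (k <= #|[pred i | (del <= d 0 i)%R]|)%N ->
  (Lam *+ (m - k)) * (2 * Lam - del) ^+ N < del * (2 * Lam) ^+ N ->
  posdef (deform Lam N G H) /\
  sums_pos (m - k + 1) (rel_eigenvalues (deform Lam N G H) H).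
Proof.
move=> Su dr GE HE km dLam del0 kd hN; set B := deform Lam N G H.
have GH : invmx G *m H = invmx S *m diag_mx d *m S.
  have Gu : G \in unitmx by rewrite GE unitmx_mul adjmx_unit Su.
  by apply: (can_inj (mulKmx Gu)); rewrite mulKVmx// GE HE !mulmxA mulmxK.
pose q : 'rV[C]_m := \row_i (2 * Lam - d 0 i) ^+ N.
have BE : B = adjmx S *m diag_mx q *m S.
  rewrite /B /deform GH; have -> : (2 * Lam)%:M - invmx S *m diag_mx d *m S =
      invmx S *m diag_mx (\row_i (2 * Lam - d 0 i)) *m S.
    have -> : diag_mx (\row_i (2 * Lam - d 0 i)) = (2 * Lam)%:M - diag_mx d.
      by apply/matrixP => i j; rewrite !mxE mulrnBl.
    by rewrite mulmxBr mulmxBl mul_mx_scalar -scalemxAl mulVmx// scalemx1.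
  rewrite conj_expr// diag_mx_expr GE !mulmxA mulmxK//.
  by congr (_ *m diag_mx _ *m _); apply/rowP => i; rewrite !mxE.
(* [k] is at least 1, so some [d i] reaches [del]; this makes [Lam] and [2 * Lam - del] positive. *)
have [i0 di0] : exists i, i \in [pred i | (del <= d 0 i)%R].
  apply/fintype.card_gt0P; case/andP: km => k1 _; exact: leq_trans kd.
have Lam0 : 0 < Lam.
  move: di0; rewrite inE => di; apply: lt_le_trans (dLam i0); rewrite ger0_norm.
    exact: lt_le_trans di.
  exact: le_trans (ltW del0) di.
have dle i : - Lam <= d 0 i /\ d 0 i <= Lam.
  by apply/andP; rewrite -real_ler_norml.
have Ld i : 0 < 2 * Lam - d 0 i.
  rewrite subr_gt0 (le_lt_trans (dle i).2)// ltr_pMl// ltr1n//.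
have q0 i : 0 < q 0 i by rewrite mxE exprn_gt0.
split.
  rewrite BE -[X in _ *m X]adjmxK; apply: posdef_congr; first exact: posdef_diag.
  by rewrite row_free_unit adjmx_unit.
(* [a] bounds the good ratios [d i / q i] from below and [- b] bounds all of them; [hN] is
   [b *+ (m - k) < a] with the denominators cleared. *)
pose a := del / (2 * Lam - del) ^+ N; pose b := Lam / (2 * Lam) ^+ N.
have LL : 0 < 2 * Lam by rewrite mulr_gt0.
have Ldel : 0 < 2 * Lam - del.
  move: di0; rewrite inE => di; apply: lt_le_trans (Ld i0) _; exact: lerB.
have pe := rel_eigenvalues_diag d Su (fun i => lt0r_neq0 (q0 i)).
rewrite -BE -HE in pe.
apply: (@sums_pos_criterion _ _ m k a b) => //.
- by rewrite /rel_eigenvalues size_eigenvalues.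
- by rewrite divr_ge0// ?exprn_ge0// ltW.
- rewrite (perm_all _ pe); apply/allP => z /mapP[i _ ->].
  rewrite rpred_div//=; last exact: gtr0_real.
  have [di|di] := real_leP (real0 _) (dr i).
    apply: (@le_trans _ _ 0); last by rewrite divr_ge0// ltW.
    by rewrite oppr_le0 divr_ge0// ?exprn_ge0// ltW.
  rewrite lerNl -mulNr; apply: ler_pM.
  + by rewrite oppr_ge0 ltW.
  + by rewrite invr_ge0 ltW.
  + by rewrite lerNl (dle i).1.
  rewrite lef_pV2 ?posrE ?exprn_gt0// mxE.
  by apply: lerXn2r; rewrite ?nnegrE ?(ltW LL) ?(ltW (Ld i))// lerDl oppr_ge0 ltW.
- rewrite (seq.permP pe) count_map_ord (leq_trans kd)//.
  apply: subset_leq_card; apply/fintype.subsetP => i; rewrite !inE => di.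
  apply: ler_pM => //; first exact: ltW.
    by rewrite invr_ge0 exprn_ge0// ltW.
  rewrite lef_pV2 ?posrE ?exprn_gt0// mxE.
  by apply: lerXn2r; rewrite ?nnegrE ?(ltW Ldel) ?(ltW (Ld i))//; exact: lerB.
- rewrite /a /b -mulrnAl ltr_pdivrMr ?exprn_gt0// mulrAC.
  by rewrite ltr_pdivlMr ?exprn_gt0.
Qed.

End DeformedMetric.

(** * Row replacement and the adjugate *)

Section MixedDeterminants.
Variable C : numClosedFieldType.

Definition replace_row m (B A : 'M[C]_m) (i : 'I_m) : 'M[C]_m :=
  \matrix_(a, b) if a == i then A a b else B a b.

(** Expansion along the replaced row produces the cofactors of [B]; the sum is the coefficient of s
    in det (B + s A). *)
Lemma sum_det_replace_row m (B A : 'M[C]_m) :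
  \sum_i \det (replace_row B A i) = \tr (\adj B *m A).
Proof.
rewrite /mxtrace.
under [RHS]eq_bigr => j _ do rewrite mxE.
rewrite [RHS]exchange_big /=; apply: eq_bigr => i _.
rewrite (expand_det_row _ i); apply: eq_bigr => j _.
rewrite !mxE eqxx mulrC; congr (_ * _); rewrite /cofactor; congr (_ * \det _).
by apply/matrixP => a b; rewrite !mxE eq_sym (negPf (neq_lift _ _)).
Qed.

Lemma det_block_schur m n (A : 'M[C]_m) B D (E : 'M[C]_n) : E \in unitmx ->
  \det (block_mx A B D E) = \det E * \det (A - B *m invmx E *m D).
Proof.
move=> Eu; rewrite mulrC -(det_ublock _ B).
have dT : \det (block_mx 1%:M 0 (- (invmx E *m D)) 1%:M : 'M[C]_(m + n)) = 1.
  by rewrite det_lblock !det1 mulr1.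
rewrite -[LHS]mulr1 -dT -det_mulmx mulmx_block.
by rewrite !mulmx1 !mulmx0 !add0r !mulmxN !mulmxA mulmxV// mul1mx subrr.
Qed.

(** The rows taken from [B] vanish in the vertical columns, so eliminating the vertical block
    changes only the horizontal row that comes from [A], into a row of the horizontal part. *)
Lemma sum_det_replace_row_block m n (B : 'M[C]_m) (A : 'M[C]_(m + n)) :
  drsubmx A \in unitmx ->
  \sum_i \det (\matrix_(a, b) (if (a < m)%N && (a != lshift n i)
                               then block_mx B 0 0 0 a b else A a b)) =
  \det (drsubmx A) * \tr (\adj B *m horizontal_part A).
Proof.
move=> Du; rewrite -sum_det_replace_row mulr_sumr; apply: eq_bigr => i _.
pose B' := \matrix_(a, b) ((a == i)%:R * ursubmx A a b).
have -> : (\matrix_(a, b) (if (a < m)%N && (a != lshift n i)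
                 then block_mx B 0 0 0 a b else A a b)) =
    block_mx (replace_row B (ulsubmx A) i) B' (dlsubmx A) (drsubmx A).
  apply/matrixP => a b; rewrite [LHS]mxE.
  case: (split_ordP a) => a' ->; case: (split_ordP b) => b' ->.
  - rewrite block_mxEul block_mxEul /= (inj_eq (@lshift_inj _ _)).
    by rewrite !mxE; case: eqP.
  - rewrite block_mxEur block_mxEur /= (inj_eq (@lshift_inj _ _)).
    by rewrite !mxE; case: eqP; rewrite ?mul1r ?mul0r.
  - by rewrite /= block_mxEdl !mxE.
  - by rewrite /= block_mxEdr !mxE.
rewrite det_block_schur//; congr (_ * \det _).
apply/matrixP => a b; rewrite !mxE; case: eqP => [->|ai].
  congr (_ - _); apply: eq_bigr => l _; congr (_ * _).
  by rewrite !mxE; apply: eq_bigr => o _; rewrite !mxE eqxx mul1r.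
rewrite big1 ?subr0// => l _; rewrite mxE big1 ?mul0r// => o _.
by rewrite mxE; case: eqP => // _; rewrite !mul0r.
Qed.

End MixedDeterminants.

(** * Stability of positivity and uniform eigenvalue bounds *)

Section Perturbation.
Variable C : numClosedFieldType.

Lemma adjmxZ p q (c : C) (A : 'M[C]_(p, q)) : adjmx (c *: A) = c^* *: adjmx A.
Proof. by apply/matrixP => i j; rewrite !mxE rmorphM. Qed.

Lemma norm_congr_le p q (W : 'M[C]_(q, p)) (E : 'M[C]_p) (eps : C) i j :
  0 <= eps -> (forall a b, `|E a b| <= eps) ->
  `|(W *m E *m adjmx W) i j| <= (\sum_a \sum_b `|W a b|) ^+ 2 * eps.
Proof.
move=> e0 Ee; set w := \sum_a _.
have rw a : \sum_b `|W a b| <= w.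
  rewrite /w (bigD1 a)//= lerDl; apply: sumr_ge0 => c _; apply: sumr_ge0 => b _.
  exact: normr_ge0.
have w0 : 0 <= w by apply: sumr_ge0 => a _; apply: sumr_ge0 => b _; exact: normr_ge0.
have WE b : `|(W *m E) i b| <= w * eps.
  rewrite mxE; apply: le_trans (ler_norm_sum _ _ _) _.
  apply: le_trans (_ : (\sum_a `|W i a|) * eps <= _); last exact: ler_wpM2r.
  by rewrite mulr_suml; apply: ler_sum => a _; rewrite normrM ler_wpM2l.
rewrite mxE; apply: le_trans (ler_norm_sum _ _ _) _.
apply: le_trans (_ : \sum_b (w * eps) * `|W j b| <= _).
  apply: ler_sum => b _; rewrite normrM [adjmx W b j]mxE norm_conjC [W^T b j]mxE.
  by apply: ler_wpM2r; [exact: normr_ge0 | exact: WE].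
by rewrite -mulr_sumr expr2 mulrAC ler_wpM2r// ler_wpM2l.
Qed.

(** By [2 x y <= x ^ 2 + y ^ 2], the perturbation contributes at most [eps *+ p] times the squared
    length of [v]. *)
Lemma posdef_near1 p (B : 'M[C]_p) (eps : C) : adjmx B = B ->
  (forall i j, `|B i j - (i == j)%:R| <= eps) -> eps *+ p < 1 -> posdef B.
Proof.
move=> Bh Be ep; split=> // v vN0.
have [E BE] : exists E, B = 1%:M + E by exists (B - 1%:M); rewrite addrC subrK.
have Eh : adjmx E = E.
  by have := Bh; rewrite BE adjmxD adjmx1 => /addrI.
have Ee i j : `|E i j| <= eps.
  by have := Be i j; rewrite BE mxE [1%:M i j]mxE addrAC subrr add0r.
rewrite BE mulmxDr mulmxDl mulmx1.
set s : C := \sum_i `|v 0 i| ^+ 2.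
have sE : (v *m adjmx v) 0 0 = s.
  by rewrite mxE; apply: eq_bigr => i _; rewrite !mxE normCK.
have s0 : 0 < s.
  have h : 0 <= s by apply: sumr_ge0 => i _; rewrite exprn_ge0.
  rewrite lt0r h andbT; apply: contraNneq vN0 => /eqP.
  rewrite psumr_eq0 => [|i _]; last by rewrite exprn_ge0.
  move=> /allP vi; apply/eqP/rowP => i; rewrite mxE; apply/eqP.
  by have := vi i (mem_index_enum i); rewrite /= sqrf_eq0 normr_eq0.
set t := (v *m E *m adjmx v) 0 0.
have tr : t \is Num.real.
  apply/CrealP; rewrite /t -[in RHS]Eh.
  have -> : v *m adjmx E *m adjmx v = adjmx (v *m E *m adjmx v).
    by rewrite !adjmxM adjmxK mulmxA.
  by rewrite [RHS]mxE [X in _ = X^*]mxE.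
have tle : `|t| <= (eps *+ p) * s.
  rewrite /t mxE; apply: le_trans (ler_norm_sum _ _ _) _.
  apply: le_trans (_ : \sum_j \sum_i eps * (`|v 0 i| * `|v 0 j|) <= _).
    apply: ler_sum => j _; rewrite normrM !mxE norm_conjC.
    apply: le_trans (ler_wpM2r (normr_ge0 _) (ler_norm_sum _ _ _)) _.
    rewrite mulr_suml; apply: ler_sum => i _; rewrite normrM mulrAC mulrC.
    by apply: ler_wpM2r => //; rewrite mulr_ge0.
  apply: le_trans (_ : \sum_j \sum_i eps * ((`|v 0 i| ^+ 2 + `|v 0 j| ^+ 2) / 2) <= _).
    apply: ler_sum => j _; apply: ler_sum => i _; apply: ler_wpM2l.
      exact: le_trans (normr_ge0 _) (Ee i j).
    rewrite ler_pdivlMr// -subr_ge0.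
    have -> : `|v 0 i| ^+ 2 + `|v 0 j| ^+ 2 - `|v 0 i| * `|v 0 j| * 2 =
              (`|v 0 i| - `|v 0 j|) ^+ 2 by ring.
    by rewrite -realEsqr rpredB ?normr_real.
  rewrite (eq_bigr (fun j => (eps / 2) * (s + `|v 0 j| ^+ 2 *+ p))); last first.
    move=> j _; rewrite -mulr_sumr -mulr_suml big_split /= sumr_const card_ord.
    by rewrite mulrA mulrAC.
  rewrite -mulr_sumr big_split /= sumr_const card_ord sumrMnl -/s.
  suff -> : eps / 2 * (s *+ p + s *+ p) = eps *+ p * s by [].
  rewrite -mulr2n -mulrnA -[X in _ * X]mulr_natr -[in RHS]mulr_natr natrM.
  by field.
rewrite mxE sE -/t; apply: lt_le_trans (_ : s - `|t| <= _).
  rewrite subr_gt0; apply: le_lt_trans tle _.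
  by rewrite -[X in _ < X]mul1r ltr_pM2r.
by rewrite lerD2l; exact: real_lerNnormlW.
Qed.

(** Congruence by [W] carries [A0] to the identity, where entrywise closeness suffices; it enlarges
    the error by at most the factor [w]. *)
Lemma posdef_open p (A0 : 'M[C]_p) : posdef A0 -> exists2 eps : C, 0 < eps &
  forall A, adjmx A = A -> (forall i j, `|A i j - A0 i j| <= eps) -> posdef A.
Proof.
move=> Ap0; have h0 : adjmx (0 : 'M[C]_p) = 0 by rewrite adjmx0.
have [S [_ [Su _ AE _]]] := simultaneous_diag Ap0 h0.
pose W := invmx (adjmx S).
have Wu : W \in unitmx by rewrite unitmx_inv adjmx_unit.
have W1 : W *m A0 *m adjmx W = 1%:M.
  by rewrite /W AE mulKmx ?adjmx_unit// adjmx_inv adjmxK mulmxV.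
set w := (\sum_a \sum_b `|W a b|) ^+ 2.
have w0 : 0 <= w.
  by rewrite exprn_ge0//; apply: sumr_ge0 => a _; apply: sumr_ge0 => b _; exact: normr_ge0.
have q0 : 0 < (w + 1) * p.+1%:R by rewrite mulr_gt0// ltr_wpDl.
(* The two increments make the denominator positive even for [w = 0] or [p = 0], and the inequality
   [w * eps *+ p < 1] strict. *)
exists ((w + 1) * p.+1%:R)^-1 => [|A Ah Ae]; first by rewrite invr_gt0.
set eps := _^-1 in Ae; have e0 : 0 <= eps by rewrite invr_ge0 ltW.
have Bp : posdef (W *m A *m adjmx W).
  apply: (@posdef_near1 _ _ (w * eps)).
  - by rewrite !adjmxM adjmxK Ah mulmxA.
  - move=> i j.
    have -> : (W *m A *m adjmx W) i j - (i == j)%:R =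
              (W *m (A - A0) *m adjmx W) i j.
      by rewrite mulmxBr mulmxBl W1 [RHS]mxE [X in _ = _ + X]mxE [1%:M i j]mxE.
    apply: norm_congr_le => // a b.
    by rewrite mxE [(- A0) a b]mxE; exact: Ae.
  rewrite -mulr_natr mulrAC ltr_pdivrMr// mul1r mulrDl mul1r.
  by rewrite ltr_pwDr// ?ltr0Sn// ler_wpM2l// ler_nat.
have := posdef_congr (W := invmx W) Bp.
rewrite row_free_unit unitmx_inv Wu => /(_ isT).
by rewrite adjmx_inv !mulmxA mulVmx// mul1mx mulmxK// adjmx_unit.
Qed.

(** A single integer controls both the size of all relative eigenvalues and the lower bound on [k]
    of them, so that compactness can be applied to a property of all large [M]. *)
Definition pinched m k M (G H : 'M[C]_m) : Prop :=
  exists S, exists d : 'rV[C]_m,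
    [/\ S \in unitmx, forall i, d 0 i \is Num.real,
        G = adjmx S *m S & H = adjmx S *m diag_mx d *m S] /\
    (forall i, `|d 0 i| <= M%:R) /\
    (k <= #|[pred i | (M.+1%:R^-1 <= d 0 i)%R]|)%N.

Lemma pinched_congr m k M (j G H : 'M[C]_m) : j \in unitmx ->
  pinched k M G H -> pinched k M (j *m G *m adjmx j) (j *m H *m adjmx j).
Proof.
move=> ju [S [d [[Su dr -> ->] [dM kd]]]]; exists (S *m adjmx j), d.
split; last by [].
by split=> //; rewrite ?unitmx_mul ?Su ?adjmx_unit// adjmxM adjmxK !mulmxA.
Qed.

(** The relative eigenvalues [d i] are bounded through positive definiteness alone: that of
    [G + M^-1 H] and [G - M^-1 H] gives [|d i| <= M], and that of [H - M.+1^-1 G] on the subspace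
    [W], where [H0] is positive, gives [k] of them at least [M.+1^-1]. *)
Lemma pinched_open m k (G0 H0 : 'M[C]_m) : posdef G0 -> adjmx H0 = H0 ->
  (k <= num_pos_eigenvalues H0)%N ->
  exists2 eps : C, 0 < eps & forall G H M, posdef G -> adjmx H = H ->
  (forall i j, `|G i j - G0 i j| <= eps) ->
  (forall i j, `|H i j - H0 i j| <= eps) -> eps^-1 <= M%:R -> pinched k M G H.
Proof.
move=> Gp0 Hh0 /(num_pos_eigenvaluesP k Hh0)[W Wp].
have [e0 e00 He0] := posdef_open Gp0.
have [e1 e10 He1] := posdef_open Wp.
set w := (\sum_a \sum_b `|W a b|) ^+ 2.
have sum_ge0 q r (A : 'M[C]_(q, r)) : 0 <= \sum_a \sum_b `|A a b|.
  by apply: sumr_ge0 => a _; apply: sumr_ge0 => b _; exact: normr_ge0.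
have w0 : 0 <= w by rewrite exprn_ge0.
have entry_le q r (A : 'M[C]_(q, r)) i j : `|A i j| <= \sum_a \sum_b `|A a b|.
  rewrite (bigD1 i)//= (bigD1 j)//= -addrA lerDl addr_ge0//.
    by apply: sumr_ge0 => b _; exact: normr_ge0.
  by apply: sumr_ge0 => a _; apply: sumr_ge0 => b _; exact: normr_ge0.
(* With [eps = 1 / (1 + a + b)], each of [eps], [eps * a] and [eps * b] is at most 1. Adding
   [c *: H] with [|c| <= eps] to [G] moves an entry away from [G0] by at most [eps] plus [eps] times
   an entry of [H], itself at most 1 plus the sum for [H0]: hence the 2. *)
pose a := (2 + \sum_a \sum_b `|H0 a b|) / e0.
pose b := w * (2 + \sum_a \sum_b `|G0 a b|) / e1.
have a0 : 0 <= a by rewrite divr_ge0 ?addr_ge0// ltW.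
have b0 : 0 <= b by rewrite divr_ge0 ?mulr_ge0 ?addr_ge0// ltW.
have Q0 : 0 < 1 + a + b by rewrite ltr_wpDr// ltr_wpDr.
exists (1 + a + b)^-1; first by rewrite invr_gt0.
set eps := _^-1; have eps0 : 0 < eps by rewrite invr_gt0.
have eps1 : eps <= 1 by rewrite invf_le1// -addrA lerDl addr_ge0.
have epsa : eps * (2 + \sum_a \sum_b `|H0 a b|) <= e0.
  rewrite -[_ + _](divfK (lt0r_neq0 e00)) -/a mulrA ler_piMl ?(ltW e00)//.
  by rewrite mulrC ler_pdivrMr// mul1r addrAC lerDr addr_ge0.
have epsb : w * (eps * (2 + \sum_a \sum_b `|G0 a b|)) <= e1.
  rewrite mulrCA -[w * _](divfK (lt0r_neq0 e10)) -/b mulrA ler_piMl ?(ltW e10)//.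
  by rewrite mulrC ler_pdivrMr// mul1r lerDr addr_ge0.
move=> G H M Gp Hh Ge He; rewrite invrK => QM.
have M0 : 0 < M%:R :> C by exact: lt_le_trans QM.
have close q (A A0 B B0 : 'M[C]_q) (c : C) : `|c| <= eps ->
    (forall i j, `|A i j - A0 i j| <= eps) -> (forall i j, `|B i j - B0 i j| <= eps) ->
    forall i j, `|(A + c *: B) i j - A0 i j| <=
                eps * (2 + \sum_a \sum_b `|B0 a b|).
  move=> ce Ae Be i j; rewrite mxE [X in _ + X - _]mxE addrAC.
  apply: le_trans (ler_normD _ _) _; rewrite normrM.
  have Bij : `|B i j| <= 1 + \sum_a \sum_b `|B0 a b|.
    rewrite -[B i j](subrK (B0 i j)); apply: le_trans (ler_normD _ _) _.
    by rewrite lerD// (le_trans (Be i j)).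
  have -> : 2 + \sum_a \sum_b `|B0 a b| = 1 + (1 + \sum_a \sum_b `|B0 a b|).
    by rewrite addrA.
  by rewrite mulrDr mulr1 lerD// ler_pM.
have [S [d [Su dr GE HE]]] := simultaneous_diag Gp Hh.
have SAu : invmx (adjmx S) \in unitmx by rewrite unitmx_inv adjmx_unit.
have Minv : M%:R^-1 <= eps.
  by rewrite /eps lef_pV2.
have M1inv : M.+1%:R^-1 <= eps.
  by rewrite /eps lef_pV2// ?posrE ?ltr0Sn// (le_trans QM)// ler_nat.
(* In the diagonalising basis, positive definiteness of [G + c *: H] reads [0 < 1 + c * d i]; it is
   used for [c = M^-1] and [c = - M^-1]. *)
have upper c : c^* = c -> `|c| <= eps -> forall i, 0 < 1 + c * d 0 i.
  move=> cr ce i.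
  have Ap : posdef (G + c *: H).
    apply: He0; first by rewrite adjmxD Gp.1 adjmxZ cr Hh.
    by move=> i' j'; apply: le_trans epsa; exact: close.
  have := posdef_congr (W := invmx (adjmx S)) Ap.
  rewrite row_free_unit => /(_ SAu)[_ /(_ (delta_mx 0 i))].
  have -> : invmx (adjmx S) *m (G + c *: H) *m adjmx (invmx (adjmx S)) =
            diag_mx (\row_i (1 + c * d 0 i)).
    have -> : G + c *: H = adjmx S *m diag_mx (\row_i (1 + c * d 0 i)) *m S.
      have -> : diag_mx (\row_i (1 + c * d 0 i)) = 1%:M + c *: diag_mx d.
        apply/matrixP => x y; rewrite !mxE; case: (x == y).
          by rewrite !mulr1n.
        by rewrite !mulr0n mulr0 addr0.
      by rewrite mulmxDr mulmxDl mulmx1 -scalemxAr -scalemxAl GE HE.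
    by rewrite adjmx_inv adjmxK !mulmxA mulVmx ?adjmx_unit// mul1mx mulmxK.
  rewrite form_diag (bigD1 i)//= big1 ?addr0 => [|l li].
    rewrite !mxE !eqxx normr1 expr1n mulr1; apply.
    by apply/eqP => /rowP/(_ i)/eqP; rewrite !mxE !eqxx oner_eq0.
  by rewrite [X in `|X|]mxE (negPf li) andbF normr0 expr0n mulr0.
exists S, d; split; first by [].
have Mn : `|M%:R^-1| = M%:R^-1 :> C by rewrite ger0_norm// invr_ge0 ltW.
have Mr : M%:R^-1 \is @Num.real C by rewrite realV ger0_real// ler0n.
split=> [i|].
  have u1 := upper _ (CrealP Mr); have u2 := upper (- M%:R^-1).
  rewrite Mn in u1; rewrite normrN Mn (CrealP (rpredNr Mr)) in u2.
  rewrite real_ler_norml//; apply/andP; split.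
    have := u1 Minv i; rewrite -(ltr_pM2l M0) mulr0 mulrDr mulr1 mulVKf ?lt0r_neq0//.
    by rewrite -ltrBlDl sub0r => /ltW.
  have := u2 erefl Minv i; rewrite -(ltr_pM2l M0) mulr0 mulrDr mulr1 mulNr mulrN.
  by rewrite mulVKf ?lt0r_neq0// subr_gt0 => /ltW.
set del := M.+1%:R^-1 in M1inv *.
have del0 : 0 <= del by rewrite invr_ge0 ler0n.
have HS : H - del *: G = adjmx S *m diag_mx (\row_i (d 0 i - del)) *m S.
  have -> : diag_mx (\row_i (d 0 i - del)) = diag_mx d - del *: 1%:M.
    apply/matrixP => x y; rewrite !mxE; case: (x == y).
      by rewrite !mulr1n mulr1.
    by rewrite !mulr0n mulr0 subr0.
  by rewrite mulmxBr mulmxBl -scalemxAr mulmx1 -scalemxAl GE HE.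
have Wp' : posdef (W *m (H - del *: G) *m adjmx W).
  apply: He1.
    rewrite !adjmxM adjmxK mulmxA adjmxD adjmxN adjmxZ Hh Gp.1.
    by rewrite (CrealP (ger0_real del0)).
  move=> i j.
  have -> : (W *m (H - del *: G) *m adjmx W) i j - (W *m H0 *m adjmx W) i j =
            (W *m (H - del *: G - H0) *m adjmx W) i j.
    by rewrite [in RHS]mulmxBr [in RHS]mulmxBl [RHS]mxE [X in _ = _ + X]mxE.
  apply: le_trans epsb; apply: norm_congr_le.
    by rewrite mulr_ge0 ?addr_ge0// ltW.
  move=> x y; have := @close _ H H0 G G0 (- del) _ He Ge x y.
  rewrite normrN ger0_norm// => /(_ M1inv).
  by rewrite scaleNr [X in _ -> `|X| <= _]mxE [(- H0) x y]mxE.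
rewrite HS in Wp'.
have dr' i : (\row_i (d 0 i - del)) 0 i \is Num.real.
  by rewrite mxE rpredB// ger0_real.
have := inertia_le dr' Wp'; move/leq_trans; apply.
apply: subset_leq_card; apply/fintype.subsetP => i; rewrite !inE mxE subr_gt0.
exact: ltW.
Qed.

(** Bernoulli's inequality [1 + N / b <= (1 + 1 / b) ^ N], multiplied by [b ^ N.+1]. *)
Lemma bernoulli_nat (b N : nat) : (b ^ N * (b + N) <= b.+1 ^ N * b)%N.
Proof.
elim: N => [|N IH]; first by rewrite !expn0 !mul1n addn0.
have le : (b ^ N <= b.+1 ^ N)%N by case: (N) => // N'; rewrite leq_exp2r.
rewrite !expnS; move: (b ^ N)%N (b.+1 ^ N)%N le IH => u v le IH.
nia.
Qed.

(* The exponent that [deformed_metric] needs for [Lam = M] and [del = 1 / (M + 1)]. *)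
Lemma deform_exponent (M q : nat) : (0 < M)%N -> exists N : nat,
  (M%:R *+ q) * (2 * M%:R - M.+1%:R^-1) ^+ N < M.+1%:R^-1 * (2 * M%:R) ^+ N :> C.
Proof.
(* Over the common denominator [M.+1], the numbers [2 M] and [2 M - 1 / M.+1] have the consecutive
   numerators [a = b.+1] and [b]. The ratio of their powers must exceed [K], which Bernoulli's
   inequality gives for [N = K * b]. *)
move=> M0; pose a := (2 * M * M.+1)%N; pose b := a.-1.
have aE : a = b.+1 by rewrite prednK// !muln_gt0 M0.
pose K := (M.+1 * (M * q))%N; pose N := (K * b)%N.
have b0 : (0 < b)%N by rewrite /b /a; nia.
have KN : (K * b ^ N < b.+1 ^ N)%N.
  have := bernoulli_nat b N; rewrite {2}/N -mulSn mulnA leq_pmul2r//.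
  apply: leq_trans; rewrite mulnC ltn_pmul2l// expn_gt0 b0.
  by [].
exists N.
have s0 : 0 < M.+1%:R :> C by rewrite ltr0Sn.
have sN : M.+1%:R != 0 :> C by rewrite lt0r_neq0.
have -> : 2 * M%:R = b.+1%:R / M.+1%:R :> C.
  by rewrite -aE !natrM mulfK.
have -> : b.+1%:R / M.+1%:R - M.+1%:R^-1 = b%:R / M.+1%:R :> C.
  by rewrite -{2}[M.+1%:R^-1]mul1r -mulrBl -natr1 addrK.
rewrite !expr_div_n mulrA [X in _ < X]mulrA ltr_pM2r ?invr_gt0 ?exprn_gt0//.
rewrite -(ltr_pM2l s0) !mulrA divff// mul1r -[M%:R *+ q]mulr_natr.
by move: KN; rewrite -(ltr_nat C) natrM !natrX /K !natrM !mulrA.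
Qed.

(** [invmx G *m H] represents an endomorphism, so it changes by conjugation and so do its
    polynomials; the factor [G] turns the result back into a form. *)
Lemma deform_congr m Lam N (j G H : 'M[C]_m) : j \in unitmx -> G \in unitmx ->
  deform Lam N (j *m G *m adjmx j) (j *m H *m adjmx j) =
  j *m deform Lam N G H *m adjmx j.
Proof.
move=> ju Gu; have au : adjmx j \in unitmx by rewrite adjmx_unit.
have Iu : j *m G *m adjmx j \in unitmx by rewrite !unitmx_mul ju Gu.
rewrite /deform; have -> : (2 * Lam)%:M - invmx (j *m G *m adjmx j) *m (j *m H *m adjmx j) =
  invmx (adjmx j) *m ((2 * Lam)%:M - invmx G *m H) *m adjmx j.
  rewrite mulmxBr mulmxBl mul_mx_scalar -scalemxAl mulVmx// scalemx1; congr (_ - _).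
  apply: (can_inj (mulKmx Iu)); rewrite mulmxA mulmxV// mul1mx.
  by rewrite !mulmxA mulmxK// mulmxK.
by rewrite conj_expr// !mulmxA mulmxK// !mulmxA.
Qed.

End Perturbation.

(** * Exterior algebra *)

Section ExteriorRing.
Import mathcomp.boot.fintype mathcomp.boot.finset.
Local Close Scope classical_set_scope.
Variables (C : numClosedFieldType) (p : nat).
Implicit Types (A B D S : {set 'I_p}) (u v w : ext C p) (i j : 'I_p).

Lemma crossingsE A B :
  crossings A B = (\sum_(a in A) \sum_(b in B) (b < a)%N)%N.
Proof.
rewrite /crossings -sum1dep_card pair_big_dep /= big_mkcond [RHS]big_mkcond /=.
apply: eq_bigr => -[a b] _ /=.
by case: (a \in A); case: (b \in B) => //=; case: ltnP.
Qed.

Lemma sum_setU (F : 'I_p -> nat) A B : [disjoint A & B] ->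
  (\sum_(a in A :|: B) F a = \sum_(a in A) F a + \sum_(a in B) F a)%N.
Proof. by move=> AB; rewrite -bigU//; apply: eq_bigl => x; rewrite !inE. Qed.

Lemma crossingsUl A B D : [disjoint A & B] ->
  crossings (A :|: B) D = (crossings A D + crossings B D)%N.
Proof. by move=> AB; rewrite !crossingsE sum_setU. Qed.

Lemma crossingsUr A B D : [disjoint A & B] ->
  crossings D (A :|: B) = (crossings D A + crossings D B)%N.
Proof.
move=> AB; rewrite !crossingsE -big_split /=; apply: eq_bigr => a _.
exact: sum_setU.
Qed.

Lemma crossings0l A : crossings set0 A = 0%N.
Proof. by rewrite crossingsE big_set0. Qed.

Lemma crossings0r A : crossings A set0 = 0%N.
Proof. by rewrite crossingsE big1// => a _; rewrite big_set0. Qed.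

(** Both sides run over the ordered partitions of [S] into three sets; the signs agree because
    crossings are additive over disjoint unions in each argument. *)
Lemma wedgeA : associative (@wedge C p).
Proof.
move=> u v w; apply/ffunP => S; rewrite !ffunE.
under eq_bigr => B BS do rewrite ffunE big_distrr /=.
under [RHS]eq_bigr => A AS do rewrite ffunE big_distrr big_distrl /=.
rewrite [RHS](exchange_big_dep (fun B => B \subset S)) /=; last first.
  by move=> A B AS BA; exact: subset_trans AS.
apply: eq_bigr => B BS.
(* [B] is the first part of the partition, [D] the second and [A] their union. *)
rewrite [RHS](reindex_onto (fun D => B :|: D) (fun A => A :\: B)) /=; last first.
  move=> A /andP[_ BA]; apply/setP => x; rewrite !inE.
  by have := subsetP BA x; case: (x \in B) => //= ->.
apply: eq_big => [D|D DS].
  rewrite subsetUl andbT subUset BS /= subsetD; congr (_ && _).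
  rewrite setDUl setDv set0U -setI_eq0 setIC; apply/eqP/eqP => [DB|].
    by apply/setDidPl; rewrite -setI_eq0 setIC DB.
  by move/setDidPl; rewrite -setI_eq0 setIC => /eqP.
have [DS' DB] : D \subset S /\ [disjoint D & B].
  by move: DS; rewrite subsetD => /andP.
have -> : (B :|: D) :\: B = D.
  by rewrite setDUl setDv set0U; apply/setDidPl.
have -> : S :\: (B :|: D) = S :\: B :\: D by rewrite setDDl.
rewrite -!mulrA (mulrCA (u B)) !mulrA -!exprD; do 3 congr (_ * _).
have SBE : S :\: B = D :|: (S :\: B :\: D).
  apply/setP => x; rewrite !inE; have := subsetP DS' x.
  have := disjointFr DB (x := x).
  by case: (x \in D) => //= -> // ->.
have dis : [disjoint D & S :\: B :\: D].
  by rewrite -setI_eq0; apply/eqP/setP => x; rewrite !inE; case: (x \in D).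
rewrite {1}SBE crossingsUr// crossingsUl; last by rewrite disjoint_sym.
by congr (_ ^+ _); rewrite addnAC addnC addnA addnAC.
Qed.

Lemma wedge1u : left_id (ext_one C p) (@wedge C p).
Proof.
move=> u; apply/ffunP => S; rewrite ffunE (bigD1 set0) ?sub0set//= big1.
  by rewrite ffunE eqxx crossings0l setD0 !mulr1 mul1r addr0.
by move=> A /andP[_ A0]; rewrite ffunE (negPf A0) mulr0 mul0r.
Qed.

Lemma wedgeu1 : right_id (ext_one C p) (@wedge C p).
Proof.
move=> u; apply/ffunP => S; rewrite ffunE (bigD1 S)//= big1.
  by rewrite ffunE setDv eqxx crossings0r !mulr1 mul1r addr0.
move=> A /andP[AS neq]; rewrite ffunE setD_eq0.
suff /negPf-> : ~~ (S \subset A) by rewrite mulr0.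
by apply: contra neq => SA; rewrite eqEsubset AS.
Qed.

Lemma wedgeDl : left_distributive (@wedge C p) +%R.
Proof.
move=> u v w; apply/ffunP => S; rewrite !ffunE -big_split; apply: eq_bigr.
by move=> A _ /=; rewrite ffunE mulrDr mulrDl.
Qed.

Lemma wedgeDr : right_distributive (@wedge C p) +%R.
Proof.
move=> u v w; apply/ffunP => S; rewrite !ffunE -big_split; apply: eq_bigr.
by move=> A _ /=; rewrite ffunE mulrDr.
Qed.

Lemma wedgeZl c u v : wedge (c *: u) v = c *: wedge u v.
Proof.
apply/ffunP => S; rewrite !ffunE /= scaler_sumr; apply: eq_bigr => A _.
have -> : (c *: u) A = c * u A by rewrite ffunE.
by rewrite -[RHS]/(c * _) !mulrA [_ * c]mulrC.
Qed.

Lemma wedgeZr c u v : wedge u (c *: v) = c *: wedge u v.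
Proof.
apply/ffunP => S; rewrite !ffunE /= scaler_sumr; apply: eq_bigr => A _.
by rewrite ffunE /GRing.scale /= mulrCA.
Qed.

Lemma wedge_genE i v S :
  wedge (ext_gen C i) v S =
  if i \in S then (-1) ^+ crossings [set i] (S :\ i) * v (S :\ i) else 0.
Proof.
rewrite ffunE; case: ifPn => iS.
  rewrite (bigD1 [set i]) ?sub1set//= big1 ?addr0.
    by rewrite ffunE eqxx mulr1.
  by move=> A /andP[_ /negPf Ai]; rewrite ffunE Ai mulr0 mul0r.
rewrite big1// => A AS; rewrite ffunE; case: eqP => [E|_].
  by rewrite E sub1set (negPf iS) in AS.
by rewrite mulr0 mul0r.
Qed.

Lemma crossings11 i j : crossings [set i] [set j] = (j < i)%N.
Proof. by rewrite crossingsE !big_set1. Qed.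

Lemma wedge_genC i j :
  wedge (ext_gen C i) (ext_gen C j) = - wedge (ext_gen C j) (ext_gen C i).
Proof.
apply/ffunP => S; rewrite [RHS]ffunE !wedge_genE !ffunE.
have [<-|ij] := eqVneq i j.
  case: ifP => iS; last by rewrite oppr0.
  case: eqP => [/setP/(_ i)|]; last by rewrite mulr0 oppr0.
  by rewrite !inE eqxx.
case: ifPn => iS; case: ifPn => jS; rewrite ?oppr0//.
- have -> : (S :\ i == [set j]) = (S == [set i; j]).
    apply/eqP/eqP => [E|->]; first by rewrite -(setD1K iS) E.
    by apply/setP => x; rewrite !inE; case: eqP => [->|]//=; rewrite (negPf ij).
  have -> : (S :\ j == [set i]) = (S == [set i; j]).
    apply/eqP/eqP => [E|->]; first by rewrite -(setD1K jS) E setUC.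
    apply/setP => x; rewrite !inE; case: (eqVneq x j) => [->|]//=; last by rewrite orbF.
    by rewrite eq_sym (negPf ij).
  case: eqP => [->|]; rewrite ?mulr0 ?oppr0// !mulr1.
  have -> : [set i; j] :\ i = [set j].
    by apply/setP => x; rewrite !inE; case: eqP => [->|]//=; rewrite (negPf ij).
  have -> : [set i; j] :\ j = [set i].
    apply/setP => x; rewrite !inE; case: (eqVneq x j) => [->|]//=; last by rewrite orbF.
    by rewrite eq_sym (negPf ij).
  rewrite !crossings11; case: ltngtP => [_|_|/val_inj E].
  - by rewrite expr0 expr1 ?opprK.
  - by rewrite expr0 expr1 ?opprK.
  - by rewrite E eqxx in ij.
- case: eqP => [E|]; last by rewrite mulr0.
  by move: jS; have /setP/(_ j) := E; rewrite !inE eqxx => /andP[_ ->].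
- case: eqP => [E|]; last by rewrite mulr0 oppr0.
  by move: iS; have /setP/(_ i) := E; rewrite !inE eqxx => /andP[_ ->].
Qed.

End ExteriorRing.

(* The same module as [ext], with the wedge as ring product, which makes the
   distributivity lemmas for iterated operators available. *)
Definition extring (C : numClosedFieldType) (p : nat) : Type := ext C p.

HB.instance Definition _ C p := GRing.Lmodule.on (extring C p).
HB.instance Definition _ C p := GRing.Zmodule_isPzRing.Build (extring C p)
  (@wedgeA C p) (@wedge1u C p) (@wedgeu1 C p) (@wedgeDl C p) (@wedgeDr C p).

(** * Products of generators and their signs *)

Section ExteriorProducts.
Variables (C : numClosedFieldType) (p : nat).
Implicit Types (u v w : extring C p) (s : seq 'I_p) (i j : 'I_p).

Definition gen i : extring C p := ext_gen C i.
Definition genprod s : extring C p := \prod_(i <- s) gen i.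

Lemma extZl (c : C) u v : (c *: u) * v = c *: (u * v).
Proof. exact: wedgeZl. Qed.

Lemma extZr (c : C) u v : u * (c *: v) = c *: (u * v).
Proof. exact: wedgeZr. Qed.

Lemma genC i j : gen i * gen j = - (gen j * gen i).
Proof. exact: wedge_genC. Qed.

Lemma genprod_cons i s : genprod (i :: s) = gen i * genprod s.
Proof. by rewrite /genprod big_cons. Qed.

Lemma genprod_cat s t : genprod (s ++ t) = genprod s * genprod t.
Proof. by rewrite /genprod big_cat. Qed.

Lemma gen_genprodC i s :
  gen i * genprod s = (-1) ^+ size s *: (genprod s * gen i).
Proof.
elim: s => [|j s IH]; first by rewrite /genprod big_nil expr0 scale1r mul1r mulr1.
rewrite genprod_cons mulrA genC mulNr -!mulrA IH extZr exprS -scalerA.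
by rewrite scaleN1r.
Qed.

(** Moving the left generator past [s2] costs the same sign on both sides; then the two generators
    are adjacent and anticommute. *)
Lemma genprod_swap s1 s2 s3 i j :
  genprod (s1 ++ i :: s2 ++ j :: s3) = - genprod (s1 ++ j :: s2 ++ i :: s3).
Proof.
rewrite !genprod_cat !genprod_cons !genprod_cat !genprod_cons -mulrN; congr (_ * _).
have key (x y : 'I_p) : gen x * (genprod s2 * (gen y * genprod s3)) =
    (-1) ^+ size s2 *: (genprod s2 * (gen x * gen y) * genprod s3).
  by rewrite !mulrA gen_genprodC !extZl.
by rewrite !key genC mulrN mulNr scalerN.
Qed.

(** The coefficient at the set of entries of [s] is a product of signs. *)
Lemma genprod_neq0 s : uniq s -> genprod s != 0.
Proof.
move=> us; suff : (genprod s : ext C p) [set:: s]%SET != 0.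
  by apply: contra => /eqP ->; rewrite ffunE.
elim: s us => [_|i s IH /= /andP[is_ us]].
  have -> : genprod [::] = ext_one C p by rewrite /genprod big_nil.
  rewrite ffunE.
  have -> : [set:: [::]]%SET = finset.set0 :> {set 'I_p}.
    by apply/setP => x; rewrite !finset.inE.
  by rewrite eqxx oner_eq0.
have -> : genprod (i :: s) = wedge (ext_gen C i) (genprod s).
  by rewrite genprod_cons.
have E : ([set:: i :: s] :\ i)%SET = [set:: s]%SET.
  apply/setP => x; rewrite !finset.inE; case: eqP => //= ->.
  by rewrite (negPf is_).
rewrite wedge_genE !finset.inE eqxx /= E mulf_neq0 ?IH//.
by rewrite signr_eq0.
Qed.

End ExteriorProducts.

Section Alternating.
Variables (C : numClosedFieldType) (N p : nat).
Implicit Types (f g : 'I_N -> 'I_p).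

Definition fprod f : extring C p := \prod_(k < N) gen C (f k).

Lemma fprodE f : fprod f = genprod C [seq f k | k <- enum 'I_N].
Proof. by rewrite /fprod /genprod big_map enumT [index_enum _]unlock. Qed.

Lemma fprod_tperm f i j : i != j -> fprod (f \o tperm i j) = - fprod f.
Proof.
move=> ij; rewrite !fprodE.
suff key (s : seq 'I_N) : uniq s -> i \in s -> j \in s ->
    genprod C [seq (f \o tperm i j) k | k <- s] = - genprod C [seq f k | k <- s].
  by apply: key; rewrite ?enum_uniq ?mem_enum.
wlog : i j ij / (index i s <= index j s)%N => [H us is_ js|].
  have [le|lt] := leqP (index i s) (index j s); first exact: H.
  by rewrite tpermC H//; [rewrite eq_sym | exact: ltnW].
move=> + + is_; case/splitPr: is_ => s1 s2.
rewrite mem_cat inE eq_sym (negPf ij) /= index_cat.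
move=> le us /orP[js|js].
  have is1 : i \notin s1.
    by move: us; rewrite cat_uniq /= negb_or => /and3P[_ /andP[]].
  move: le; rewrite (negPf is1) /= eqxx addn0 index_cat js.
  by rewrite leqNgt index_mem js.
move: us {le}; case/splitPr: js => s2' s3 us.
have notin k : k \in s1 ++ s2' ++ s3 -> (i != k) && (j != k).
  have /perm_uniq E : perm_eq (s1 ++ i :: s2' ++ j :: s3)
      [:: i, j & s1 ++ s2' ++ s3].
    by apply/seq.permP => a; rewrite /= !count_cat /= !count_cat /=; lia.
  move: us; rewrite E /= inE negb_or -andbA => /and3P[_ is_ /andP[js _]] ks.
  by apply/andP; split; [apply: contraNneq is_ | apply: contraNneq js] => ->.
rewrite !map_cat /= !map_cat /= tpermL tpermR.
have E t : {subset t <= s1 ++ s2' ++ s3} ->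
    [seq (f \o tperm i j) k | k <- t] = [seq f k | k <- t].
  move=> ts; apply/eq_in_map => k /ts/notin/andP[ik jk] /=.
  by rewrite tpermD.
rewrite (E s1) ?(E s2') ?(E s3); first exact: genprod_swap.
all: by move=> k ks; rewrite !mem_cat ks ?orbT.
Qed.

Lemma fprod_perm f (s : 'S_N) : fprod (f \o s) = (-1) ^+ s *: fprod f.
Proof.
have [ts -> /allP dts] := prod_tpermP s.
elim: ts dts f => [_ f|t ts IH dts f].
  rewrite big_nil odd_perm1 expr0 scale1r; apply: eq_bigr => k _ /=.
  by rewrite perm1.
have tN : t.1 != t.2 by apply: dts; rewrite mem_head.
rewrite big_cons odd_permM odd_tperm tN.
have -> : f \o (tperm t.1 t.2 * \prod_(t <- ts) tperm t.1 t.2)%g =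
    (f \o (\prod_(t <- ts) tperm t.1 t.2)%g) \o tperm t.1 t.2.
  by apply/funext => k /=; rewrite permM.
rewrite fprod_tperm// IH => [|u uts]; last by apply: dts; rewrite inE uts orbT.
by rewrite signr_addb mulN1r scaleNr.
Qed.

(** The transposition of [i] and [j] fixes [f], so the product equals its own opposite. *)
Lemma fprod_noninj f i j : i != j -> f i = f j -> fprod f = 0.
Proof.
move=> ij fij; have := fprod_tperm f ij.
have -> : f \o tperm i j = f.
  by apply/funext => k /=; case: tpermP => [->|->|].
move=> E; have : (2 : C) *: fprod f = 0.
  by rewrite scalerDl scale1r {1}E addNr.
by move/eqP; rewrite scaler_eq0 pnatr_eq0 /= => /eqP.
Qed.

End Alternating.

(** * Forms of top degree as mixed discriminants *)

Section TopForms.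
Variables (C : numClosedFieldType) (N : nat).

Lemma gen_fprodC q p (f : 'I_q -> 'I_p) j :
  gen C j * fprod C f = (-1) ^+ q *: (fprod C f * gen C j).
Proof. by rewrite fprodE gen_genprodC size_map size_enum_ord. Qed.

(* Moving all the dz to the left of all the d\bar z costs a sign that only
   depends on the number of factors. *)
Lemma prod_pairs q p : exists2 e : C, e != 0 &
  forall f g : 'I_q -> 'I_p, \prod_(k < q) (gen C (f k) * gen C (g k)) =
    e *: (fprod C f * fprod C g).
Proof.
elim: q => [|q [e e0 He]].
  exists 1 => [|f g]; first exact: oner_neq0.
  by rewrite /fprod !big_ord0 scale1r mulr1.
exists ((-1) ^+ q * e) => [|f g]; first by rewrite mulf_neq0// signr_eq0.
rewrite /fprod !big_ord_recl.
have := He (f \o lift ord0) (g \o lift ord0); rewrite /fprod /= => ->.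
have := gen_fprodC (f \o lift ord0) (g ord0); rewrite /fprod /=.
set X := \prod_(i < q) gen C (f _); set Y := \prod_(i < q) gen C (g _).
move=> E; rewrite extZr -[in LHS]mulrA (mulrA (gen C (g ord0))) E.
by rewrite extZl extZr scalerA mulrC !mulrA.
Qed.

Definition gen2 (a b : 'I_N) : extring C (N + N) :=
  gen C (lshift N a) * gen C (rshift N b).

Definition gen_top : extring C (N + N) := \prod_(k < N) gen2 k k.

(** The reordering constant of [prod_pairs] is the same on both sides, which leaves the signs of the
    two permutations. *)
Lemma prod_gen2_perm (s t : 'S_N) :
  \prod_(k < N) gen2 (s k) (t k) = ((-1) ^+ s * (-1) ^+ t) *: gen_top.
Proof.
have [e e0 He] := prod_pairs N (N + N).
rewrite /gen_top /gen2 !He.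
have := fprod_perm C (@lshift N N) s; rewrite /fprod /= => ->.
have := fprod_perm C (@rshift N N) t; rewrite /fprod /= => ->.
by rewrite extZl extZr !scalerA; congr (_ *: _); rewrite [RHS]mulrC mulrA.
Qed.

Lemma prod_gen2_noninj (f g : {ffun 'I_N -> 'I_N}) :
  ~~ injectiveb f || ~~ injectiveb g -> \prod_(k < N) gen2 (f k) (g k) = 0.
Proof.
have [e e0 He] := prod_pairs N (N + N); rewrite /gen2 He.
case/orP => /injectivePn[i [j ij E]].
  by rewrite (fprod_noninj _ ij) ?E// mul0r scaler0.
by rewrite (@fprod_noninj _ _ _ (fun k => rshift N (g k)) _ _ ij) ?E// mulr0 scaler0.
Qed.

Lemma gen_top_neq0 : gen_top != 0.
Proof.
have [e e0 He] := prod_pairs N (N + N).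
rewrite /gen_top /gen2 He scaler_eq0 (negPf e0) /= !fprodE -genprod_cat.
apply: genprod_neq0; rewrite cat_uniq; apply/and3P; split.
- by rewrite map_inj_uniq ?enum_uniq//; exact: lshift_inj.
- apply/hasPn => x /mapP[i _ ->]; apply/negP => /mapP[j _].
  by move/eqP; rewrite eq_sym eq_lrshift.
- by rewrite map_inj_uniq ?enum_uniq//; exact: rshift_inj.
Qed.

Lemma sum_ffun_perm (V : zmodType) (F : {ffun 'I_N -> 'I_N} -> V) :
  (forall f : {ffun 'I_N -> 'I_N}, ~~ injectiveb f -> F f = 0) ->
  \sum_f F f = \sum_(s : 'S_N) F (pval s).
Proof.
move=> F0; rewrite (bigID (fun f : {ffun 'I_N -> 'I_N} => injectiveb f)) /= addrC.
rewrite big1 ?add0r//; rewrite (reindex (@pval _)) /=; last first.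
  pose in_Sn := insubd (1%g : 'S_N).
  by exists in_Sn => /= f Uf; first apply: val_inj; apply: insubdK.
by apply: eq_bigl => s; rewrite (valP s).
Qed.

Lemma prodZ q p (c : 'I_q -> C) (u : 'I_q -> extring C p) :
  \prod_k (c k *: u k) = (\prod_k c k) *: \prod_k u k.
Proof.
elim: q c u => [|q IH] c u; first by rewrite !big_ord0 scale1r.
by rewrite !big_ord_recl IH extZl extZr scalerA.
Qed.

Lemma form11E (A : 'M[C]_N) :
  form11 A = \sum_a \sum_b ('i * A a b) *: gen2 a b.
Proof. by []. Qed.

Lemma vol_formE : vol_form C N = 'i ^+ N *: gen_top.
Proof.
have -> : vol_form C N = \prod_(k < N) ('i *: gen2 k k) by [].
by rewrite prodZ prodr_const card_ord.
Qed.

Lemma vol_form_neq0 : vol_form C N != 0.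
Proof.
by rewrite vol_formE scaler_eq0 expf_eq0 (negPf (neq0Ci _)) andbF /= gen_top_neq0.
Qed.

(** This is the mixed discriminant of the [A k]: only pairs of permutations survive in the
    expansion, and the sum over the second one, taken relative to the first one [s], is a Leibniz
    determinant whose row [a] comes from the factor number [s^-1 a]. *)
Lemma prod_form11 (A : 'I_N -> 'M[C]_N) :
  \prod_(k < N) (form11 (A k) : extring C (N + N)) =
  (\sum_(s : 'S_N) \det (\matrix_(a, b) A (s^-1%g a) a b)) *: vol_form C N.
Proof.
under eq_bigr do rewrite form11E.
rewrite bigA_distr_bigA /=.
under eq_bigr => f _ do rewrite bigA_distr_bigA /=.
rewrite sum_ffun_perm => [|f fN]; last first.
  by rewrite big1// => g _; rewrite prodZ prod_gen2_noninj ?fN// scaler0.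
rewrite scaler_suml; apply: eq_bigr => s _.
rewrite sum_ffun_perm => [|g gN]; last first.
  by rewrite prodZ prod_gen2_noninj ?gN ?orbT// scaler0.
rewrite /determinant scaler_suml (reindex_inj (mulgI s)); apply: eq_bigr => r _.
rewrite prodZ !pvalE prod_gen2_perm vol_formE !scalerA; congr (_ *: _).
rewrite big_split /= prodr_const card_ord odd_permM signr_addb.
rewrite [X in _ = _ * X * _](reindex_perm s) /=.
have -> : \prod_i A i (s i) ((s * r)%g i) =
    \prod_i (\matrix_(a, b) A (s^-1%g a) a b) (s i) (r (s i)).
  by apply: eq_bigr => i _; rewrite mxE permK permM.
by rewrite mulrA -expr2 sqrr_sign mul1r mulrC mulrA mulrAC.
Qed.

Lemma positive_top_vol (c : C) : positive_top (c *: vol_form C N) <-> 0 < c.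
Proof.
split=> [[d d0 /eqP]|c0]; last by exists c.
rewrite -subr_eq0 -scalerBl scaler_eq0 (negPf vol_form_neq0) orbF subr_eq0.
by move/eqP => ->.
Qed.

End TopForms.

Lemma ext_powE (C : numClosedFieldType) p (u : ext C p) k :
  ext_pow u k = (u : extring C p) ^+ k.
Proof. by elim: k => [|k IH]; rewrite ?expr0// exprS -IH. Qed.

(** * The two wedge products as traces *)

Section TraceForms.
Variable C : numClosedFieldType.

(** With [H] in slot 0 and [B] in the others, the determinant attached to [s] depends only on the
    row [s ord0] that is taken from [H], and each row arises equally often. The constant is that
    multiplicity. *)
Lemma wedge_top_adj m (H B : 'M[C]_m) : (0 < m)%N ->
  exists2 c : C, 0 < c &
    wedge (form11 H) (ext_pow (form11 B) (m - 1)) =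
    (c * \tr (\adj B *m H)) *: vol_form C m.
Proof.
case: m H B => // m H B _; rewrite subn1 /= ext_powE.
pose A (k : 'I_m.+1) := if k == ord0 then H else B.
have -> : wedge (form11 H) ((form11 B : extring C _) ^+ m) =
    \prod_(k < m.+1) (form11 (A k) : extring C (m.+1 + m.+1)).
  by rewrite big_ord_recl /A eqxx /= prodr_const card_ord.
rewrite prod_form11.
pose K i := #|[pred s : 'S_m.+1 | s ord0 == i]|.
have KE i : K i = K ord0.
  rewrite /K -!sum1_card (reindex_inj (mulIg (tperm ord0 i))) /=.
  apply: eq_bigl => s.
  by rewrite !inE permM (canF_eq (tpermK _ _)) tpermR.
have K0 : (0 < K ord0)%N.
  by apply/fintype.card_gt0P; exists 1%g; rewrite inE perm1.
exists (K ord0)%:R; first by rewrite ltr0n.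
congr (_ *: _); rewrite -sum_det_replace_row mulr_sumr.
rewrite (partition_big (fun s : 'S_m.+1 => s ord0) predT) //=.
apply: eq_bigr => i _; rewrite mulr_natl -(KE i) -sumr_const.
apply: eq_big => [s|s /eqP si]; first by rewrite !inE.
congr (\det _); apply/matrixP => a b; rewrite !mxE /A.
by rewrite (canF_eq (permKV s)) si; case: eqP.
Qed.

(** Each determinant takes [n.+1] rows from [A] and [m - 1] from [B'], whose vertical rows are zero.
    It survives only if [A] supplies all vertical rows and one horizontal row;
    [sum_det_replace_row_block] evaluates the sum over that row. *)
Lemma wedge_top_schur m n (A : 'M[C]_(m + n)) (B : 'M[C]_m) : (0 < m)%N ->
  drsubmx A \in unitmx ->
  exists2 c : C, 0 < c &
    wedge (ext_pow (form11 A) n.+1)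
          (ext_pow (form11 (block_mx B 0 0 0 : 'M[C]_(m + n))) (m - 1)) =
    (c * (\det (drsubmx A) * \tr (\adj B *m horizontal_part A)))
      *: vol_form C (m + n).
Proof.
have L (k : 'I_m) : (m <= lshift n k)%N = false.
  by apply/negbTE; rewrite -ltnNge; exact: (ltn_ord k).
move=> m0 Du; set B' := block_mx B 0 0 0.
pose F (k : 'I_(m + n)) := if (k < n.+1)%N then A else B'.
have -> : wedge (ext_pow (form11 A) n.+1) (ext_pow (form11 B') (m - 1)) =
    \prod_(k < m + n) (form11 (F k) : extring C _).
  rewrite !ext_powE.
  rewrite -(big_mkord predT (fun k => form11 (if (k < n.+1)%N then A else B') : extring C _)).
  rewrite (big_cat_nat (n := n.+1))//=; last by rewrite -addn1 addnC leq_add2r.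
  rewrite -[LHS]/((form11 A : extring C _) ^+ n.+1 * (form11 B' : extring C _) ^+ (m - 1)).
  apply: (congr2 (@GRing.mul (extring C (m + n + (m + n))))); apply/esym.
    rewrite -[n.+1 in RHS]subn0 -prodr_const_nat; apply: eq_big_nat => k.
    by move=> /andP[_ ->].
  have -> : (m - 1 = m + n - n.+1)%N by lia.
  rewrite -prodr_const_nat; apply: eq_big_nat => k /andP[nk _].
  by rewrite ltnNge nk.
rewrite prod_form11.
(* Under [s], the rows coming from [A] are all the vertical ones and the single horizontal row
   [i]. *)
pose cond (i : 'I_m) (s : 'S_(m + n)) := [forall a : 'I_(m + n),
  (s^-1%g a < n.+1)%N == ((m <= a)%N || (a == lshift n i))].
pose K i := #|[pred s | cond i s]|.
have KE i j : K i = K j.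
  set t := tperm (lshift n i) (lshift n j).
  have tE a : (m <= t a)%N || (t a == lshift n i) = (m <= a)%N || (a == lshift n j).
    rewrite (canF_eq (tpermK _ _)) tpermL; congr (_ || _).
    by rewrite /t; case: tpermP => [->|->|//]; rewrite !L.
  rewrite /K -!sum1_card (reindex_inj (mulIg t)) /=.
  apply: eq_bigl => s; rewrite !inE.
  apply/forallP/forallP => h a; first by have := h (t a); rewrite tE invMg permM tpermV tpermK.
  by rewrite invMg permM tpermV (eqP (h _)) -tE tpermK.
have K0 i : (0 < K i)%N.
  have m1 : (m.-1 < m)%N by rewrite ltn_predL.
  rewrite (KE i (Ordinal m1)).
  (* Reversal matches the last horizontal row and the [n] vertical rows with the first [n.+1]
     slots. *)
  apply/fintype.card_gt0P; exists (perm (@rev_ord_inj (m + n))).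
  rewrite inE; apply/forallP => a.
  have -> : (perm (@rev_ord_inj (m + n)))^-1%g a = rev_ord a.
    by apply: (@perm_inj _ (perm (@rev_ord_inj (m + n)))); rewrite permKV permE rev_ordK.
  rewrite -(inj_eq val_inj) /=; apply/eqP.
  by move: (ltn_ord a); case: eqP; case: leqP; lia.
have [i0 _] : exists i : 'I_m, true by exists (Ordinal m0).
exists (K i0)%:R; first by rewrite ltr0n.
congr (_ *: _); rewrite -(sum_det_replace_row_block B Du) mulr_sumr.
pose D i := \det (\matrix_(a, b) (if (a < m)%N && (a != lshift n i) then B' a b else A a b)).
transitivity (\sum_(s : 'S_(m + n)) \sum_(i | cond i s) D i); last first.
  rewrite (exchange_big_dep predT) //=; apply: eq_bigr => i _.
  by rewrite sumr_const mulr_natl (KE i0 i).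
apply: eq_bigr => s _.
have condD i : cond i s -> \det (\matrix_(a, b) F (s^-1%g a) a b) = D i.
  move=> /forallP ci; congr (\det _); apply/matrixP => a b; rewrite [LHS]mxE [RHS]mxE /F.
  rewrite (eqP (ci a)) (ltnNge a m); case: (m <= a)%N => //=.
  by case: (a == lshift n i).
have [[i ci]|nc] := pselect (exists i, cond i s).
  rewrite (condD _ ci) (big_pred1 i)// => j; apply/idP/eqP => [cj|->//].
  have := forallP ci (lshift n j); have := forallP cj (lshift n j).
  rewrite eqxx orbT => /eqP ->; rewrite eq_sym L /= eqb_id.
  by rewrite (inj_eq (@lshift_inj _ _)) => /eqP.
rewrite big1 => [|i ci]; last by case: nc; exists i.
(* Pigeonhole: if the [n] vertical rows all came from the [n.+1] slots of [A], exactly one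
   horizontal row would be left for these slots and [cond] would hold. So some vertical row comes
   from [B'] and is zero. *)
have [a am an] : exists2 a : 'I_(m + n), (m <= a)%N & (n.+1 <= s^-1%g a)%N.
  apply: contrapT => no.
  pose T := [set a : 'I_(m + n) | (s^-1%g a < n.+1)%N]%SET.
  pose Low := [set a : 'I_(m + n) | (m <= a)%N]%SET.
  have LT : Low \subset T.
    apply/fintype.subsetP => a; rewrite !inE => am; rewrite ltnNge.
    by apply/negP => an; apply: no; exists a.
  have card_lt q : (q <= m + n)%N -> #|[set k : 'I_(m + n) | (k < q)%N]%SET| = q.
    move=> qmn; rewrite -sum1dep_card (big_ord_narrow qmn).
    by rewrite sum1_card card_ord.
  have cT : #|T| = n.+1.
    rewrite -(card_lt n.+1); last by rewrite -addn1 addnC leq_add2r.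
    rewrite -[RHS](card_imset _ (@perm_inj _ s)).
    apply: eq_card => a; rewrite inE; apply/idP/imsetP => [h|[k]].
      by exists (s^-1%g a); rewrite ?inE ?permKV.
    by rewrite inE => kn ->; rewrite permK.
  have cL : #|Low| = n.
    have := cardsC Low; rewrite card_ord.
    have -> : (~: Low)%SET = [set k : 'I_(m + n) | (k < m)%N]%SET.
      by apply/setP => a; rewrite !inE ltnNge.
    by rewrite card_lt ?leq_addr// addnC => /addnI.
  have /cards1P[c Tc] : #|(T :\: Low)%SET| == 1%N.
    by rewrite cardsD (finset.setIidPr LT) cT cL subSnn.
  have : c \in (T :\: Low)%SET by rewrite Tc inE.
  rewrite !inE -ltnNge => /andP[cm _]; apply: nc.
  exists (Ordinal cm); apply/forallP => a; apply/eqP.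
  have := congr1 (fun E : {set _} => a \in E) Tc.
  rewrite /= !inE -(inj_eq val_inj) /=.
  have := fintype.subsetP LT a; rewrite !inE.
  by case: (m <= a)%N => /= [/(_ isT) -> _|_ ->].
rewrite (expand_det_row _ a) big1// => b _; rewrite mxE /F ltnNge an /= /B'.
case: (split_ordP a) am => a' -> am; first by rewrite L in am.
by case: (split_ordP b) => b' ->; rewrite ?block_mxEdl ?block_mxEdr mxE mul0r.
Qed.

End TraceForms.

(** * Wirtinger calculus *)

Section ComplexNorm.
Variable R : realType.
Local Notation C := (Cplx R).
Implicit Types (z w : C) (r : R).

(** [|z|] is a complex number; the estimates below take place in [R], where the order is total and
    suprema exist. *)
Definition cnorm z : R := reC `|z|.

Lemma normC_cnorm z : `|z| = toC (cnorm z).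
Proof. by rewrite /cnorm [`|z|]normc_def. Qed.

Lemma cnormE z : cnorm z = Num.sqrt (reC z ^+ 2 + imC z ^+ 2).
Proof. by rewrite /cnorm normc_def. Qed.

Lemma toC_inj : injective (@toC R).
Proof. by move=> x y []. Qed.

Lemma toCD x y : toC (x + y) = toC x + toC y :> C.
Proof. by rewrite /toC rmorphD. Qed.
Lemma toCB x y : toC (x - y) = toC x - toC y :> C.
Proof. by rewrite /toC rmorphB. Qed.
Lemma toCN x : toC (- x) = - toC x :> C.
Proof. by rewrite /toC rmorphN. Qed.
Lemma toCM x y : toC (x * y) = toC x * toC y :> C.
Proof. by rewrite /toC rmorphM. Qed.
Lemma toC0 : toC 0 = 0 :> C.
Proof. by rewrite /toC rmorph0. Qed.
Lemma toC1 : toC 1 = 1 :> C.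
Proof. by rewrite /toC rmorph1. Qed.
Lemma toCMn x n : toC (x *+ n) = toC x *+ n :> C.
Proof. by rewrite /toC rmorphMn. Qed.
Lemma toCV x : toC x^-1 = (toC x)^-1 :> C.
Proof. by rewrite /toC fmorphV. Qed.
Lemma ltC r s : (toC r < toC s :> C) = (r < s).
Proof. exact: ltcR. Qed.
Lemma leC r s : (toC r <= toC s :> C) = (r <= s).
Proof. exact: lecR. Qed.

Lemma re_toC r : reC (toC r) = r.
Proof. by []. Qed.
Lemma im_toC r : imC (toC r) = 0.
Proof. by []. Qed.
Lemma reCD z w : reC (z + w) = reC z + reC w.
Proof. by case: z; case: w. Qed.
Lemma imCD z w : imC (z + w) = imC z + imC w.
Proof. by case: z; case: w. Qed.
Lemma reCN z : reC (- z) = - reC z.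
Proof. by case: z. Qed.
Lemma imCN z : imC (- z) = - imC z.
Proof. by case: z. Qed.
Lemma reCM z w : reC (z * w) = reC z * reC w - imC z * imC w.
Proof. by case: z; case: w. Qed.
Lemma imCM z w : imC (z * w) = reC z * imC w + imC z * reC w.
Proof. by case: z; case: w. Qed.
Lemma reJ z : reC z^* = reC z.
Proof. by case: z. Qed.
Lemma imJ z : imC z^* = - imC z.
Proof. by case: z. Qed.
Lemma Ci_def : 'i = Complex 0 1 :> C.
Proof. exact: esym (complexiE R). Qed.
Lemma reCi : reC ('i : C) = 0.
Proof. by rewrite Ci_def. Qed.
Lemma imCi : imC ('i : C) = 1.
Proof. by rewrite Ci_def. Qed.

Lemma CE z : z = toC (reC z) + 'i * toC (imC z).
Proof. by rewrite Ci_def; exact: complexE. Qed.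

Lemma reim_eq z w : reC z = reC w -> imC z = imC w -> z = w.
Proof. by case: z w => [a b] [c d] /= -> ->. Qed.

Lemma conj_reim z : z^* = toC (reC z) - 'i * toC (imC z).
Proof.
by apply: reim_eq; rewrite ?(reJ, imJ, reCD, imCD, reCN, imCN, reCM, imCM,
  reCi, imCi, re_toC, im_toC); ring.
Qed.

Lemma conj_toC r : (toC r)^* = toC r :> C.
Proof. by rewrite conj_reim re_toC im_toC toC0 mulr0 subr0. Qed.

Lemma cnorm_ge0 z : 0 <= cnorm z.
Proof. by rewrite -leC toC0 -normC_cnorm. Qed.
Lemma cnorm0 : cnorm 0 = 0.
Proof. by rewrite /cnorm normr0. Qed.
Lemma cnorm1 : cnorm 1 = 1.
Proof. by rewrite /cnorm normr1. Qed.
Lemma cnorm_eq0 z : cnorm z = 0 -> z = 0.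
Proof. by move=> z0; apply/eqP; rewrite -normr_eq0 normC_cnorm z0 toC0. Qed.
Lemma cnormD z w : cnorm (z + w) <= cnorm z + cnorm w.
Proof. by rewrite -leC toCD -!normC_cnorm ler_normD. Qed.
Lemma cnormM z w : cnorm (z * w) = cnorm z * cnorm w.
Proof. by apply: toC_inj; rewrite toCM -!normC_cnorm normrM. Qed.
Lemma cnormN z : cnorm (- z) = cnorm z.
Proof. by rewrite /cnorm normrN. Qed.
Lemma cnormB z w : cnorm (z - w) = cnorm (w - z).
Proof. by rewrite -cnormN opprB. Qed.
Lemma cnormJ z : cnorm z^* = cnorm z.
Proof. by rewrite /cnorm norm_conjC. Qed.
Lemma cnorm_toC r : cnorm (toC r) = `|r|.
Proof. by rewrite cnormE re_toC im_toC expr0n addr0 sqrtr_sqr. Qed.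
Lemma cnormi : cnorm 'i = 1.
Proof. by rewrite cnormE reCi imCi expr0n expr1n add0r sqrtr1. Qed.
Lemma cnormV z : cnorm z^-1 = (cnorm z)^-1.
Proof. by apply: toC_inj; rewrite toCV -!normC_cnorm normfV. Qed.
Lemma le_re_cnorm z : `|reC z| <= cnorm z.
Proof. by rewrite cnormE -sqrtr_sqr ler_wsqrtr// lerDl sqr_ge0. Qed.
Lemma le_im_cnorm z : `|imC z| <= cnorm z.
Proof. by rewrite cnormE -sqrtr_sqr ler_wsqrtr// lerDr sqr_ge0. Qed.
Lemma cnorm_le_reim z : cnorm z <= `|reC z| + `|imC z|.
Proof.
rewrite {1}(CE z); apply: le_trans (cnormD _ _) _.
by rewrite cnormM cnormi mul1r !cnorm_toC.
Qed.
Lemma cnorm_sum (I : Type) (s : seq I) (F : I -> C) :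
  cnorm (\sum_(i <- s) F i) <= \sum_(i <- s) cnorm (F i).
Proof.
elim: s => [|i s IH]; first by rewrite !big_nil cnorm0.
by rewrite !big_cons; apply: le_trans (cnormD _ _) _; rewrite lerD2l.
Qed.

Lemma gt0_toC (e : C) : 0 < e -> exists2 r : R, 0 < r & e = toC r.
Proof.
move=> e0; exists (reC e); last first.
  by apply: reim_eq => //; rewrite im_toC; exact: (ger0_Im (ltW e0)).
by move: e0; rewrite ltcE => /andP[].
Qed.

Section RowNorm.
Variable N : nat.
Implicit Types u v : 'rV[C]_N.

(** The l1 norm, equivalent by [nbhs_rnorm] to the sup norm that defines the topology of row
    vectors. *)
Definition rnorm v : R := \sum_a cnorm (v 0 a).

Lemma rnorm_ge0 v : 0 <= rnorm v.
Proof. by apply: sumr_ge0 => a _; exact: cnorm_ge0. Qed.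
Lemma rnorm0 : rnorm 0 = 0.
Proof. by rewrite /rnorm big1// => a _; rewrite mxE cnorm0. Qed.
Lemma rnormD u v : rnorm (u + v) <= rnorm u + rnorm v.
Proof.
rewrite /rnorm -big_split; apply: ler_sum => a _; rewrite mxE; exact: cnormD.
Qed.
Lemma rnormZ z v : rnorm (z *: v) = cnorm z * rnorm v.
Proof. by rewrite /rnorm mulr_sumr; apply: eq_bigr => a _; rewrite mxE cnormM. Qed.
Lemma rnormN v : rnorm (- v) = rnorm v.
Proof. by apply: eq_bigr => a _; rewrite mxE cnormN. Qed.
Lemma rnormB u v : rnorm (u - v) = rnorm (v - u).
Proof. by rewrite -rnormN opprB. Qed.
Lemma cnorm_le_rnorm v a : cnorm (v 0 a) <= rnorm v.
Proof.
by rewrite /rnorm (bigD1 a)//= lerDl sumr_ge0// => b _; exact: cnorm_ge0.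
Qed.
Lemma rnorm_delta a : rnorm (delta_mx 0 a) = 1.
Proof.
rewrite /rnorm (bigD1 a)//= mxE !eqxx cnorm1 big1 ?addr0// => b ba.
by rewrite mxE (negPf ba) andbF cnorm0.
Qed.
Lemma rnorm_eq0 v : rnorm v = 0 -> v = 0.
Proof.
move=> v0; apply/rowP => a; rewrite mxE; apply: cnorm_eq0; apply/eqP.
by rewrite eq_le cnorm_ge0 andbT -v0 cnorm_le_rnorm.
Qed.
Lemma nbhs_rnorm u (A : set 'rV[C]_N) :
  nbhs u A <-> exists2 e : R, 0 < e & forall v, rnorm (v - u) < e -> A v.
Proof.
split=> [/nbhs_ballP[_ /gt0_toC[e e0 ->] eA]|[e e0 eA]].
  exists e => // v uv; apply: eA; split; first by rewrite -[0]toC0 ltC.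
  move=> i j; rewrite ord1 -ball_normE /= normC_cnorm ltC.
  apply: le_lt_trans uv; rewrite rnormB.
  by have := cnorm_le_rnorm (u - v) j; rewrite !mxE.
(* [N + 1] rather than [N] covers dimension 0 and keeps the final inequality strict. *)
apply/nbhs_ballP; pose d : R := e / (N%:R + 1).
have d0 : 0 < d by rewrite divr_gt0// ltr_wpDl.
exists (toC d); first by rewrite /= -[0]toC0 ltC.
move=> v [_ uv]; apply: eA; rewrite rnormB.
have : rnorm (u - v) <= \sum_(a < N) d.
  apply: ler_sum => a _; have := uv 0 a.
  by rewrite -ball_normE /= normC_cnorm ltC !mxE => /ltW.
move=> /le_lt_trans; apply; rewrite sumr_const card_ord -mulr_natl /d.
by rewrite mulrCA gtr_pMr// ltr_pdivrMr ?ltr_wpDl// mul1r ltrDl.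
Qed.

End RowNorm.

Lemma nbhs_cnorm z (A : set C) :
  nbhs z A <-> exists2 e : R, 0 < e & forall w, cnorm (w - z) < e -> A w.
Proof.
split=> [/nbhs_ballP[_ /gt0_toC[e e0 ->] eA]|[e e0 eA]].
  by exists e => // w zw; apply: eA; rewrite -ball_normE /= normC_cnorm ltC cnormB.
apply/nbhs_ballP; exists (toC e); first by rewrite /= -[0]toC0 ltC.
by move=> w; rewrite -ball_normE /= normC_cnorm ltC cnormB; exact: eA.
Qed.

Lemma continuous_rnorm N (f : 'rV[C]_N -> C) u :
  {for u, continuous f} <-> forall e : R, 0 < e -> exists2 d : R, 0 < d &
    forall v, rnorm (v - u) < d -> cnorm (f v - f u) < e.
Proof.
split=> [fc e e0|fc A /nbhs_cnorm[e e0 eA]].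
  have h : nbhs (f u) [set w | cnorm (w - f u) < e] by apply/nbhs_cnorm; exists e.
  by have /nbhs_rnorm := fc _ h.
apply/nbhs_rnorm; have [d d0 dP] := fc e e0.
by exists d => // v /dP; exact: eA.
Qed.

Lemma continuous_rnorm_row N M (f : 'rV[C]_N -> 'rV[C]_M) u :
  {for u, continuous f} <-> forall e : R, 0 < e -> exists2 d : R, 0 < d &
    forall v, rnorm (v - u) < d -> rnorm (f v - f u) < e.
Proof.
split=> [fc e e0|fc A /nbhs_rnorm[e e0 eA]].
  have h : nbhs (f u) [set w | rnorm (w - f u) < e] by apply/nbhs_rnorm; exists e.
  by have /nbhs_rnorm := fc _ h.
apply/nbhs_rnorm; have [d d0 dP] := fc e e0.
by exists d => // v /dP; exact: eA.
Qed.

Lemma continuous_row N M (F : 'rV[C]_N -> 'rV[C]_M) x :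
  (forall b, {for x, continuous (fun y => F y 0 b)}) -> {for x, continuous F}.
Proof.
move=> Fc; apply/continuous_rnorm_row => e e0; have e1 : 0 < e / (M%:R + 1).
  by rewrite divr_gt0// ltr_wpDl.
have /choice[D HD] b : exists d : R, 0 < d /\ forall v, rnorm (v - x) < d ->
    cnorm (F v 0 b - F x 0 b) < e / (M%:R + 1).
  by have /continuous_rnorm/(_ _ e1)[d d0 H] := Fc b; exists d.
exists (\big[Num.min/1]_b D b) => [|v vd].
  by apply: lt_bigmin => // b _; case: (HD b).
have : rnorm (F v - F x) <= \sum_(b < M) (e / (M%:R + 1)).
  apply: ler_sum => b _; rewrite !mxE; have [_ H] := HD b; apply/ltW/H.
  by apply: (lt_le_trans vd); rewrite (bigD1 b)//= ge_min lexx.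
move=> /le_lt_trans; apply; rewrite sumr_const card_ord -[X in X < _]mulr_natl.
by rewrite mulrCA gtr_pMr// ltr_pdivrMr ?ltr_wpDl// mul1r ltrDl.
Qed.

Lemma open_rnorm N (V : set 'rV[C]_N) : open V -> forall u, V u ->
  exists2 d : R, 0 < d & forall v, rnorm (v - u) < d -> V v.
Proof. by move=> Vo u Vu; apply/nbhs_rnorm; exact: open_nbhs_nbhs. Qed.

End ComplexNorm.

(** * Derivative estimates in one real variable *)

Section OneVariable.
Variable R : realType.
Implicit Types f g : R -> R.

Lemma is_derive_eps f (l : R) :
  (forall e, 0 < e -> exists2 d, 0 < d & forall r, `|r| < d ->
     `|f r - f 0 - r * l| <= e * `|r|) -> is_derive (0 : R) (1 : R) f l.
Proof.
move=> H; have c : (fun h => h^-1 *: ((f \o shift 0) (h *: 1) - f 0)) @ 0^' --> l.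
  apply/cvgrPdist_le => e e0; have [d d0 Hd] := H e e0.
  near=> h; have h0 : h != 0 by near: h; exact: nbhs_dnbhs_neq.
  rewrite /= addr0 /GRing.scale /= mulr1.
  have := Hd h; have -> : `|h| < d by near: h; exact: dnbhs0_lt.
  move=> /(_ isT) Hh.
  have -> : l - h^-1 * (f h - f 0) = - (h^-1 * (f h - f 0 - h * l)).
    by rewrite [in RHS]mulrBr mulKf// opprB.
  by rewrite normrN normrM normfV ler_pdivrMl ?normr_gt0// (mulrC `|h|).
split; first by apply/cvg_ex; exists l.
exact/cvg_lim.
Unshelve. all: by end_near. Qed.

Lemma is_derive_shift f (r l : R) :
  is_derive (0 : R) (1 : R) (fun h => f (r + h)) l -> is_derive r (1 : R) f l.
Proof.
have E : (fun h : R => h^-1 *: (((fun k => f (r + k)) \o shift 0) (h *: (1 : R)) - f (r + 0))) =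
         (fun h : R => h^-1 *: ((f \o shift r) (h *: (1 : R)) - f r)).
  by apply/funext => h /=; rewrite !addr0 (addrC r).
move=> [d v]; split; first by rewrite /derivable -E.
by rewrite -v /derive /= E.
Qed.

Lemma mean_value_le f (df : R -> R) (t K e : R) :
  (forall r, `|r| <= `|t| -> is_derive r (1 : R) f (df r)) ->
  (forall r, `|r| <= `|t| -> `|df r - K| <= e) ->
  `|f t - f 0 - t * K| <= e * `|t|.
Proof.
(* The reflection [r => - r] reduces a negative [t] to a positive one; it negates [df] and [K]. *)
move=> fd dK; wlog t0 : t f df K fd dK / 0 <= t.
  move=> H; have [t0|t0] := leP 0 t; first exact: (H t f df K).
  have h1 r : `|r| <= `|- t| -> is_derive r (1 : R) (fun r => f (- r)) (- df (- r)).
    rewrite normrN -(normrN r) => /fd h.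
    rewrite -mulrN1.
    exact: (@is_derive1_comp _ f -%R).
  have h2 r : `|r| <= `|- t| -> `|- df (- r) - - K| <= e.
    by rewrite normrN -(normrN r) => rt; rewrite -opprD normrN; exact: dK.
  have h3 : 0 <= - t by rewrite oppr_ge0 ltW.
  by have := H _ _ _ _ h1 h2 h3; rewrite /= !opprK oppr0 mulrNN normrN.
have fd' r : r \in `]0, t[%R -> is_derive r (1 : R) f (df r).
  rewrite in_itv /= => /andP[r0 rt]; apply: fd.
  by rewrite !ger0_norm// ltW.
have fc : {within `[0, t], continuous f}.
  apply: continuous_in_subspaceT => r; rewrite inE /= in_itv /= => /andP[r0 rt].
  apply/differentiable_continuous/derivable1_diffP.
  have rt' : `|r| <= `|t| by rewrite !ger0_norm.
  by have [] := fd r rt'.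
have [c] := MVT_segment t0 fd' fc.
rewrite in_itv /= => /andP[c0 ct] ->; rewrite subr0 mulrC -mulrBr normrM mulrC.
by rewrite ler_wpM2r// dK// !ger0_norm.
Qed.

End OneVariable.

(** * Real differentials in Wirtinger coordinates *)

Section Wirtinger.
Variable R : realType.
Local Notation C := (Cplx R).

Section SmallO.
Variable N : nat.
Implicit Types (f g : 'rV[C]_N -> C) (u v h x : 'rV[C]_N).

Definition osmall f := forall e : R, 0 < e -> exists2 d : R, 0 < d &
  forall h, rnorm h < d -> cnorm (f h) <= e * rnorm h.

Lemma osmallD f g : osmall f -> osmall g -> osmall (fun h => f h + g h).
Proof.
move=> fo go e e0; have e2 : 0 < e / 2 by lra.
have [d1 d10 H1] := fo _ e2; have [d2 d20 H2] := go _ e2.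
exists (Num.min d1 d2) => [|h]; first by rewrite lt_min d10.
rewrite lt_min => /andP[/H1 h1 /H2 h2].
by apply: le_trans (cnormD _ _) _; lra.
Qed.

Lemma osmall_le f g (K : R) : 0 <= K -> osmall f ->
  (exists2 d : R, 0 < d & forall h, rnorm h < d -> cnorm (g h) <= K * cnorm (f h)) ->
  osmall g.
Proof.
move=> K0 fo [d0 d00 Hd0] e e0.
have eK : 0 < e / (K + 1) by rewrite divr_gt0// ltr_wpDl.
have [d d1 Hd] := fo _ eK.
exists (Num.min d0 d) => [|h]; first by rewrite lt_min d00.
rewrite lt_min => /andP[/Hd0 h1 /Hd h2]; apply: le_trans h1 _.
apply: le_trans (ler_wpM2l K0 h2) _; rewrite mulrA ler_wpM2r ?rnorm_ge0//.
by rewrite mulrCA ger_pMr// ler_pdivrMr ?ltr_wpDl//; lra.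
Qed.

Lemma osmallZ (c : C) f : osmall f -> osmall (fun h => c * f h).
Proof.
move=> fo; apply: (osmall_le (cnorm_ge0 c) fo); exists 1 => // h _.
by rewrite cnormM.
Qed.

Lemma osmall0 : osmall (fun _ => 0).
Proof. by move=> e e0; exists 1 => // h _; rewrite cnorm0 mulr_ge0 ?rnorm_ge0// ltW. Qed.

Lemma osmall_sum (I : Type) (s : seq I) (F : I -> 'rV[C]_N -> C) :
  (forall i, osmall (F i)) -> osmall (fun h => \sum_(i <- s) F i h).
Proof.
move=> Fo; elim: s => [|i s IH].
  have -> : (fun h => \sum_(i <- [::]) F i h) = (fun _ => 0).
    by apply/funext => h; rewrite big_nil.
  exact: osmall0.
have -> : (fun h => \sum_(j <- i :: s) F j h) =
    (fun h => F i h + \sum_(j <- s) F j h).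
  by apply/funext => h; rewrite big_cons.
exact: osmallD.
Qed.

(** The general real-linear map to the complex numbers, split into its complex-linear and antilinear
    parts. *)
Definition wlin (al be : 'I_N -> C) h : C :=
  \sum_a (h 0 a * al a + (h 0 a)^* * be a).

Lemma wlin_le al be h :
  cnorm (wlin al be h) <=
  (\sum_a (cnorm (al a) + cnorm (be a))) * rnorm h.
Proof.
rewrite mulr_suml; apply: le_trans (cnorm_sum _ _) _; apply: ler_sum => a _.
apply: le_trans (cnormD _ _) _; rewrite !cnormM cnormJ mulrDl.
by apply: lerD; rewrite mulrC ler_wpM2l ?cnorm_ge0// cnorm_le_rnorm.
Qed.

Lemma wlinZ al be (r : R) h : wlin al be (toC r *: h) = toC r * wlin al be h.
Proof.
rewrite /wlin mulr_sumr; apply: eq_bigr => a _; rewrite !mxE rmorphM /=.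
by rewrite [(toC r)^*]conj_toC; ring.
Qed.

Lemma wlinD al be h k : wlin al be (h + k) = wlin al be h + wlin al be k.
Proof.
rewrite /wlin -big_split; apply: eq_bigr => a _ /=; rewrite !mxE rmorphD /=.
by ring.
Qed.

Lemma wlin_dirx al be a : wlin al be (dirx R a) = al a + be a.
Proof.
rewrite /wlin (bigD1 a)//= big1 => [|b ba].
  by rewrite !mxE !eqxx /= conjC1 !mul1r addr0.
by rewrite !mxE (negPf ba) andbF conjC0 !mul0r addr0.
Qed.

Lemma wlin_diry al be a : wlin al be (diry R a) = 'i * (al a - be a).
Proof.
rewrite /wlin (bigD1 a)//= big1 => [|b ba].
  by rewrite !mxE !eqxx mulr1 conjCi addr0; ring.
by rewrite !mxE (negPf ba) andbF mulr0 conjC0 !mul0r addr0.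
Qed.

(** Real differentiability with prescribed coefficients. Keeping [al] and [be] as parameters lets
    the rules below be proved before any derivative is identified; [wdiff_unique] then recovers [dz]
    and [dzbar]. *)
Definition wdiff f x (al be : 'I_N -> C) : Prop :=
  osmall (fun h => f (x + h) - f x - wlin al be h).

Definition wdifferentiable f x : Prop :=
  wdiff f x (fun a => dz a f x) (fun a => dzbar a f x).

Lemma wdiff_rderive f x al be v : wdiff f x al be ->
  rderivable v f x /\ rderive v f x = wlin al be v.
Proof.
move=> fd; set l := wlin al be v.
have key (e : R) : 0 < e -> exists2 d : R, 0 < d & forall r : R, `|r| < d ->
    cnorm (f (x + toC r *: v) - f x - toC r * l) <= e * `|r|.
  move=> e0; have V0 : 0 < rnorm v + 1 by rewrite ltr_wpDl ?rnorm_ge0.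
  have [d d0 H] := fd (e / (rnorm v + 1)) (divr_gt0 e0 V0).
  exists (d / (rnorm v + 1)) => [|r]; first exact: divr_gt0.
  rewrite ltr_pdivlMr// => rd; have := H (toC r *: v).
  rewrite rnormZ cnorm_toC wlinZ => /(_ _)/le_trans; apply.
    by apply: le_lt_trans rd; rewrite ler_wpM2l//; lra.
  rewrite mulrAC ler_pdivrMr// -!mulrA ler_wpM2l ?(ltW e0)//.
  by rewrite ler_wpM2l//; lra.
have dre : is_derive (0 : R) (1 : R) (fun r => reC (f (x + toC r *: v))) (reC l).
  apply: is_derive_eps => e e0; have [d d0 H] := key e e0.
  exists d => // r rd; apply: le_trans (H r rd).
  rewrite toC0 scale0r addr0; apply: le_trans (le_re_cnorm _).
  by rewrite !(reCD, reCN, reCM) re_toC im_toC mul0r subr0.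
have dim : is_derive (0 : R) (1 : R) (fun r => imC (f (x + toC r *: v))) (imC l).
  apply: is_derive_eps => e e0; have [d d0 H] := key e e0.
  exists d => // r rd; apply: le_trans (H r rd).
  rewrite toC0 scale0r addr0; apply: le_trans (le_im_cnorm _).
  by rewrite !(imCD, imCN, imCM) re_toC im_toC mul0r addr0.
split; first by split; [case: dre | case: dim].
by rewrite /rderive !derive1E !derive_val -CE.
Qed.

Lemma wdiff_unique f x al be a : wdiff f x al be ->
  dz a f x = al a /\ dzbar a f x = be a.
Proof.
move=> fd; rewrite /dz /dzbar !(wdiff_rderive _ fd).2 wlin_dirx wlin_diry.
have i2 : 'i * ('i * (al a - be a)) = - (al a - be a) :> C.
  by rewrite mulrA -expr2 sqrCi mulN1r.
rewrite i2; split; field; rewrite ?pnatr_eq0//.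
Qed.

Lemma wdiffW f x al be : wdiff f x al be -> wdifferentiable f x.
Proof.
move=> fd; rewrite /wdifferentiable.
have -> : (fun a => dz a f x) = al.
  by apply/funext => a; case: (wdiff_unique a fd).
have -> : (fun a => dzbar a f x) = be; last by [].
by apply/funext => a; case: (wdiff_unique a fd).
Qed.

Lemma wdiff_lip f x al be : wdiff f x al be ->
  exists2 K : R, 0 < K & exists2 d : R, 0 < d & forall h, rnorm h < d ->
    cnorm (f (x + h) - f x) <= K * rnorm h.
Proof.
move=> fd; have [d d0 H] := fd 1 ltr01.
set S := \sum_a (cnorm (al a) + cnorm (be a)).
have S0 : 0 <= S by apply: sumr_ge0 => a _; rewrite addr_ge0 ?cnorm_ge0.
exists (S + 1); first by rewrite ltr_wpDl.
exists d => // h /H h1; rewrite -[f (x + h) - f x](subrK (wlin al be h)).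
apply: le_trans (cnormD _ _) _; rewrite mulrDl addrC lerD// wlin_le//.
Qed.

Lemma wdiff_continuous f x al be : wdiff f x al be -> {for x, continuous f}.
Proof.
move=> /wdiff_lip[K K0 [d d0 H]]; apply/continuous_rnorm => e e0.
exists (Num.min d (e / K)) => [|v]; first by rewrite lt_min d0 divr_gt0.
rewrite lt_min ltr_pdivlMr// => /andP[/H]; rewrite (addrC x) subrK => h1 h2.
by apply: le_lt_trans h1 _; rewrite mulrC.
Qed.

Lemma wdiff_near f g x al be : (\forall y \near x, f y = g y) ->
  wdiff f x al be -> wdiff g x al be.
Proof.
move=> /nbhs_rnorm[d0 d00 fg] fd e e0; have [d d1 H] := fd e e0.
exists (Num.min d0 d) => [|h]; first by rewrite lt_min d00.
rewrite lt_min => /andP[h0 /H]; rewrite !fg ?subrr ?rnorm0//.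
by rewrite addrC addKr.
Qed.

Lemma wdiff_cst c x : wdiff (fun _ => c) x (fun _ => 0) (fun _ => 0).
Proof.
apply: (@osmall_le (fun=> 0) _ 1) => //; first exact: osmall0.
exists 1 => // h _; rewrite subrr /wlin big1 ?subrr ?mul1r// => a _.
by rewrite !mulr0 addr0.
Qed.

Lemma wdiff_coord x b : wdiff (fun y => y 0 b) x (fun a => (a == b)%:R) (fun _ => 0).
Proof.
apply: (@osmall_le (fun=> 0) _ 1) => //; first exact: osmall0.
exists 1 => // h _; rewrite mul1r.
have -> : (x + h) 0 b - x 0 b = h 0 b by rewrite mxE; ring.
rewrite /wlin (bigD1 b)//= big1.
  by rewrite eqxx mulr1 mulr0 !addr0 subrr.
by move=> a /negPf ->; rewrite !mulr0 addr0.
Qed.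

Lemma wdiffD f g x al be al' be' : wdiff f x al be -> wdiff g x al' be' ->
  wdiff (fun y => f y + g y) x (fun a => al a + al' a) (fun a => be a + be' a).
Proof.
move=> fd gd.
suff -> : wdiff (fun y => f y + g y) x (fun a => al a + al' a) (fun a => be a + be' a) =
  osmall (fun h => (f (x + h) - f x - wlin al be h) +
    (g (x + h) - g x - wlin al' be' h)) by exact: osmallD.
congr osmall; apply/funext => h.
have -> : wlin (fun a => al a + al' a) (fun a => be a + be' a) h =
    wlin al be h + wlin al' be' h.
  by rewrite /wlin -big_split; apply: eq_bigr => a _ /=; ring.
by ring.
Qed.

Lemma wdiffM f g x al be al' be' : wdiff f x al be -> wdiff g x al' be' ->
  wdiff (fun y => f y * g y) x (fun a => al a * g x + f x * al' a)
    (fun a => be a * g x + f x * be' a).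
Proof.
move=> fd gd.
(* Both increments are Lipschitz at [x], so their product is of second order in [h]. *)
have qd : osmall (fun h => (f (x + h) - f x) * (g (x + h) - g x)).
  have [K1 K10 [d1 d10 H1]] := wdiff_lip fd.
  have [K2 K20 [d2 d20 H2]] := wdiff_lip gd.
  move=> e e0; exists (Num.min (Num.min d1 d2) (e / (K1 * K2))) => [|h].
    by rewrite !lt_min d10 d20 divr_gt0// mulr_gt0.
  rewrite !lt_min ltr_pdivlMr ?mulr_gt0// => /andP[/andP[/H1 h1 /H2 h2] h3].
  rewrite cnormM; apply: (@le_trans _ _ ((K1 * rnorm h) * (K2 * rnorm h))).
    by rewrite ler_pM ?cnorm_ge0.
  rewrite mulrACA mulrA ler_wpM2r ?rnorm_ge0// ltW//.
  by rewrite mulrC.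
suff -> : wdiff (fun y => f y * g y) x (fun a => al a * g x + f x * al' a)
    (fun a => be a * g x + f x * be' a) =
  osmall (fun h => (g x * (f (x + h) - f x - wlin al be h) +
    f x * (g (x + h) - g x - wlin al' be' h)) +
    (f (x + h) - f x) * (g (x + h) - g x)).
  by apply: osmallD qd; apply: osmallD; exact: osmallZ.
congr osmall; apply/funext => h.
have -> : wlin (fun a => al a * g x + f x * al' a) (fun a => be a * g x + f x * be' a) h =
    g x * wlin al be h + f x * wlin al' be' h.
  by rewrite /wlin !mulr_sumr -big_split; apply: eq_bigr => a _ /=; ring.
by ring.
Qed.

Definition cdiff (g : C -> C) (z p q : C) := forall e : R, 0 < e ->
  exists2 d : R, 0 < d & forall k, cnorm k < d ->
    cnorm (g (z + k) - g z - (p * k + q * k^*)) <= e * cnorm k.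

Lemma wdiff_compC (g : C -> C) f x al be p q :
  cdiff g (f x) p q -> wdiff f x al be ->
  wdiff (fun y => g (f y)) x (fun a => p * al a + q * (be a)^*)
    (fun a => p * be a + q * (al a)^*).
Proof.
move=> gd fd; pose al' a := p * al a + q * (be a)^*.
pose be' a := p * be a + q * (al a)^*; rewrite -/al' -/be'.
suff -> : wdiff (fun y => g (f y)) x al' be' =
  osmall (fun h => (g (f (x + h)) - g (f x) -
      (p * (f (x + h) - f x) + q * (f (x + h) - f x)^*)) +
    (p * (f (x + h) - f x - wlin al be h) +
     q * (f (x + h) - f x - wlin al be h)^*)).
  apply: osmallD; last first.
    apply: osmallD; first exact: osmallZ.
    apply: osmallZ; apply: (osmall_le ler01 fd).
    by exists 1 => // h _; rewrite cnormJ mul1r.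
  have [K K0 [d1 d10 H1]] := wdiff_lip fd.
  move=> e e0; have [d d0 H] := gd _ (divr_gt0 e0 K0).
  exists (Num.min d1 (d / K)) => [|h]; first by rewrite lt_min d10 divr_gt0.
  rewrite lt_min ltr_pdivlMr// => /andP[/H1 h1 h2].
  have := H (f (x + h) - f x); rewrite (addrC (f x)) subrK => /(_ _)/le_trans; apply.
    by apply: le_lt_trans h1 _; rewrite mulrC.
  apply: le_trans (ler_wpM2l _ h1) _; first by rewrite ltW// divr_gt0.
  by rewrite mulrA divfK// gt_eqF.
congr osmall; apply/funext => h.
have -> : wlin al' be' h = p * wlin al be h + q * (wlin al be h)^*.
  rewrite /wlin rmorph_sum !mulr_sumr -big_split; apply: eq_bigr => a _ /=.
  by rewrite rmorphD !rmorphM /= conjCK /al' /be'; ring.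
by rewrite !(rmorphB, rmorphD, rmorphN) /=; ring.
Qed.

End SmallO.

Lemma wdiff_comp N M (F : 'rV[C]_N -> 'rV[C]_M) (g : 'rV[C]_M -> C) x
    (p q : 'I_M -> C) (al be : 'I_M -> 'I_N -> C) :
  wdiff g (F x) p q -> (forall b, wdiff (fun y => F y 0 b) x (al b) (be b)) ->
  wdiff (fun y => g (F y)) x
    (fun a => \sum_b (p b * al b a + q b * (be b a)^*))
    (fun a => \sum_b (p b * be b a + q b * (al b a)^*)).
Proof.
move=> gd Fd; pose al' a := \sum_b (p b * al b a + q b * (be b a)^*).
pose be' a := \sum_b (p b * be b a + q b * (al b a)^*); rewrite -/al' -/be'.
pose rF b h := F (x + h) 0 b - F x 0 b - wlin (al b) (be b) h.
suff -> : wdiff (fun y => g (F y)) x al' be' =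
  osmall (fun h => (g (F (x + h)) - g (F x) - wlin p q (F (x + h) - F x)) +
    \sum_b (p b * rF b h + q b * (rF b h)^*)).
  apply: osmallD; last first.
    apply: osmall_sum => b; apply: osmallD; first by apply: osmallZ; exact: Fd.
    apply: osmallZ; apply: (osmall_le ler01 (Fd b)).
    by exists 1 => // h _; rewrite cnormJ mul1r.
  (* A Lipschitz bound for all components together: what is small relative to the increment of [F]
     is then small relative to [h]. *)
  have [K K0 [d1 d10 H1]] : exists2 K : R, 0 < K & exists2 d : R, 0 < d &
      forall h, rnorm h < d -> rnorm (F (x + h) - F x) <= K * rnorm h.
    have /choice[Kd HKd] b : exists Kd : R * R, [/\ 0 < Kd.1, 0 < Kd.2 &
        forall h, rnorm h < Kd.2 -> cnorm (F (x + h) 0 b - F x 0 b) <= Kd.1 * rnorm h].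
      by have [K K0 [d d0 H]] := wdiff_lip (Fd b); exists (K, d).
    exists (1 + \sum_b (Kd b).1).
      by rewrite ltr_wpDr// sumr_ge0// => b _; case: (HKd b) => /ltW.
    exists (\big[Num.min/1]_b (Kd b).2).
      by apply: lt_bigmin => // b _; case: (HKd b).
    move=> h hd; rewrite mulrDl mulr_suml; apply: ler_wpDl.
      by rewrite mul1r rnorm_ge0.
    apply: ler_sum => b _; rewrite !mxE; have [_ _] := HKd b; apply.
    by apply: (lt_le_trans hd); rewrite (bigD1 b)//= ge_min lexx.
  move=> e e0; have [d d0 H] := gd _ (divr_gt0 e0 K0).
  exists (Num.min d1 (d / K)) => [|h]; first by rewrite lt_min d10 divr_gt0.
  rewrite lt_min ltr_pdivlMr// => /andP[/H1 h1 h2].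
  have := H (F (x + h) - F x); rewrite (addrC (F x)) subrK => /(_ _)/le_trans; apply.
    by apply: le_lt_trans h1 _; rewrite mulrC.
  apply: le_trans (ler_wpM2l _ h1) _; first by rewrite ltW// divr_gt0.
  by rewrite mulrA divfK// gt_eqF.
congr osmall; apply/funext => h.
have -> : wlin al' be' h =
    \sum_b (p b * wlin (al b) (be b) h + q b * (wlin (al b) (be b) h)^*).
  rewrite /wlin.
  under [RHS]eq_bigr => b _ do rewrite rmorph_sum !mulr_sumr -big_split /=.
  rewrite exchange_big; apply: eq_bigr => a _ /=.
  rewrite /al' /be' !mulr_sumr -big_split; apply: eq_bigr => b _ /=.
  by rewrite rmorphD !rmorphM /= conjCK; ring.
rewrite -[RHS]addrA; congr (_ + _); rewrite /wlin -!sumrN -big_split /=.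
apply: eq_bigr => b _; rewrite /rF /wlin !mxE !(rmorphB, rmorphD, rmorphN) /=.
by ring.
Qed.

End Wirtinger.

(** * Differentiability classes through Wirtinger derivatives *)

Section SmoothFunctions.
Variable R : realType.
Local Notation C := (Cplx R).

Section MeanValue.
Variable N : nat.
Implicit Types (f : 'rV[C]_N -> C) (v x : 'rV[C]_N).

Lemma rderivable_line f v x (r : R) : rderivable v f (x + toC r *: v) ->
  is_derive r (1 : R) (fun s => reC (f (x + toC s *: v)))
    (reC (rderive v f (x + toC r *: v))) /\
  is_derive r (1 : R) (fun s => imC (f (x + toC s *: v)))
    (imC (rderive v f (x + toC r *: v))).
Proof.
have E s : x + toC r *: v + toC s *: v = x + toC (r + s) *: v.
  by rewrite toCD scalerDl addrA.
move=> [h1 h2]; split; apply: is_derive_shift.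
- have -> : (fun h => reC (f (x + toC (r + h) *: v))) =
      (fun h => reC (f (x + toC r *: v + toC h *: v))).
    by apply/funext => s; rewrite E.
  split=> //; rewrite /rderive reCD reCM reCi imCi re_toC !im_toC.
  by rewrite -derive1E mul0r mulr0 subr0 addr0.
- have -> : (fun h => imC (f (x + toC (r + h) *: v))) =
      (fun h => imC (f (x + toC r *: v + toC h *: v))).
    by apply/funext => s; rewrite E.
  split=> //; rewrite /rderive imCD imCM reCi imCi !re_toC !im_toC.
  by rewrite -derive1E mul0r mul1r !add0r.
Qed.

(** The mean value theorem is applied to real and imaginary parts separately, hence the factor 2. *)
Lemma mean_value_cnorm f v x (t : R) (K : C) (e : R) :
  (forall r : R, `|r| <= `|t| -> rderivable v f (x + toC r *: v)) ->
  (forall r : R, `|r| <= `|t| -> cnorm (rderive v f (x + toC r *: v) - K) <= e) ->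
  cnorm (f (x + toC t *: v) - f x - toC t * K) <= 2 * e * `|t|.
Proof.
move=> fd fK.
have x0 : f x = f (x + toC 0 *: v) by rewrite toC0 scale0r addr0.
have hr : (forall r, `|r| <= `|t| ->
      `|reC (rderive v f (x + toC r *: v)) - reC K| <= e) ->
    `|reC (f (x + toC t *: v)) - reC (f x) - t * reC K| <= e * `|t|.
  rewrite x0; apply: (mean_value_le (f := fun s => reC (f (x + toC s *: v)))).
  by move=> r rt; exact: (rderivable_line (fd r rt)).1.
have hi : (forall r, `|r| <= `|t| ->
      `|imC (rderive v f (x + toC r *: v)) - imC K| <= e) ->
    `|imC (f (x + toC t *: v)) - imC (f x) - t * imC K| <= e * `|t|.
  rewrite x0; apply: (mean_value_le (f := fun s => imC (f (x + toC s *: v)))).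
  by move=> r rt; exact: (rderivable_line (fd r rt)).2.
apply: le_trans (cnorm_le_reim _) _.
have -> : 2 * e * `|t| = e * `|t| + e * `|t| by ring.
rewrite !(reCD, reCN, reCM, imCD, imCN, imCM) re_toC im_toC !mul0r subr0 addr0.
apply: lerD.
  apply: hr => r rt; apply: le_trans (fK r rt); apply: le_trans (le_re_cnorm _).
  by rewrite reCD reCN.
apply: hi => r rt; apply: le_trans (fK r rt); apply: le_trans (le_im_cnorm _).
by rewrite imCD imCN.
Qed.

(* Telescoping over a polygonal path whose edges are parallel to the given
   directions. *)
Lemma mean_value_path f x (e d : R) (s : seq (R * 'rV[C]_N)) (y : 'rV[C]_N) :
  0 <= e ->
  (forall tv, tv \in s -> rnorm tv.2 <= 1 /\
     forall z, rnorm (z - x) < d -> rderivable tv.2 f z /\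
       cnorm (rderive tv.2 f z - rderive tv.2 f x) <= e) ->
  rnorm (y - x) + \sum_(tv <- s) `|tv.1| < d ->
  cnorm (f (y + \sum_(tv <- s) toC tv.1 *: tv.2) - f y -
         \sum_(tv <- s) toC tv.1 * rderive tv.2 f x) <=
  2 * e * \sum_(tv <- s) `|tv.1|.
Proof.
move=> e0; elim: s y => [|[t v] s IH] y sP.
  by move=> _; rewrite !big_nil addr0 subrr subr0 cnorm0 mulr0.
rewrite !big_cons /= => yd.
have [v1 vP] := sP _ (mem_head _ _).
have ytv r : `|r| <= `|t| -> rnorm (y + toC r *: v - x) <= rnorm (y - x) + `|t|.
  move=> rt; rewrite addrAC; apply: le_trans (rnormD _ _) _; rewrite lerD2l.
  by rewrite rnormZ cnorm_toC -[leRHS]mulr1 ler_pM ?rnorm_ge0.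
have S0 : 0 <= \sum_(tv <- s) `|tv.1| by apply: sumr_ge0.
have h1 : cnorm (f (y + toC t *: v) - f y - toC t * rderive v f x) <= 2 * e * `|t|.
  apply: mean_value_cnorm => r rt; apply vP; apply: le_lt_trans (ytv r rt) _.
    by apply: le_lt_trans yd; lra.
  by apply: le_lt_trans yd; lra.
have h2 := IH (y + toC t *: v) _ _.
have {}h2 := h2 (fun tv tvs => sP tv (mem_behead (s := (t, v) :: s) tvs)).
have {}h2 := h2 (le_lt_trans (lerD (ytv t (lexx _)) (lexx _)) _).
rewrite -addrA in h2; have {}h2 := h2 yd.
rewrite addrA; set a := f (_ + _ + _) in h2 *; set b := f (_ + _) in h1 h2 *.
set c := f y in h1 *; set p := toC t * _ in h1 *.
set q := \sum_(_ <- _) toC _ * _ in h2 *.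
have -> : a - c - (p + q) = b - c - p + (a - b - q) by ring.
by apply: le_trans (cnormD _ _) _; rewrite mulrDr; exact: lerD.
Qed.

Lemma row_real_dirs (h : 'rV[C]_N) :
  h = \sum_a (toC (reC (h 0 a)) *: dirx R a + toC (imC (h 0 a)) *: diry R a).
Proof.
rewrite {1}(row_sum_delta h); apply: eq_bigr => a _.
by rewrite {1}(CE (h 0 a)) scalerDl /dirx /diry scalerA mulrC.
Qed.

Lemma C1_wdifferentiable f x (d0 : R) : 0 < d0 ->
  (forall a y, rnorm (y - x) < d0 ->
     rderivable (dirx R a) f y /\ rderivable (diry R a) f y) ->
  (forall a, {for x, continuous (rderive (dirx R a) f)}) ->
  (forall a, {for x, continuous (rderive (diry R a) f)}) ->
  wdifferentiable f x.
Proof.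
(* A quarter, because the mean value estimate doubles the error and the real and imaginary parts of
   the entries of [h] sum to at most [2 * rnorm h] in absolute value. The radius [d / 2] has the
   latter origin. *)
move=> d00 fd fcx fcy e e0; have e4 : 0 < e / 4 by lra.
have [d [d1 dd0 dP]] : exists d : R, [/\ 0 < d, d <= d0 & forall a y,
    rnorm (y - x) < d ->
    cnorm (rderive (dirx R a) f y - rderive (dirx R a) f x) <= e / 4 /\
    cnorm (rderive (diry R a) f y - rderive (diry R a) f x) <= e / 4].
  have /choice[D HD] a : exists d : R, 0 < d /\ forall y,
    rnorm (y - x) < d ->
    cnorm (rderive (dirx R a) f y - rderive (dirx R a) f x) <= e / 4 /\
    cnorm (rderive (diry R a) f y - rderive (diry R a) f x) <= e / 4.
    have /continuous_rnorm/(_ _ e4)[d1 d10 H1] := fcx a.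
    have /continuous_rnorm/(_ _ e4)[d2 d20 H2] := fcy a.
    exists (Num.min d1 d2); rewrite lt_min d10; split=> // y.
    by rewrite lt_min => /andP[/H1/ltW ? /H2/ltW].
  exists (Num.min d0 (\big[Num.min/1]_a D a)); split.
  - by rewrite lt_min d00 lt_bigmin// => a _; case: (HD a).
  - by rewrite ge_min lexx.
  - move=> a y; rewrite lt_min (bigD1 a)//= lt_min => /andP[_ /andP[+ _]].
    by case: (HD a) => _; apply.
exists (d / 2) => [|h hd]; first by lra.
pose s := flatten [seq [:: (reC (h 0 a), dirx R a); (imC (h 0 a), diry R a)]
                      | a <- index_enum 'I_N].
have sumS (V : zmodType) (F : R * 'rV[C]_N -> V) : \sum_(tv <- s) F tv =
    \sum_a (F (reC (h 0 a), dirx R a) + F (imC (h 0 a), diry R a)).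
  rewrite /s big_flatten big_map; apply: eq_bigr => a _.
  by rewrite !big_cons big_nil /= addr0.
have sabs : \sum_(tv <- s) `|tv.1| <= 2 * rnorm h.
  rewrite sumS /rnorm mulr_sumr; apply: ler_sum => a _ /=.
  by have := le_re_cnorm (h 0 a); have := le_im_cnorm (h 0 a); lra.
rewrite sumS in sabs.
have := @mean_value_path f x (e / 4) d s x (ltW e4) _ _.
rewrite !sumS -row_real_dirs => H.
have -> : wlin (fun a => dz a f x) (fun a => dzbar a f x) h =
    \sum_a (toC (reC (h 0 a)) * rderive (dirx R a) f x +
            toC (imC (h 0 a)) * rderive (diry R a) f x).
  apply: eq_bigr => a _; rewrite conj_reim {1}(CE (h 0 a)) /dz /dzbar.
  set Dx := rderive _ _ _; set Dy := rderive _ _ _.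
  set u := toC (reC _); set w := toC (imC _).
  have i2 : 'i * 'i = -1 :> C by rewrite -expr2 sqrCi.
  have -> : (u + 'i * w) * ((Dx - 'i * Dy) / 2) + (u - 'i * w) * ((Dx + 'i * Dy) / 2)
     = u * Dx - ('i * 'i) * (w * Dy) by field; rewrite ?pnatr_eq0.
  by rewrite i2 mulN1r opprK.
apply: le_trans (H _ _) _; last 1 first.
- apply: le_trans (ler_wpM2l _ sabs) _; first by lra.
  by have := rnorm_ge0 h; nra.
- move=> tv /flatten_mapP[a _]; rewrite !inE => /orP[]/eqP -> /=.
    split=> [|z zd]; first by rewrite rnorm_delta.
    split; last by case: (dP a z zd).
    by case: (fd a z (lt_le_trans zd dd0)).
  split=> [|z zd]; first by rewrite rnormZ cnormi rnorm_delta mul1r.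
  split; last by case: (dP a z zd).
  by case: (fd a z (lt_le_trans zd dd0)).
- by rewrite subrr rnorm0 add0r; apply: le_lt_trans sabs _; lra.
Qed.

End MeanValue.

Section SmoothClass.
Variable N : nat.
Implicit Types (f g : 'rV[C]_N -> C) (V : set 'rV[C]_N).

(* [Ck], with the Wirtinger derivatives in place of the real partial
   derivatives. *)
Fixpoint CW (k : nat) V f : Prop :=
  if k is k'.+1 then
    (forall x, V x -> wdifferentiable f x) /\
    forall a : 'I_N, CW k' V (dz a f) /\ CW k' V (dzbar a f)
  else forall x, V x -> {for x, continuous f}.

Lemma CW_continuous k V f x : CW k V f -> V x -> {for x, continuous f}.
Proof.
by case: k => [|k] /=; [exact | move=> [h _] /h; exact: wdiff_continuous].
Qed.

Lemma CW_ext k V f g : open V -> (forall x, V x -> f x = g x) ->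
  CW k V f -> CW k V g.
Proof.
move=> Vo; elim: k f g => [|k IH] f g fg.
  move=> fc x Vx A; rewrite -fg// => /(fc x Vx) H.
  have Vn : nbhs x V by exact: open_nbhs_nbhs.
  have H' : nbhs x (f @^-1` A) := H.
  suff : nbhs x (g @^-1` A) by [].
  by apply: filterS2 Vn H' => y Vy; rewrite /preimage /= fg.
have fgn x : V x -> nbhs x [set y | f y = g y].
  by move=> Vx; have : nbhs x V by [exact: open_nbhs_nbhs]; apply: filterS.
move=> [fd dd].
have gd x : V x -> wdiff g x (fun a => dz a f x) (fun a => dzbar a f x).
  by move=> Vx; exact: wdiff_near (fgn x Vx) (fd x Vx).
split=> [x /gd/wdiffW//|a]; have [d1 d2] := dd a.
by split; [apply: IH d1|apply: IH d2] => x /gd/(wdiff_unique a)[].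
Qed.

(** The derivatives may be replaced by any explicit coefficients of the differential; the inductions
    on the class below go through this rule. *)
Lemma CW_S k V f (al be : 'I_N -> 'rV[C]_N -> C) : open V ->
  (forall x, V x -> wdiff f x (al^~ x) (be^~ x)) ->
  (forall a, CW k V (al a)) -> (forall a, CW k V (be a)) -> CW k.+1 V f.
Proof.
move=> Vo fd ak bk; split=> [x /fd/wdiffW//|a].
by split; [apply: CW_ext (ak a) | apply: CW_ext (bk a)] => // x /fd/(wdiff_unique a)[].
Qed.

Lemma CW_cst k V c : open V -> CW k V (fun _ => c).
Proof.
move=> Vo; elim: k c => [|k IH] c; first by move=> x _; exact: cst_continuous.
apply: CW_S => // [x _|a|a]; [exact: wdiff_cst | exact: IH | exact: IH].
Qed.

Lemma CW_coord k V b : open V -> CW k V (fun x => x 0 b).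
Proof.
move=> Vo; case: k => [|k].
  by move=> x _; exact: wdiff_continuous (wdiff_coord x b).
by apply: CW_S => // [x _|a|a]; [exact: wdiff_coord | exact: CW_cst | exact: CW_cst].
Qed.

Lemma CWD k V f g : open V -> CW k V f -> CW k V g -> CW k V (fun x => f x + g x).
Proof.
move=> Vo; elim: k f g => [|k IH] f g.
  by move=> fc gc x Vx; apply: continuousD; [exact: fc | exact: gc].
move=> [fd ff] [gd gg]; apply: CW_S => // [x Vx|a|a].
- by apply: wdiffD; [exact: fd | exact: gd].
- by apply: IH; [case: (ff a) | case: (gg a)].
- by apply: IH; [case: (ff a) | case: (gg a)].
Qed.

Lemma CWW k V f : CW k.+1 V f -> CW k V f.
Proof.
elim: k f => [|k IH] f.
  by move=> [fd _] x /fd; exact: wdiff_continuous.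
by move=> [fd ff]; split=> // a; have [h1 h2] := ff a; split; exact: IH.
Qed.

Lemma CW_sub k V V' f : V' `<=` V -> CW k V f -> CW k V' f.
Proof.
move=> VV; elim: k f => [|k IH] f; first by move=> fc x /VV; exact: fc.
move=> [fd ff]; split=> [x /VV/fd//|a]; have [h1 h2] := ff a.
by split; exact: IH.
Qed.

Lemma CWM k V f g : open V -> CW k V f -> CW k V g -> CW k V (fun x => f x * g x).
Proof.
move=> Vo; elim: k f g => [|k IH] f g.
  by move=> fc gc x Vx; apply: continuousM; [exact: fc | exact: gc].
move=> fk gk; have [fd ff] := fk; have [gd gg] := gk.
apply: CW_S => // [x Vx|a|a].
- by apply: wdiffM; [exact: fd | exact: gd].
- have [f1 _] := ff a; have [g1 _] := gg a.
  by apply: CWD => //; apply: IH => //; exact: CWW.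
- have [_ f1] := ff a; have [_ g1] := gg a.
  by apply: CWD => //; apply: IH => //; exact: CWW.
Qed.

Lemma CWZ k V c f : open V -> CW k V f -> CW k V (fun x => c * f x).
Proof. by move=> Vo; apply: CWM => //; exact: CW_cst. Qed.

Lemma CWN k V f : open V -> CW k V f -> CW k V (fun x => - f x).
Proof.
move=> Vo /(CWZ (-1) Vo); apply: CW_ext => // x _; exact: mulN1r.
Qed.

Lemma CWB k V f g : open V -> CW k V f -> CW k V g -> CW k V (fun x => f x - g x).
Proof. by move=> Vo fk gk; apply: CWD => //; exact: CWN. Qed.

Lemma CW_sum k V (I : Type) (s : seq I) (F : I -> 'rV[C]_N -> C) : open V ->
  (forall i, CW k V (F i)) -> CW k V (fun x => \sum_(i <- s) F i x).
Proof.
move=> Vo Fk; elim: s => [|i s IH].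
  by apply: CW_ext (CW_cst k 0 Vo) => // x _; rewrite big_nil.
by apply: CW_ext (CWD Vo (Fk i) IH) => // x _; rewrite big_cons.
Qed.

Lemma CW_prod k V (I : Type) (s : seq I) (F : I -> 'rV[C]_N -> C) : open V ->
  (forall i, CW k V (F i)) -> CW k V (fun x => \prod_(i <- s) F i x).
Proof.
move=> Vo Fk; elim: s => [|i s IH].
  by apply: CW_ext (CW_cst k 1 Vo) => // x _; rewrite big_nil.
by apply: CW_ext (CWM Vo (Fk i) IH) => // x _; rewrite big_cons.
Qed.

(** Real partial derivatives and Wirtinger derivatives are constant combinations of each other. The
    substance is that continuous partial derivatives imply differentiability, by
    [C1_wdifferentiable]. *)
Lemma Ck_CW k V f : open V -> Ck k V f <-> CW k V f.
Proof.
move=> Vo; elim: k f => [|k IH] f; first by split=> [[]|].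
split.
  move=> [fc ff].
  have fd x : V x -> wdifferentiable f x.
    move=> Vx; have [d d0 dV] := open_rnorm Vo Vx.
    apply: (C1_wdifferentiable d0) => [a y /dV Vy|a|a].
    - by have [h1 h2 _ _] := ff a; split; [exact: h1 | exact: h2].
    - have [_ _ h _] := ff a; exact: (CW_continuous ((IH _).1 h)).
    - have [_ _ _ h] := ff a; exact: (CW_continuous ((IH _).1 h)).
  split=> // a; have [_ _ /IH h1 /IH h2] := ff a.
  have h3 := CWZ 'i Vo h2; split.
    by apply: CW_ext (CWZ 2^-1 Vo (CWB Vo h1 h3)) => // x _; rewrite mulrC.
  by apply: CW_ext (CWZ 2^-1 Vo (CWD Vo h1 h3)) => // x _; rewrite mulrC.
move=> fk; have [fd ff] := fk; split=> [x Vx|a].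
  exact: CW_continuous fk Vx.
have [h1 h2] := ff a; split=> [x /fd/(wdiff_rderive (dirx R a))[]//|
    x /fd/(wdiff_rderive (diry R a))[]//||]; apply/IH.
  apply: CW_ext (CWD Vo h1 h2) => // x /fd/(wdiff_rderive (dirx R a))[_ ->].
  by rewrite wlin_dirx.
apply: CW_ext (CWZ 'i Vo (CWB Vo h1 h2)) => // x.
by move=> /fd/(wdiff_rderive (diry R a))[_ ->]; rewrite wlin_diry.
Qed.

Lemma cdiff_conj z : cdiff (fun w : C => w^*) z 0 1.
Proof.
move=> e e0; exists 1 => // w _; rewrite rmorphD /= mul0r add0r mul1r.
have -> : z^* + w^* - z^* - w^* = 0 by ring.
by rewrite cnorm0 mulr_ge0 ?cnorm_ge0// ltW.
Qed.

Lemma CW_conj k V f : open V -> CW k V f -> CW k V (fun x => (f x)^*).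
Proof.
move=> Vo; elim: k f => [|k IH] f.
  move=> fc x Vx; apply/continuous_rnorm => e e0.
  have /continuous_rnorm/(_ e e0)[d d0 H] := fc x Vx.
  by exists d => // v /H; rewrite -rmorphB cnormJ.
move=> [fd ff]; apply: CW_S => // [x Vx|a|a].
- exact: wdiff_compC (cdiff_conj _) (fd x Vx).
- have [_ h] := ff a; apply: CW_ext (IH _ h) => // x _.
  by rewrite mul0r add0r mul1r.
- have [h _] := ff a; apply: CW_ext (IH _ h) => // x _.
  by rewrite mul0r add0r mul1r.
Qed.

Lemma cdiff_inv (z : C) : z != 0 -> cdiff (fun w : C => w^-1) z (- z^-1 ^+ 2) 0.
Proof.
move=> z0 e e0; have cz : 0 < cnorm z.
  by rewrite lt0r cnorm_ge0 andbT; apply: contra z0 => /eqP/cnorm_eq0 ->.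
have K0 : 0 < e * cnorm z ^+ 3 / 2 by rewrite divr_gt0// mulr_gt0// exprn_gt0.
(* The first bound keeps [|z + k| >= |z| / 2], the second makes the remainder
   [k ^ 2 / (z ^ 2 (z + k))] at most [e |k|]. *)
exists (Num.min (cnorm z / 2) (e * cnorm z ^+ 3 / 2)) => [|k].
  by rewrite lt_min divr_gt0.
rewrite lt_min => /andP[k1 k2].
have zk : cnorm z / 2 <= cnorm (z + k).
  have := cnormD (z + k) (- k); rewrite addrK cnormN; lra.
have zk0 : z + k != 0.
  apply/eqP => E; move: zk; rewrite E cnorm0; lra.
have -> : (z + k)^-1 - z^-1 - (- z^-1 ^+ 2 * k + 0 * k^*) =
    k ^+ 2 * (z^-1 ^+ 2 * (z + k)^-1) by field; rewrite z0 zk0.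
rewrite expr2 !cnormM !cnormV.
have -> : cnorm k * cnorm k * ((cnorm z)^-1 * (cnorm z)^-1 * (cnorm (z + k))^-1) =
   cnorm k * (cnorm z)^-1 ^+ 2 * (cnorm (z + k))^-1 * cnorm k by ring.
rewrite ler_wpM2r ?cnorm_ge0// ler_pdivrMr; last by lra.
rewrite exprVn ler_pdivrMr ?exprn_gt0//.
apply: le_trans (ltW k2) _.
apply: (@le_trans _ _ (e * (cnorm z / 2) * cnorm z ^+ 2)).
  by rewrite le_eqVlt; apply/orP; left; apply/eqP; field.
by rewrite ler_wpM2r ?exprn_ge0 ?(ltW cz)// ler_wpM2l// ltW.
Qed.

Lemma CWV k V f : open V -> (forall x, V x -> f x != 0) ->
  CW k V f -> CW k V (fun x => (f x)^-1).
Proof.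
move=> Vo f0; elim: k => [|k IH].
  by move=> fc x Vx; apply: continuousV; [exact: f0 | exact: fc].
move=> fk; have [fd ff] := fk; have h := IH (CWW fk).
have h2 : CW k V (fun x => - (f x)^-1 ^+ 2).
  by apply: CW_ext (CWN Vo (CWM Vo h h)) => // x _; rewrite expr2.
apply: CW_S => // [x Vx|a|a].
- exact: wdiff_compC (cdiff_inv (f0 x Vx)) (fd x Vx).
- have [h3 _] := ff a; apply: CW_ext (CWM Vo h2 h3) => // x _.
  by rewrite mul0r addr0.
- have [_ h3] := ff a; apply: CW_ext (CWM Vo h2 h3) => // x _.
  by rewrite mul0r addr0.
Qed.

End SmoothClass.

Lemma CW_comp N M k (V : set 'rV[C]_N) (W : set 'rV[C]_M)
    (F : 'rV[C]_N -> 'rV[C]_M) (g : 'rV[C]_M -> C) :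
  open V -> (forall x, V x -> W (F x)) ->
  (forall b, CW k V (fun x => F x 0 b)) -> CW k W g -> CW k V (fun x => g (F x)).
Proof.
move=> Vo VW; elim: k g => [|k IH] g Fk.
  move=> gc x Vx; apply: (@continuous_comp _ _ _ F g); last exact: gc (VW _ Vx).
  by apply: continuous_row => b; exact: Fk.
move=> [gd gg].
have Fk' b : CW k V (fun x => F x 0 b) by exact: CWW.
have gk c : CW k V (fun x => dz c g (F x)) by apply: IH => //; case: (gg c).
have gk' c : CW k V (fun x => dzbar c g (F x)) by apply: IH => //; case: (gg c).
apply: CW_S => //.
- move=> x Vx; apply: wdiff_comp (gd _ (VW _ Vx)) _ => b.
  by case: (Fk b) => h _; exact: h.
- move=> a; apply: CW_sum => // b; have [_ /(_ a)[h1 h2]] := Fk b.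
  by apply: CWD => //; apply: CWM => //; exact: CW_conj.
- move=> a; apply: CW_sum => // b; have [_ /(_ a)[h1 h2]] := Fk b.
  by apply: CWD => //; apply: CWM => //; exact: CW_conj.
Qed.

End SmoothFunctions.

(** * Symmetry of second derivatives *)

Section SecondDerivatives.
Variable R : realType.
Local Notation C := (Cplx R).
Variable N : nat.
Implicit Types (f g : 'rV[C]_N -> C) (V : set 'rV[C]_N) (v w x y : 'rV[C]_N).

Lemma rderivable_shift f v y w : rderivable v f (y + w) ->
  rderivable v (fun z => f (z + w)) y /\
  rderive v (fun z => f (z + w)) y = rderive v f (y + w).
Proof.
have E : (fun r : R => f (y + toC r *: v + w)) = (fun r : R => f (y + w + toC r *: v)).
  by apply/funext => r; rewrite addrAC.
move=> [h1 h2]; split.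
  by split; rewrite (funext (fun r => congr1 _ (congr1 (@^~ r) E))).
rewrite /rderive; congr (toC _ + 'i * toC _); congr (derive1 _ 0).
  by apply/funext => r; rewrite (congr1 (@^~ r) E).
by apply/funext => r; rewrite (congr1 (@^~ r) E).
Qed.

Lemma derive1B (u w : R -> R) : derivable u 0 1 -> derivable w 0 1 ->
  derive1 (u - w) 0 = derive1 u 0 - derive1 w 0.
Proof. by move=> ud wd; rewrite !derive1E (deriveB ud wd). Qed.

Lemma rderiveB f g v y : rderivable v f y -> rderivable v g y ->
  rderivable v (fun z => f z - g z) y /\
  rderive v (fun z => f z - g z) y = rderive v f y - rderive v g y.
Proof.
move=> [f1 f2] [g1 g2].
have Er : (fun r : R => reC (f (y + toC r *: v) - g (y + toC r *: v))) =
   (fun r : R => reC (f (y + toC r *: v))) - (fun r : R => reC (g (y + toC r *: v))).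
  by apply/funext => r; rewrite reCD reCN.
have Ei : (fun r : R => imC (f (y + toC r *: v) - g (y + toC r *: v))) =
   (fun r : R => imC (f (y + toC r *: v))) - (fun r : R => imC (g (y + toC r *: v))).
  by apply/funext => r; rewrite imCD imCN.
split; first by split; rewrite ?Er ?Ei; exact: derivableB.
rewrite /rderive Er Ei (derive1B f1 g1) (derive1B f2 g2) !toCB.
by rewrite mulrBr opprD addrACA.
Qed.

(** The mean value estimate in the direction [v] applies to [y => f (y + t w) - f y], whose
    derivative is [t K] up to an error given by the differentiability of [rderive v f] at [x]. *)
Lemma second_difference f x v w (K : C) (d0 : R) : 0 < d0 ->
  (forall y, rnorm (y - x) < d0 -> rderivable v f y) ->
  wdifferentiable (rderive v f) x ->
  K = rderive w (rderive v f) x ->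
  forall e : R, 0 < e -> exists2 d : R, 0 < d & forall t : R, 0 < t < d ->
    cnorm (f (x + toC t *: v + toC t *: w) - f (x + toC t *: v)
           - (f (x + toC t *: w) - f x) - toC t * (toC t * K)) <= e * t ^+ 2.
Proof.
(* All points involved lie within [t * S] of [x]. Two remainders of size [e / (4 * S) * (t * S)] and
   the factor 2 of [mean_value_cnorm] make up [e * t ^+ 2]. *)
move=> d00 fd vfd KE e e0; pose S := rnorm v + rnorm w + 1.
have v0 := rnorm_ge0 v; have w0 := rnorm_ge0 w.
have S0 : 0 < S by rewrite /S; lra.
have e1 : 0 < e / (4 * S) by rewrite divr_gt0// mulr_gt0.
have [d d1 H] := vfd _ e1.
exists (Num.min d0 d / S) => [|t /andP[t0]]; first by rewrite divr_gt0// lt_min d00.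
rewrite ltr_pdivlMr// lt_min => /andP[td0 td].
have rl r u : `|r| <= t -> rnorm u <= t * rnorm w ->
    rnorm (toC r *: v + u) <= t * S.
  move=> rt uw; apply: le_trans (rnormD _ _) _; rewrite rnormZ cnorm_toC.
  have : `|r| * rnorm v <= t * rnorm v by rewrite ler_wpM2r.
  by rewrite /S; lra.
have tw : rnorm (toC t *: w) <= t * rnorm w.
  by rewrite rnormZ cnorm_toC gtr0_norm.
have zw : rnorm (0 : 'rV[C]_N) <= t * rnorm w.
  by rewrite rnorm0 mulr_ge0// ltW.
have near_x r u : `|r| <= t -> rnorm u <= t * rnorm w ->
    rnorm (x + toC r *: v + u - x) < d0.
  move=> rt uw; have -> : x + toC r *: v + u - x = toC r *: v + u.
    by rewrite -(addrA x (toC r *: v)) (addrAC x) subrr add0r.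
  exact: le_lt_trans (rl r u rt uw) td0.
have fdr r u : `|r| <= t -> rnorm u <= t * rnorm w ->
   rderivable v f (x + toC r *: v + u).
  by move=> rt uw; apply: fd; exact: near_x.
pose g : 'rV[C]_N -> C := fun y : 'rV[C]_N => f (y + toC t *: w) - f y.
have gd r : `|r| <= t -> rderivable v g (x + toC r *: v) /\
   rderive v g (x + toC r *: v) =
     rderive v f (x + toC r *: v + toC t *: w) - rderive v f (x + toC r *: v).
  move=> rt; have [h1 h2] := rderivable_shift (fdr r _ rt tw).
  have h3 : rderivable v f (x + toC r *: v).
    by have := fdr r 0 rt zw; rewrite addr0.
  by have := rderiveB h1 h3; rewrite h2.
have := @mean_value_cnorm _ _ g v x t (toC t * K) (2 * (e / (4 * S)) * (t * S)).
rewrite gtr0_norm// => /(_ (fun r rt => (gd r rt).1)) Hmv.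
have -> : f (x + toC t *: v + toC t *: w) - f (x + toC t *: v)
           - (f (x + toC t *: w) - f x) - toC t * (toC t * K) =
  g (x + toC t *: v) - g x - toC t * (toC t * K) by [].
apply: le_trans (Hmv _) _.
  move=> r rt; rewrite (gd r rt).2.
  have h1 := H (toC r *: v + toC t *: w) (le_lt_trans (rl r _ rt tw) td).
  have h2 := H (toC r *: v + 0) (le_lt_trans (rl r _ rt zw) td).
  rewrite !addr0 in h2; rewrite addrA in h1.
  move: h1 h2; rewrite wlinD; set L := wlin _ _.
  have -> : L (toC t *: w) = toC t * K.
    by rewrite KE (wdiff_rderive w vfd).2 -wlinZ.
  set a := rderive v f (_ + _ + _); set b := rderive v f (_ + _).
  move=> h1 h2.
  have -> : a - b - toC t * K =
    (a - rderive v f x - (L (toC r *: v) + toC t * K)) -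
    (b - rderive v f x - L (toC r *: v)) by ring.
  apply: le_trans (cnormD _ _) _; rewrite cnormN.
  have q1 : e / (4 * S) * rnorm (toC r *: v + toC t *: w) <= e / (4 * S) * (t * S).
    by rewrite ler_wpM2l ?(ltW e1)//; exact: rl.
  have q2 : e / (4 * S) * rnorm (toC r *: v) <= e / (4 * S) * (t * S).
    by rewrite ler_wpM2l ?(ltW e1)//; rewrite -[toC r *: v]addr0; exact: rl.
  by apply: le_trans (lerD (le_trans h1 q1) (le_trans h2 q2)) _; lra.
rewrite le_eqVlt; apply/orP; left; apply/eqP.
by field; rewrite gt_eqF.
Qed.

(** The second difference is symmetric in [v] and [w], and both iterated derivatives, multiplied by
    [t ^ 2], approximate it up to o(t ^ 2). *)
Lemma rderive_swap f x v w (d0 : R) : 0 < d0 ->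
  (forall y, rnorm (y - x) < d0 -> rderivable v f y /\ rderivable w f y) ->
  wdifferentiable (rderive v f) x -> wdifferentiable (rderive w f) x ->
  rderive w (rderive v f) x = rderive v (rderive w f) x.
Proof.
move=> d00 fd vd wd; set K := LHS; set K' := RHS.
have key e : 0 < e -> cnorm (K - K') <= 2 * e.
  move=> e0.
  have [d1 d10 H1] := second_difference d00 (fun y h => (fd y h).1) vd (erefl K) e0.
  have [d2 d20 H2] := second_difference d00 (fun y h => (fd y h).2) wd (erefl K') e0.
  pose t := Num.min d1 d2 / 2.
  have t0 : 0 < t by rewrite divr_gt0// lt_min d10.
  have [td1 td2] : t < d1 /\ t < d2.
    have : t < Num.min d1 d2 by rewrite /t; move: t0; rewrite /t; lra.
    by rewrite lt_min => /andP.
  have := H1 t; rewrite t0 td1 => /(_ isT) h1.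
  have := H2 t; rewrite t0 td2 => /(_ isT) h2.
  have : cnorm (toC t * (toC t * (K - K'))) <= 2 * e * t ^+ 2.
    move: h1 h2; rewrite (addrAC x (toC t *: w)).
    move: (f (x + toC t *: v + toC t *: w)) (f (x + toC t *: v)) (f (x + toC t *: w)).
    move: (f x) => s p q r h1 h2.
    have -> : toC t * (toC t * (K - K')) =
      (p - r - (q - s) - toC t * (toC t * K')) -
      (p - q - (r - s) - toC t * (toC t * K)) by ring.
    apply: le_trans (cnormD _ _) _; rewrite cnormN.
    have -> : 2 * e * t ^+ 2 = e * t ^+ 2 + e * t ^+ 2 by ring.
    exact: lerD h2 h1.
  rewrite !cnormM cnorm_toC gtr0_norm// mulrA -expr2 mulrC.
  by rewrite ler_pM2r// exprn_gt0.
apply/eqP; rewrite -subr_eq0; apply/eqP/cnorm_eq0/eqP.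
rewrite eq_le cnorm_ge0 andbT leNgt; apply/negP => h.
by have := key (cnorm (K - K') / 4); have := h; lra.
Qed.

Lemma wdiff_rderive_lin f1 f2 x (c : C) v :
  wdifferentiable f1 x -> wdifferentiable f2 x ->
  rderive v (fun y => (f1 y + c * f2 y) / 2) x =
  (rderive v f1 x + c * rderive v f2 x) / 2.
Proof.
move=> d1 d2.
have d3 := wdiffM (wdiffD d1 (wdiffM (wdiff_cst c x) d2)) (wdiff_cst 2^-1 x).
rewrite (wdiff_rderive v d3).2 (wdiff_rderive v d1).2 (wdiff_rderive v d2).2.
rewrite /wlin mulr_sumr -big_split mulr_suml; apply: eq_bigr => a _.
move: (v 0 a) (v 0 a)^* (dz a f1 x) (dz a f2 x) (dzbar a f1 x) (dzbar a f2 x) => *.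
by rewrite /=; ring.
Qed.

Lemma CW_rderive k V f v : open V -> CW k.+1 V f -> CW k V (rderive v f).
Proof.
move=> Vo [fd ff].
have h : CW k V (fun x => \sum_a (v 0 a * dz a f x + (v 0 a)^* * dzbar a f x)).
  by apply: CW_sum => // a; have [h1 h2] := ff a; apply: CWD => //; exact: CWZ.
by apply: CW_ext h => // x /fd/(wdiff_rderive v)[_ ->].
Qed.

Lemma rderive_comm V f v w x : open V -> CW 2 V f -> V x ->
  rderive w (rderive v f) x = rderive v (rderive w f) x.
Proof.
move=> Vo f2 Vx; have [d d0 dV] := open_rnorm Vo Vx.
have [v1 _] := CW_rderive v Vo f2; have [w1 _] := CW_rderive w Vo f2.
apply: (rderive_swap d0) => [y /dV Vy||]; [|exact: v1|exact: w1].
have [fd _] := f2; have := fd y Vy => fdy.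
by split; [case: (wdiff_rderive v fdy) | case: (wdiff_rderive w fdy)].
Qed.

(** One family for both derivatives, [c = - 'i] for [dz] and [c = 'i] for [dzbar], so that a single
    computation makes them all commute. *)
Definition wirt (c : C) a f x : C :=
  (rderive (dirx R a) f x + c * rderive (diry R a) f x) / 2.

Lemma dz_wirt a f : dz a f = wirt (- 'i) a f.
Proof. by apply/funext => x; rewrite /wirt mulNr. Qed.

Lemma dzbar_wirt a f : dzbar a f = wirt 'i a f.
Proof. by []. Qed.

Lemma wirt_comm_aux (F : fieldType) (p q r s c c' : F) :
  ((p + c' * q) / 2 + c * ((r + c' * s) / 2)) / 2 =
  ((p + c * r) / 2 + c' * ((q + c * s) / 2)) / 2.
Proof. by ring. Qed.

Lemma wirt_comm V f x c c' a b : open V -> CW 2 V f -> V x ->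
  wirt c a (wirt c' b f) x = wirt c' b (wirt c a f) x.
Proof.
move=> Vo f2 Vx; have D v : wdifferentiable (rderive v f) x.
  by have [h _] := CW_rderive v Vo f2; exact: h.
have E c1 c2 i j : wirt c1 i (wirt c2 j f) x =
    ((rderive (dirx R i) (rderive (dirx R j) f) x +
        c2 * rderive (dirx R i) (rderive (diry R j) f) x) / 2 +
     c1 * ((rderive (diry R i) (rderive (dirx R j) f) x +
        c2 * rderive (diry R i) (rderive (diry R j) f) x) / 2)) / 2.
  have L v := wdiff_rderive_lin c2 v (D (dirx R j)) (D (diry R j)).
  by rewrite -[LHS]/((rderive (dirx R i) (wirt c2 j f) x +
     c1 * rderive (diry R i) (wirt c2 j f) x) / 2) !L.
rewrite (E c c' a b) (E c' c b a).
move: (dirx R a) (diry R a) (dirx R b) (diry R b) => xa ya xb yb {E D}.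
rewrite (rderive_comm xb xa Vo f2 Vx) (rderive_comm yb xa Vo f2 Vx).
rewrite (rderive_comm xb ya Vo f2 Vx) (rderive_comm yb ya Vo f2 Vx).
exact: wirt_comm_aux.
Qed.

Definition smooth V f : Prop := forall k, CW k V f.

Lemma Cinf_smooth V f : open V -> Cinf V f <-> smooth V f.
Proof. by move=> Vo; split=> fk k; apply/(Ck_CW k f Vo). Qed.

Lemma smooth_wd V f x : smooth V f -> V x -> wdifferentiable f x.
Proof. by move=> /(_ 1%N)[h _]; exact: h. Qed.

Lemma smooth_dz V f a : smooth V f -> smooth V (dz a f).
Proof. by move=> fs k; have [_ /(_ a)[]] := fs k.+1. Qed.

Lemma smooth_dzbar V f a : smooth V f -> smooth V (dzbar a f).
Proof. by move=> fs k; have [_ /(_ a)[]] := fs k.+1. Qed.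

Lemma smooth_ext V f g : open V -> (forall x, V x -> f x = g x) ->
  smooth V f -> smooth V g.
Proof. by move=> Vo fg fs k; exact: CW_ext (fs k). Qed.

Lemma smooth_local V f : (forall x, V x -> exists U, [/\ open U, U x & smooth U f]) ->
  smooth V f.
Proof.
move=> loc k; elim: k f loc => [|k IH] f loc.
  by move=> x /loc[U [Uo Ux /(_ 0%N)]]; apply.
split=> [x /loc[U [Uo Ux fs]]|a]; first exact: smooth_wd fs Ux.
split; apply: IH => x /loc[U [Uo Ux fs]]; exists U; split=> //.
  exact: smooth_dz.
exact: smooth_dzbar.
Qed.

Lemma dz_near f g x a : nbhs x [set y | f y = g y] -> wdifferentiable f x ->
  dz a g x = dz a f x /\ dzbar a g x = dzbar a f x.
Proof. by move=> fg fd; exact: wdiff_unique (wdiff_near fg fd). Qed.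

Lemma dz_cst (c : C) a x : dz a (fun _ => c) x = 0 /\ dzbar a (fun _ => c) x = 0.
Proof. exact: wdiff_unique (wdiff_cst c x). Qed.

Lemma dzD f g x a : wdifferentiable f x -> wdifferentiable g x ->
  dz a (fun y => f y + g y) x = dz a f x + dz a g x /\
  dzbar a (fun y => f y + g y) x = dzbar a f x + dzbar a g x.
Proof. by move=> fd gd; exact: wdiff_unique (wdiffD fd gd). Qed.

Lemma dzM f g x a : wdifferentiable f x -> wdifferentiable g x ->
  dz a (fun y => f y * g y) x = dz a f x * g x + f x * dz a g x /\
  dzbar a (fun y => f y * g y) x = dzbar a f x * g x + f x * dzbar a g x.
Proof. by move=> fd gd; exact: wdiff_unique (wdiffM fd gd). Qed.

Lemma wdiff_sum (I : Type) (s : seq I) (F : I -> 'rV[C]_N -> C) x :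
  (forall i, wdifferentiable (F i) x) ->
  wdiff (fun y => \sum_(i <- s) F i y) x (fun a => \sum_(i <- s) dz a (F i) x)
    (fun a => \sum_(i <- s) dzbar a (F i) x).
Proof.
move=> Fd; elim: s => [|i s IH].
  have -> : (fun y => \sum_(i <- [::]) F i y) = (fun=> 0).
    by apply/funext => y; rewrite big_nil.
  have -> : (fun a => \sum_(i <- [::]) dz a (F i) x) = (fun=> 0).
    by apply/funext => y; rewrite big_nil.
  have -> : (fun a => \sum_(i <- [::]) dzbar a (F i) x) = (fun=> 0).
    by apply/funext => y; rewrite big_nil.
  exact: wdiff_cst.
have := wdiffD (Fd i) IH.
by congr wdiff; apply/funext => y; rewrite big_cons.
Qed.

Lemma dz_conj f x a : wdifferentiable f x ->
  dz a (fun y => (f y)^*) x = (dzbar a f x)^* /\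
  dzbar a (fun y => (f y)^*) x = (dz a f x)^*.
Proof.
move=> /(wdiff_compC (cdiff_conj _))/(wdiff_unique a).
by rewrite !mul0r !add0r !mul1r.
Qed.

Lemma dz_dzbar_comm V f x a b : open V -> smooth V f -> V x ->
  dz a (dzbar b f) x = dzbar b (dz a f) x.
Proof. by move=> Vo fs Vx; rewrite !dz_wirt !dzbar_wirt; exact: wirt_comm (fs _) Vx. Qed.

(** For real [f], conjugation exchanges [dz] and [dzbar]; the rest is their commutation. *)
Lemma cplx_hessian_herm V f x : open V -> smooth V f -> V x ->
  (forall y, V y -> (f y)^* = f y) ->
  adjmx (cplx_hessian f x) = cplx_hessian f x.
Proof.
move=> Vo fs Vx fr; apply/matrixP => a b; rewrite !mxE.
have Vn : nbhs x V by exact: open_nbhs_nbhs.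
have fJ y c : V y -> (dzbar c f y)^* = dz c f y.
  move=> Vy; have [<- _] := dz_conj c (smooth_wd fs Vy).
  have Vny : nbhs y V by exact: open_nbhs_nbhs.
  have h : nbhs y [set z | f z = (f z)^*] by apply: filterS Vny => z /fr.
  by have [] := dz_near c h (smooth_wd fs Vy).
have d1 : wdifferentiable (dzbar a f) x by exact: smooth_wd (smooth_dzbar a fs) Vx.
rewrite -(dz_conj b d1).2.
have h : nbhs x [set z | dz a f z = (dzbar a f z)^*].
  by apply: filterS Vn => z /fJ.
have [_ ->] := dz_near b h (smooth_wd (smooth_dz a fs) Vx).
by rewrite (dz_dzbar_comm _ _ Vo fs Vx).
Qed.

End SecondDerivatives.

(** * Holomorphic functions and the inverse function theorem *)

Section Holomorphic.
Variable R : realType.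
Local Notation C := (Cplx R).

Definition holomorphic N (V : set 'rV[C]_N) (f : 'rV[C]_N -> C) : Prop :=
  smooth V f /\ forall x a, V x -> dzbar a f x = 0.

Lemma holoP N (V : set 'rV[C]_N) f : open V -> holo V f <-> holomorphic V f.
Proof. by move=> Vo; split=> -[/(Cinf_smooth _ Vo) ? ?]. Qed.

Section OneDomain.
Variables (N : nat) (V : set 'rV[C]_N).
Hypothesis Vo : open V.
Implicit Types (f g : 'rV[C]_N -> C).

Let Vn x : V x -> nbhs x V.
Proof. by move=> Vx; exact: open_nbhs_nbhs. Qed.

Lemma holo_dz f a : holomorphic V f -> holomorphic V (dz a f).
Proof.
move=> [fs fh]; split; first exact: smooth_dz.
move=> x b Vx; rewrite -(dz_dzbar_comm _ _ Vo fs Vx).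
have h : nbhs x [set y | (0 : C) = dzbar b f y].
  by apply: filterS (Vn Vx) => y Vy /=; rewrite fh.
have [-> _] := dz_near a h (wdiffW (wdiff_cst 0 x)).
exact: (dz_cst 0 a x).1.
Qed.

Lemma holo_ext f g : (forall x, V x -> f x = g x) ->
  holomorphic V f -> holomorphic V g.
Proof.
move=> fg [fs fh]; split; first exact: smooth_ext fs.
move=> x a Vx; have h : nbhs x [set y | f y = g y].
  by apply: filterS (Vn Vx) => y /fg.
by rewrite (dz_near a h (smooth_wd fs Vx)).2 fh.
Qed.

Lemma holo_cst c : holomorphic V (fun _ => c).
Proof.
by split=> [k|x a _]; [exact: CW_cst | exact: (dz_cst c a x).2].
Qed.

Lemma holo_coord b : holomorphic V (fun x => x 0 b).
Proof.
split=> [k|x a _]; first exact: CW_coord.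
exact: (wdiff_unique a (wdiff_coord x b)).2.
Qed.

Lemma holoD f g : holomorphic V f -> holomorphic V g ->
  holomorphic V (fun x => f x + g x).
Proof.
move=> [fs fh] [gs gh]; split=> [k|x a Vx]; first exact: CWD.
by rewrite (dzD a (smooth_wd fs Vx) (smooth_wd gs Vx)).2 fh// gh// addr0.
Qed.

Lemma holoM f g : holomorphic V f -> holomorphic V g ->
  holomorphic V (fun x => f x * g x).
Proof.
move=> [fs fh] [gs gh]; split=> [k|x a Vx]; first exact: CWM.
by rewrite (dzM a (smooth_wd fs Vx) (smooth_wd gs Vx)).2 fh// gh// mul0r mulr0 addr0.
Qed.

Lemma holo_sum (I : Type) (s : seq I) (F : I -> 'rV[C]_N -> C) :
  (forall i, holomorphic V (F i)) -> holomorphic V (fun x => \sum_(i <- s) F i x).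
Proof.
move=> Fh; elim: s => [|i s IH].
  by apply: holo_ext (holo_cst 0) => x _; rewrite big_nil.
by apply: holo_ext (holoD (Fh i) IH) => x _; rewrite big_cons.
Qed.

Lemma holoV f : (forall x, V x -> f x != 0) -> holomorphic V f ->
  holomorphic V (fun x => (f x)^-1).
Proof.
move=> f0 [fs fh]; split=> [k|x a Vx]; first exact: CWV.
have := wdiff_compC (cdiff_inv (f0 x Vx)) (smooth_wd fs Vx).
by move=> /(wdiff_unique a)[_ ->]; rewrite fh// mulr0 mul0r addr0.
Qed.

Lemma smoothD f g : smooth V f -> smooth V g -> smooth V (fun x => f x + g x).
Proof. by move=> fs gs k; exact: CWD. Qed.

Lemma smoothM f g : smooth V f -> smooth V g -> smooth V (fun x => f x * g x).
Proof. by move=> fs gs k; exact: CWM. Qed.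

Lemma smooth_sum (I : Type) (s : seq I) (F : I -> 'rV[C]_N -> C) :
  (forall i, smooth V (F i)) -> smooth V (fun x => \sum_(i <- s) F i x).
Proof. by move=> Fs k; apply: CW_sum => // i; exact: Fs. Qed.

Lemma smooth_prod (I : Type) (s : seq I) (F : I -> 'rV[C]_N -> C) :
  (forall i, smooth V (F i)) -> smooth V (fun x => \prod_(i <- s) F i x).
Proof. by move=> Fs k; apply: CW_prod => // i; exact: Fs. Qed.

Lemma smooth_conj f : smooth V f -> smooth V (fun x => (f x)^*).
Proof. by move=> fs k; exact: CW_conj. Qed.

Lemma smoothV f : (forall x, V x -> f x != 0) -> smooth V f ->
  smooth V (fun x => (f x)^-1).
Proof. by move=> f0 fs k; exact: CWV. Qed.

Lemma smooth_cst c : smooth V (fun _ => c).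
Proof. by move=> k; exact: CW_cst. Qed.

Lemma cdiff_ln (r : R) : 0 < r ->
  cdiff (fun w : C => toC (ln (reC w))) (toC r) (toC (2 * r)^-1) (toC (2 * r)^-1).
Proof.
move=> r0 e e0.
have r1 : derivable (@ln R) r 1 by case: (is_derive1_ln r0).
have lnr : 'D_1 (@ln R) r = r^-1 by apply: (@derive_val _ _ _ _ _ _ _ (is_derive1_ln r0)).
have : (fun h => h^-1 *: ((@ln R \o shift r) (h *: (1 : R)) - ln r)) @ 0^' --> r^-1.
  by rewrite -lnr; exact: r1.
move=> /cvgrPdist_le/(_ e e0); rewrite near_withinE => /nbhs_ballP[d /= d0 H].
exists d => // k kd; set h := reC k.
have hk : `|h| <= cnorm k := le_re_cnorm k.
have -> : toC (ln (reC (toC r + k))) - toC (ln (reC (toC r))) -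
    (toC (2 * r)^-1 * k + toC (2 * r)^-1 * k^*) = toC (ln (h + r) - ln r - h / r).
  have E0 : k + k^* = toC (2 * h).
    apply: reim_eq; rewrite ?(reCD, reJ, re_toC) ?(imCD, imJ, im_toC) ?subrr//.
    by rewrite -/h; ring.
  have E1 : reC (toC r + k) = h + r by rewrite reCD re_toC addrC.
  rewrite E1 -mulrDr E0 re_toC -toCM -!toCB; congr toC.
  by field; rewrite gt_eqF.
rewrite cnorm_toC; apply: (@le_trans _ _ (e * `|h|)); last by rewrite ler_wpM2l// ltW.
have [h0|h0] := eqVneq h 0.
  by rewrite h0 add0r subrr mul0r subr0 normr0 mulr0.
have := H h; rewrite -ball_normE /= sub0r normrN => /(_ (le_lt_trans hk kd) h0).
rewrite /GRing.scale /= mulr1.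
have -> : ln (h + r) - ln r - h / r = - (h * (r^-1 - h^-1 * (ln (h + r) - ln r))).
  by rewrite mulrBr mulVKf// opprB.
by move=> Hh; rewrite normrN normrM mulrC ler_wpM2r.
Qed.

Lemma smooth_ln f : (forall x, V x -> exists2 r : R, 0 < r & f x = toC r) ->
  smooth V f -> smooth V (fun x => toC (ln (reC (f x)))) /\
    forall x a, V x ->
    dz a (fun x => toC (ln (reC (f x)))) x = dz a f x / f x /\
    dzbar a (fun x => toC (ln (reC (f x)))) x = dzbar a f x / f x.
Proof.
move=> fr fs.
have fN x : V x -> f x != 0.
  move=> /fr[r r0 ->]; rewrite -toC0; apply/eqP => /toC_inj E.
  by rewrite E ltxx in r0.
have fJ x : V x -> (f x)^* = f x by move=> /fr[r _ ->]; rewrite [LHS]conj_toC.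
have dJ x a : V x -> (dzbar a f x)^* = dz a f x /\ (dz a f x)^* = dzbar a f x.
  move=> Vx; have [<- <-] := dz_conj a (smooth_wd fs Vx).
  have h : nbhs x [set y | f y = (f y)^*] by apply: filterS (Vn Vx) => y /fJ.
  exact: dz_near h (smooth_wd fs Vx).
have wd x : V x -> wdiff (fun x => toC (ln (reC (f x)))) x
    (fun a => dz a f x / f x) (fun a => dzbar a f x / f x).
  move=> Vx; have [r r0 fxr] := fr x Vx.
  have h := cdiff_ln r0; rewrite -fxr in h.
  have := wdiff_compC h (smooth_wd fs Vx).
  have r2 : toC (2 * r)^-1 = (2 * f x)^-1.
    by rewrite fxr toCV toCM; congr (_ * _)^-1; rewrite /toC rmorph_nat.
  rewrite r2; congr wdiff; apply/funext => a; rewrite ?(dJ x a Vx).1 ?(dJ x a Vx).2.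
    by field; rewrite fN.
  by field; rewrite fN.
split; last by move=> x a Vx; exact: wdiff_unique (wd x Vx).
case=> [|k]; first by move=> x Vx; exact: wdiff_continuous (wd x Vx).
have iV : CW k V (fun x => (f x)^-1) by apply: CWV.
apply: CW_S => // [x Vx|a|a]; first exact: wd.
- by apply: CWM => //; exact: (smooth_dz a fs).
- by apply: CWM => //; exact: (smooth_dzbar a fs).
Qed.

(** [dzbar b g] is the conjugate of a holomorphic function, so [dz a] annihilates it. *)
Lemma holo_conj_hessian0 f g : holomorphic V f ->
  (forall x b, V x -> dzbar b g x = (dz b f x / f x)^*) ->
  (forall x, V x -> f x != 0) -> smooth V g ->
  forall x, V x -> cplx_hessian g x = 0.
Proof.
move=> fh gE f0 gs x Vx; apply/matrixP => a b; rewrite !mxE.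
have qh : holomorphic V (fun y => dz b f y / f y).
  by apply: holoM; [exact: holo_dz | exact: holoV].
have h : nbhs x [set y | (dz b f y / f y)^* = dzbar b g y].
  by apply: filterS (Vn Vx) => y Vy /=; rewrite gE.
have wJ : wdifferentiable (fun y => (dz b f y / f y)^*) x.
  exact: smooth_wd (smooth_conj qh.1) Vx.
rewrite (dz_near a h wJ).1 (dz_conj a (smooth_wd qh.1 Vx)).1 qh.2//.
by rewrite conjC0.
Qed.

(** [ln |f|^2] is pluriharmonic, as its [dzbar] derivative is the conjugate of the logarithmic
    derivative of [f]. Changes of frame modify the weight by such a function. *)
Lemma smooth_lnV f : (forall x, V x -> f x != 0) -> holomorphic V f ->
  smooth V (fun x => toC (ln (reC (f x * (f x)^*)))) /\
    forall x, V x -> cplx_hessian (fun x => toC (ln (reC (f x * (f x)^*)))) x = 0.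
Proof.
move=> f0 fh; have us : smooth V (fun x => f x * (f x)^*).
  by apply: smoothM; [exact: fh.1 | exact: smooth_conj fh.1].
have ur x : V x -> exists2 r : R, 0 < r & f x * (f x)^* = toC r.
  by move=> Vx; apply: gt0_toC; rewrite -normCK exprn_gt0// normr_gt0 f0.
have [gs gd] := smooth_ln ur us; split=> //.
apply: (holo_conj_hessian0 fh) => // x b Vx; rewrite (gd x b Vx).2.
have fd := smooth_wd fh.1 Vx; have fJd := smooth_wd (smooth_conj fh.1) Vx.
rewrite (dzM b fd fJd).2 (dz_conj b fd).2 fh.2// mul0r add0r.
rewrite [in RHS]rmorphM [in RHS]fmorphV invfM mulrACA mulfV ?f0//.
exact: mul1r.
Qed.

End OneDomain.

Section Composition.
Variables (N M : nat) (V : set 'rV[C]_N) (W : set 'rV[C]_M).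
Variable F : 'rV[C]_N -> 'rV[C]_M.
Hypotheses (Vo : open V) (VW : forall x, V x -> W (F x)).
Hypothesis Fh : forall b, holomorphic V (fun x => F x 0 b).

Lemma wdiff_comp_holo g x : wdifferentiable g (F x) -> V x ->
  wdiff (fun y => g (F y)) x
    (fun a => \sum_b dz b g (F x) * dz a (fun y => F y 0 b) x)
    (fun a => \sum_b dzbar b g (F x) * (dz a (fun y => F y 0 b) x)^*).
Proof.
move=> gd Vx.
have := wdiff_comp gd (fun b => smooth_wd (Fh b).1 Vx).
congr wdiff; apply/funext => a; apply: eq_bigr => b _.
  by rewrite (Fh b).2// conjC0 mulr0 addr0.
by rewrite (Fh b).2// mulr0 add0r.
Qed.

Lemma smooth_comp g : smooth W g -> smooth V (fun x => g (F x)).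
Proof. by move=> gs k; apply: (CW_comp Vo VW) => // b; exact: (Fh b).1. Qed.

Lemma holo_comp g : holomorphic W g -> holomorphic V (fun x => g (F x)).
Proof.
move=> [gs gh]; split; first exact: smooth_comp.
move=> x a Vx; have := wdiff_comp_holo (smooth_wd gs (VW Vx)) Vx.
move=> /(wdiff_unique a)[_ ->]; rewrite big1// => b _.
by rewrite gh ?mul0r//; exact: VW.
Qed.

Lemma dz_comp g x a : smooth W g -> V x ->
  dz a (fun y => g (F y)) x =
    \sum_b dz b g (F x) * dz a (fun y => F y 0 b) x /\
    dzbar a (fun y => g (F y)) x =
    \sum_b dzbar b g (F x) * (dz a (fun y => F y 0 b) x)^*.
Proof.
by move=> gs Vx; exact: wdiff_unique (wdiff_comp_holo (smooth_wd gs (VW Vx)) Vx).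
Qed.

(** No second derivative of [F] appears: in [dzbar b] of the composite the factors from [F] are
    conjugates of holomorphic functions, which [dz a] annihilates. *)
Lemma cplx_hessian_comp g x : smooth W g -> V x ->
  cplx_hessian (fun y => g (F y)) x =
  jac F x *m cplx_hessian g (F x) *m adjmx (jac F x).
Proof.
move=> gs Vx; apply/matrixP => a b; rewrite !mxE.
have Vn : nbhs x V by exact: open_nbhs_nbhs.
have h : nbhs x [set y | \sum_c dzbar c g (F y) * (dz b (fun y => F y 0 c) y)^* =
    dzbar b (fun y => g (F y)) y].
  by apply: filterS Vn => y Vy /=; rewrite (dz_comp b gs Vy).2.
have FJ c : smooth V (fun y => (dz b (fun y => F y 0 c) y)^*).
  by apply: smooth_conj => //; exact: smooth_dz (Fh c).1.
have gF c : smooth V (fun y => dzbar c g (F y)).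
  by apply: smooth_comp; exact: smooth_dzbar.
have pd c : wdifferentiable (fun y => dzbar c g (F y) * (dz b (fun y => F y 0 c) y)^*) x.
  by apply: smooth_wd Vx; exact: smoothM.
have sd := wdiff_sum (index_enum 'I_M) pd.
rewrite (dz_near a h (wdiffW sd)).1 (wdiff_unique a sd).1.
apply: eq_bigr => c _.
rewrite (dzM a (smooth_wd (gF c) Vx) (smooth_wd (FJ c) Vx)).1.
have Fd := smooth_wd (smooth_dz b (Fh c).1) Vx.
rewrite (dz_conj a Fd).1 (holo_dz Vo b (Fh c)).2// conjC0 mulr0 addr0 !mxE.
congr (_ * _); rewrite (dz_comp a (smooth_dzbar c gs) Vx).1.
by apply: eq_bigr => d _; rewrite !mxE mulrC.
Qed.

End Composition.

End Holomorphic.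

(** * Smooth families of matrices *)

Section SmoothMatrices.
Variable R : realType.
Local Notation C := (Cplx R).
Variables (N : nat) (V : set 'rV[C]_N).
Hypothesis Vo : open V.

Definition msmooth p q (M : 'rV[C]_N -> 'M[C]_(p, q)) : Prop :=
  forall i j, smooth V (fun x => M x i j).

Lemma msmooth_ext p q (M M' : 'rV[C]_N -> 'M[C]_(p, q)) :
  (forall x, V x -> M x = M' x) -> msmooth M -> msmooth M'.
Proof. by move=> E Ms i j; apply: smooth_ext (Ms i j) => // x /E ->. Qed.

Lemma msmooth_cst p q (A : 'M[C]_(p, q)) : msmooth (fun _ => A).
Proof. by move=> i j; exact: smooth_cst. Qed.

Lemma msmoothD p q (M M' : 'rV[C]_N -> 'M[C]_(p, q)) :
  msmooth M -> msmooth M' -> msmooth (fun x => M x + M' x).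
Proof.
move=> Ms Ms' i j; apply: smooth_ext (smoothD Vo (Ms i j) (Ms' i j)) => // x _.
by rewrite mxE.
Qed.

Lemma msmoothM p q r (M : 'rV[C]_N -> 'M[C]_(p, q)) (M' : 'rV[C]_N -> 'M[C]_(q, r)) :
  msmooth M -> msmooth M' -> msmooth (fun x => M x *m M' x).
Proof.
move=> Ms Ms' i j.
have h : smooth V (fun x => \sum_k M x i k * M' x k j).
  by apply: smooth_sum => // k; exact: smoothM.
by apply: smooth_ext h => // x _; rewrite mxE.
Qed.

Lemma msmoothN p q (M : 'rV[C]_N -> 'M[C]_(p, q)) :
  msmooth M -> msmooth (fun x => - M x).
Proof.
move=> Ms i j; apply: smooth_ext (smoothM Vo (smooth_cst Vo (-1)) (Ms i j)) => // x _.
by rewrite mxE mulN1r.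
Qed.

Lemma msmoothX p (M : 'rV[C]_N -> 'M[C]_p) n :
  msmooth M -> msmooth (fun x => M x ^+ n).
Proof.
move=> Ms; elim: n => [|n IH]; first exact: msmooth_cst.
by apply: msmooth_ext (msmoothM Ms IH) => x _; rewrite exprS.
Qed.

Lemma smooth_det p (M : 'rV[C]_N -> 'M[C]_p) :
  msmooth M -> smooth V (fun x => \det (M x)).
Proof.
move=> Ms; apply: smooth_sum => // s; apply: smoothM => //; first exact: smooth_cst.
by apply: smooth_prod => // i; exact: Ms.
Qed.

Lemma msmooth_inv p (M : 'rV[C]_N -> 'M[C]_p) :
  (forall x, V x -> M x \in unitmx) -> msmooth M -> msmooth (fun x => invmx (M x)).
Proof.
move=> Mu Ms i j.
have h : smooth V (fun x => (\det (M x))^-1 * ((-1) ^+ (j + i) * \det (row' j (col' i (M x))))).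
  apply: (smoothM Vo).
    apply: (smoothV Vo); last exact: smooth_det.
    by move=> x /Mu; rewrite unitmxE unitfE.
  apply: (smoothM Vo); first exact: smooth_cst.
  apply: smooth_det => a b; apply: smooth_ext (Ms (lift j a) (lift i b)) => // x _.
  by rewrite !mxE.
by apply: smooth_ext h => // x /Mu Mxu; rewrite /invmx Mxu !mxE.
Qed.

End SmoothMatrices.

(** * Fixed points of contractions *)

Section InverseFunction.
Variable R : realType.
Local Notation C := (Cplx R).

(** The intervals of radius [2 K / 2 ^ n] around [u n] are nested; the supremum of their left ends
    is a common point. *)
Lemma geometric_limit (u : nat -> R) (K : R) :
  (forall n, `|u n.+1 - u n| <= K * 2^-1 ^+ n) ->
  exists l, forall n, `|u n - l| <= 2 * K * 2^-1 ^+ n.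
Proof.
move=> uK; pose h n : R := 2^-1 ^+ n.
have h0 n : 0 < h n by rewrite exprn_gt0// invr_gt0.
have hS n : h n.+1 = h n / 2 by rewrite /h exprS mulrC.
have a_le n p : u n - 2 * K * h n <= u (n + p)%N - 2 * K * h (n + p)%N.
  elim: p => [|p IH]; first by rewrite addn0.
  apply: le_trans IH _; rewrite addnS hS.
  by have := uK (n + p)%N; rewrite -/(h _) ler_norml => /andP[]; lra.
have b_le n p : u (n + p)%N + 2 * K * h (n + p)%N <= u n + 2 * K * h n.
  elim: p => [|p IH]; first by rewrite addn0.
  apply: le_trans IH; rewrite addnS hS.
  by have := uK (n + p)%N; rewrite -/(h _) ler_norml => /andP[]; lra.
have K0 : 0 <= K.
  by have := uK 0%N; rewrite expr0 mulr1; apply: le_trans.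
have ab n m : u n - 2 * K * h n <= u m + 2 * K * h m.
  have [nm|mn] := leqP n m.
    have := a_le n (m - n)%N; rewrite subnKC// => /le_trans; apply.
    by have := mulr_ge0 K0 (ltW (h0 m)); lra.
  have := b_le m (n - m)%N; rewrite (subnKC (ltnW mn)); apply: le_trans.
  by have := mulr_ge0 K0 (ltW (h0 n)); lra.
pose A := range (fun n => u n - 2 * K * h n).
have A0 : A !=set0 by exists (u 0%N - 2 * K * h 0%N); exists 0%N.
have Au : has_ubound A by exists (u 0%N + 2 * K * h 0%N) => _ [n _ <-].
exists (sup A) => n; rewrite -/(h n) distrC ler_distl; apply/andP; split.
  by apply: ub_le_sup => //; exists n.
by apply: ge_sup => // _ [m _ <-].
Qed.

Lemma geometric_limit_row N (X : nat -> 'rV[C]_N) (K : R) :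
  (forall n, rnorm (X n.+1 - X n) <= K * 2^-1 ^+ n) ->
  exists l, exists2 K' : R, 0 <= K' & forall n, rnorm (X n - l) <= K' * 2^-1 ^+ n.
Proof.
move=> XK.
have K0 : 0 <= K.
  by have := XK 0%N; rewrite expr0 mulr1; apply: le_trans (rnorm_ge0 _).
have XKa n a : cnorm (X n.+1 0 a - X n 0 a) <= K * 2^-1 ^+ n.
  by apply: le_trans (XK n); have := cnorm_le_rnorm (X n.+1 - X n) a; rewrite !mxE.
have /choice[lr Hr] a : exists l, forall n, `|reC (X n 0 a) - l| <= 2 * K * 2^-1 ^+ n.
  apply: geometric_limit => n; apply: le_trans (XKa n a).
  by apply: le_trans (le_re_cnorm _); rewrite reCD reCN.
have /choice[li Hi] a : exists l, forall n, `|imC (X n 0 a) - l| <= 2 * K * 2^-1 ^+ n.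
  apply: geometric_limit => n; apply: le_trans (XKa n a).
  by apply: le_trans (le_im_cnorm _); rewrite imCD imCN.
exists (\row_a (toC (lr a) + 'i * toC (li a))), (N%:R * (4 * K)).
  by rewrite mulr_ge0// mulr_ge0.
move=> n.
have : rnorm (X n - \row_a (toC (lr a) + 'i * toC (li a))) <=
    \sum_(a < N) (4 * K * 2^-1 ^+ n).
  apply: ler_sum => a _; rewrite !mxE; apply: le_trans (cnorm_le_reim _) _.
  have -> : 4 * K * 2^-1 ^+ n = 2 * K * 2^-1 ^+ n + 2 * K * 2^-1 ^+ n by ring.
  rewrite !(reCD, reCN, reCM, imCD, imCN, imCM) reCi imCi !re_toC !im_toC.
  rewrite !mul0r !mulr0 mul1r subr0 !addr0 ?add0r.
  exact: lerD.
by move=> /le_trans; apply; rewrite sumr_const card_ord -[X in X <= _]mulr_natl mulrA.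
Qed.

(** Displacing [x0] by less than [r / 2] keeps the iterates of the contraction in the closed ball,
    and puts the fixed point in the open one: [|x - x0| <= |x - x0| / 2 + |T x0 - x0|]. *)
Lemma contraction_fixpoint N (T : 'rV[C]_N -> 'rV[C]_N) x0 (r : R) :
  (forall x y, rnorm (x - x0) <= r -> rnorm (y - x0) <= r ->
     rnorm (T x - T y) <= 2^-1 * rnorm (x - y)) ->
  rnorm (T x0 - x0) < r / 2 ->
  exists2 x, rnorm (x - x0) < r & T x = x.
Proof.
move=> TL Tx0; pose X n := iter n T x0.
have r0 : 0 < r by have := rnorm_ge0 (T x0 - x0); lra.
have XB n : rnorm (X n - x0) <= r.
  elim: n => [|n IH]; first by rewrite /X /= subrr rnorm0 ltW.
  have -> : X n.+1 - x0 = (T (X n) - T x0) + (T x0 - x0) by rewrite addrA subrK.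
  apply: le_trans (rnormD _ _) _.
  have := TL _ _ IH (_ : rnorm (x0 - x0) <= r); rewrite subrr rnorm0 => /(_ (ltW r0)).
  by lra.
have XK n : rnorm (X n.+1 - X n) <= r * 2^-1 ^+ n.
  elim: n => [|n IH]; first by rewrite expr0 mulr1 /X /=; lra.
  apply: le_trans (TL _ _ (XB n.+1) (XB n)) _; rewrite exprS; lra.
have [l [K K0 lK]] := geometric_limit_row XK.
have hsmall (e : R) : 0 < e -> exists n, K * 2^-1 ^+ n < e.
  move=> e0; have : (2^-1 : R) ^+ n @[n --> \oo] --> 0.
    by apply: cvg_expr; rewrite ger0_norm ?invr_ge0// invf_lt1// ltr1n.
  move=> /cvgrPdist_lt/(_ (e / (K + 1)))[|n _ /(_ n (leqnn n))].
    by rewrite divr_gt0// ltr_wpDl.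
  rewrite sub0r normrN ger0_norm ?exprn_ge0 ?invr_ge0// ltr_pdivlMr ?ltr_wpDl// => h.
  exists n; apply: le_lt_trans h; rewrite mulrC ler_wpM2l ?exprn_ge0 ?invr_ge0//; lra.
have lB : rnorm (l - x0) <= r.
  rewrite leNgt; apply/negP => lr; have [|n hn] := hsmall (rnorm (l - x0) - r); first lra.
  have : rnorm (l - x0) <= rnorm (l - X n) + rnorm (X n - x0).
    by apply: le_trans (rnormD _ _); rewrite addrA subrK.
  have := XB n; have := lK n; rewrite rnormB; lra.
have Tl : T l = l.
  apply/eqP; rewrite -subr_eq0; apply/eqP/rnorm_eq0/eqP.
  rewrite eq_le rnorm_ge0 andbT leNgt; apply/negP => Tl0.
  have [|n hn] := hsmall (rnorm (T l - l) / 2); first lra.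
  have : rnorm (T l - l) <= rnorm (T l - X n.+1) + rnorm (X n.+1 - l).
    by apply: le_trans (rnormD _ _); rewrite addrA subrK.
  have := TL _ _ lB (XB n); have := lK n; have := lK n.+1.
  rewrite exprS (rnormB (X n)) -[T (X n)]/(X n.+1).
  by have := rnorm_ge0 (l - X n); have := hn; nra.
exists l => //.
have : rnorm (l - x0) <= rnorm (T l - T x0) + rnorm (T x0 - x0).
  by rewrite Tl; apply: le_trans (rnormD _ _); rewrite addrA subrK.
have := TL _ _ lB (_ : rnorm (x0 - x0) <= r); rewrite subrr rnorm0 => /(_ (ltW r0)).
have := rnorm_ge0 (l - x0); lra.
Qed.

Lemma rnorm_mulmx N M (A : 'M[C]_(N, M)) (v : 'rV[C]_N) (K : R) :
  (forall i, \sum_j cnorm (A i j) <= K) -> rnorm (v *m A) <= K * rnorm v.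
Proof.
move=> AK; rewrite /rnorm mulr_sumr.
apply: (@le_trans _ _ (\sum_j \sum_i cnorm (v 0 i) * cnorm (A i j))).
  apply: ler_sum => j _; rewrite mxE; apply: le_trans (cnorm_sum _ _) _.
  by apply: ler_sum => i _; rewrite cnormM.
rewrite exchange_big; apply: ler_sum => i _ /=.
by rewrite -mulr_sumr mulrC ler_wpM2r ?cnorm_ge0.
Qed.

Lemma mulmx_bound N M (A : 'M[C]_(N, M)) : exists2 K : R, 0 < K &
  forall v : 'rV[C]_N, rnorm (v *m A) <= K * rnorm v.
Proof.
exists (1 + \sum_i \sum_j cnorm (A i j)).
  rewrite ltr_wpDr// sumr_ge0// => i _; rewrite sumr_ge0// => j _; exact: cnorm_ge0.
move=> v; apply: rnorm_mulmx => i; rewrite (bigD1 i)//= addrCA lerDl addr_ge0//.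
by rewrite sumr_ge0// => k _; rewrite sumr_ge0// => j _; exact: cnorm_ge0.
Qed.

End InverseFunction.

(** * The holomorphic inverse function theorem *)

Section HolomorphicInverse.
Variable R : realType.
Local Notation C := (Cplx R).
Variables (N : nat) (V : set 'rV[C]_N) (F : 'rV[C]_N -> 'rV[C]_N) (x0 : 'rV[C]_N).
Hypotheses (Vo : open V) (Vx0 : V x0).
Hypothesis Fh : forall b, holomorphic V (fun x => F x 0 b).
Hypothesis Ju : jac F x0 \in unitmx.

Let A := invmx (jac F x0).
(* [F x = y] if and only if [x] is a fixed point of [x => g x + y *m A], and the
   differential of [g] vanishes at [x0]. *)
Let g x := x - F x *m A.

Lemma g_holo b : holomorphic V (fun x => g x 0 b).
Proof.
have h : holomorphic V (fun x => x 0 b + (-1) * \sum_c F x 0 c * A c b).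
  apply: (holoD Vo); first exact: holo_coord.
  apply: (holoM Vo); first exact: holo_cst.
  apply: (holo_sum Vo) => c; apply: (holoM Vo); first exact: Fh.
  exact: holo_cst.
by apply: (holo_ext Vo) h => x _; rewrite !mxE mulN1r.
Qed.

Lemma g_jac x : V x -> jac g x = 1%:M - jac F x *m A.
Proof.
move=> Vx; apply/matrixP => a b; rewrite !mxE.
have FA c : wdifferentiable (fun y => F y 0 c * A c b) x.
  have := wdiffM (smooth_wd (Fh c).1 Vx) (wdiff_cst (A c b) x).
  exact: wdiffW.
have sd := wdiffD (wdiff_coord x b)
  (wdiffM (wdiff_cst (-1) x) (wdiff_sum (index_enum 'I_N) FA)).
have -> : (fun y => g y 0 b) = (fun y => y 0 b + (-1) * \sum_c F y 0 c * A c b).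
  by apply/funext => y; rewrite !mxE mulN1r.
rewrite (wdiff_unique a sd).1 mul0r add0r mulN1r; congr (_ - _).
apply: eq_bigr => c _.
rewrite (dzM a (smooth_wd (Fh c).1 Vx) (wdiffW (wdiff_cst (A c b) x))).1.
by rewrite (dz_cst _ a x).1 mulr0 addr0 mxE.
Qed.

(** The entries of [jac g] vanish at [x0], hence are small nearby. The bound is chosen for the
    Lipschitz constant [2^-1]: there are [N] components, each with the factor 2 of
    [mean_value_cnorm]. *)
Lemma g_contraction : exists2 r : R, 0 < r & forall x, rnorm (x - x0) < 4 * r ->
  V x /\ forall a b, cnorm (jac g x a b) <= (4 * (N%:R + 1))^-1.
Proof.
pose ep : R := (4 * (N%:R + 1))^-1.
have ep0 : 0 < ep by rewrite invr_gt0 mulr_gt0// ltr_wpDl.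
have [d0 d00 dV] := open_rnorm Vo Vx0.
have J0 : jac g x0 = 0 by rewrite g_jac// mulmxV// subrr.
have /choice[D HD] (ab : 'I_N * 'I_N) : exists d : R, 0 < d /\
    forall x, rnorm (x - x0) < d -> cnorm (jac g x ab.1 ab.2) <= ep.
  have := smooth_dz ab.1 (g_holo ab.2).1 0%N => /(_ x0 Vx0)/continuous_rnorm.
  move=> /(_ ep ep0)[d dd0 H]; exists d; split=> // x xd.
  have E : dz ab.1 (fun y => g y 0 ab.2) x0 = 0.
    by have := congr1 (fun M : 'M[C]_N => M ab.1 ab.2) J0; rewrite [LHS]mxE [RHS]mxE.
  by rewrite mxE; have := H x xd; rewrite E subr0 => /ltW.
pose d := Num.min d0 (\big[Num.min/1]_ab D ab).
have dd : 0 < d by rewrite lt_min d00 lt_bigmin// => ab _; case: (HD ab).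
exists (d / 4) => [|x]; first by rewrite divr_gt0.
have -> : 4 * (d / 4) = d by field.
rewrite lt_min => /andP[/dV Vx xd]; split=> // a b.
have [_] := HD (a, b); apply; apply: (lt_le_trans xd).
by rewrite (bigD1 (a, b))//= ge_min lexx.
Qed.

Lemma g_lipschitz (r : R) : 0 < r -> (forall x, rnorm (x - x0) < 4 * r ->
    V x /\ forall a b, cnorm (jac g x a b) <= (4 * (N%:R + 1))^-1) ->
  forall x y, rnorm (x - x0) <= r -> rnorm (y - x0) <= r ->
    rnorm (g x - g y) <= 2^-1 * rnorm (x - y).
Proof.
move=> r0 rP x y xr yr; set ep := (4 * (N%:R + 1))^-1 in rP.
have ep0 : 0 < ep by rewrite invr_gt0 mulr_gt0// ltr_wpDl.
have xy : rnorm (x - y) <= 2 * r.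
  have -> : x - y = (x - x0) + (x0 - y) by rewrite addrA subrK.
  by apply: le_trans (rnormD _ _) _; rewrite (rnormB x0); lra.
(* [mean_value_cnorm] also runs over negative parameters, so the segment is prolonged beyond [y], up
   to distance [r + 2 * r] from [x0]. *)
have line t : `|t| <= 1 -> rnorm (y + toC t *: (x - y) - x0) < 4 * r.
  move=> t1; rewrite addrAC; apply: le_lt_trans (rnormD _ _) _.
  rewrite rnormZ cnorm_toC.
  have : `|t| * rnorm (x - y) <= 1 * rnorm (x - y) by rewrite ler_wpM2r ?rnorm_ge0.
  by lra.
have key b : cnorm (g x 0 b - g y 0 b) <= 2 * (ep * rnorm (x - y)).
  have gd t : `|t| <= 1 ->
      wdifferentiable (fun z => g z 0 b) (y + toC t *: (x - y)).
    by move=> /line/rP[Vz _]; exact: smooth_wd (g_holo b).1 Vz.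
  have := @mean_value_cnorm _ _ (fun z => g z 0 b) (x - y) y 1 0
    (ep * rnorm (x - y)).
  rewrite mulr0 subr0 normr1 mulr1 toC1 scale1r (addrC y) subrK.
  apply=> t t1.
    exact: (wdiff_rderive _ (gd t t1)).1.
  rewrite subr0 (wdiff_rderive _ (gd t t1)).2 /wlin mulr_sumr.
  apply: le_trans (cnorm_sum _ _) _; apply: ler_sum => a _.
  have [Vz Jz] := rP _ (line t t1).
  rewrite (g_holo b).2// mulr0 addr0 cnormM mulrC ler_wpM2r ?cnorm_ge0//.
  by have := Jz a b; rewrite mxE.
have : rnorm (g x - g y) <= \sum_(b < N) 2 * (ep * rnorm (x - y)).
  have subE (u v : 'rV[C]_N) b : (u - v) 0 b = u 0 b - v 0 b by rewrite !mxE.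
  by apply: ler_sum => b _; rewrite subE; exact: key.
move=> /le_trans; apply; rewrite sumr_const card_ord -[X in X <= _]mulr_natl.
have xy0 := rnorm_ge0 (x - y).
rewrite mulrCA !mulrA ler_wpM2r//.
have N1 : 0 < N%:R + 1 :> R by rewrite ltr_wpDl.
have -> : 2 * N%:R * ep = 2^-1 * (N%:R / (N%:R + 1)).
  by rewrite /ep; field; rewrite gt_eqF.
by rewrite -[leRHS]mulr1 ler_wpM2l ?invr_ge0// ler_pdivrMr// mul1r lerDl.
Qed.

Theorem holomorphic_inverse : exists U W (G : 'rV[C]_N -> 'rV[C]_N),
  [/\ open U, open W, U `<=` V, U x0 &
   [/\ forall x, U x -> W (F x) /\ G (F x) = x,
       forall y, W y -> U (G y) /\ F (G y) = y &
       forall b, holomorphic W (fun y => G y 0 b)]].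
Proof.
have [r r0 rP] := g_contraction.
have gL := g_lipschitz r0 rP.
have r4 : r < 4 * r by lra.
have ballV x : rnorm (x - x0) < r -> V x.
  by move=> xr; case: (rP x (lt_trans xr r4)).
have [K K0 AK] := mulmx_bound A.
have Fg x : F x *m A = x - g x by rewrite /g opprB addrC subrK.
have AJ (v : 'rV[C]_N) : v *m A *m jac F x0 = v by rewrite mulmxKV.
have E4 (a b c d : 'rV[C]_N) : a - b - (c - d) = a - c - (b - d).
  by rewrite !opprB addrACA [RHS]addrACA (addrC (- c)).
(* From [x - y = (F x - F y) *m A + (g x - g y)] and the contraction property of [g]. It yields
   injectivity of [F] and the Lipschitz bound on [G]. *)
have expand x y : rnorm (x - x0) <= r -> rnorm (y - x0) <= r ->
    rnorm (x - y) <= 2 * K * rnorm (F x - F y).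
  move=> xr yr; have := gL x y xr yr.
  have := AK (F x - F y); rewrite mulmxBl !Fg.
  rewrite E4.
  have : rnorm (x - y) <= rnorm (x - y - (g x - g y)) + rnorm (g x - g y).
    by apply: le_trans (rnormD _ _); rewrite subrK.
  lra.
(* These are exactly the [y] for which [x => g x + y *m A] moves [x0] by less than [r / 2], as
   [contraction_fixpoint] requires. *)
pose W := [set y | rnorm ((y - F x0) *m A) < r / 2].
pose U := [set x | rnorm (x - x0) < r /\ W (F x)].
have Wo : open W.
  rewrite openE => y Wy; apply/nbhs_rnorm.
  pose d := (r / 2 - rnorm ((y - F x0) *m A)) / K.
  exists d => [|v vd]; first by rewrite divr_gt0// subr_gt0.
  rewrite /W /=; have -> : v - F x0 = (v - y) + (y - F x0) by rewrite addrA subrK.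
  rewrite mulmxDl; apply: le_lt_trans (rnormD _ _) _.
  have := AK (v - y); move: vd; rewrite ltr_pdivlMr//.
  move: (rnorm (v - y)) (rnorm ((v - y) *m A)) (rnorm ((y - F x0) *m A)) => a b c.
  lra.
have Uo : open U.
  rewrite openE => x [xr WFx].
  have Vx := ballV x xr.
  have Fc e : 0 < e -> exists2 d : R, 0 < d &
      forall v, rnorm (v - x) < d -> rnorm (F v - F x) < e.
    have : {for x, continuous F}.
      by apply: continuous_row => b; exact: CW_continuous ((Fh b).1 0%N) Vx.
    by move=> /continuous_rnorm_row; apply.
  have [d d0 dW] := open_rnorm Wo WFx; have [d' d'0 H] := Fc d d0.
  apply/nbhs_rnorm; exists (Num.min d' (r - rnorm (x - x0))) => [|v].
    by rewrite lt_min d'0 subr_gt0.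
  rewrite lt_min => /andP[/H/dW WFv vx]; split=> //.
  have -> : v - x0 = (v - x) + (x - x0) by rewrite addrA subrK.
  by apply: le_lt_trans (rnormD _ _) _; lra.
have E8 (a b c : 'rV[C]_N) (M : 'M[C]_N) : M \in unitmx ->
    b = a *m M + c -> a = b *m invmx M - c *m invmx M.
  by move=> Mu ->; rewrite mulmxDl addrK mulmxK.
have E6 (a b c : 'rV[C]_N) : a + b - c = b - (c - a).
  by rewrite opprB addrA (addrC b).
have E7 (a b : 'rV[C]_N) : b - (a + b - a) = 0.
  by rewrite addrAC subrr add0r subrr.
have E5 (a b c : 'rV[C]_N) : a + c - (b + c) = a - b.
  by rewrite opprD addrACA subrr addr0.
have /choice[G GP] y : exists x, W y -> U x /\ F x = y.
  have [Wy|nWy] := pselect (W y); last by exists x0.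
  have [x xr Tx] : exists2 x, rnorm (x - x0) < r & g x + y *m A = x.
    apply: (@contraction_fixpoint _ _ (fun x => g x + y *m A)) => [x z xr zr|].
      by rewrite E5; exact: gL.
    have -> : g x0 + y *m A - x0 = (y - F x0) *m A.
      by rewrite mulmxBl Fg E6.
    exact: Wy.
  have Fx : F x = y.
    apply/esym/eqP; rewrite -subr_eq0 -(AJ (y - F x)) mulmxBl.
    have -> : y *m A - F x *m A = 0.
      by rewrite Fg -{1}Tx E7.
    by rewrite mul0mx.
  exists x => _; split; last exact: Fx.
  by split; [exact: xr | rewrite Fx; exact: Wy].
have GU y : W y -> rnorm (G y - x0) < r by case/GP => -[].
have GF x : U x -> G (F x) = x.
  move=> [xr WFx]; have [_ E] := GP _ WFx.
  have := expand (G (F x)) x (ltW (GU _ WFx)) (ltW xr).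
  rewrite E subrr rnorm0 mulr0 => h; apply/eqP; rewrite -subr_eq0.
  by apply/eqP/rnorm_eq0/eqP; rewrite eq_le rnorm_ge0 h.
have GL y y' : W y -> W y' -> rnorm (G y - G y') <= 2 * K * rnorm (y - y').
  move=> Wy Wy'; have [_ E] := GP _ Wy; have [_ E'] := GP _ Wy'.
  by have := expand _ _ (ltW (GU _ Wy)) (ltW (GU _ Wy')); rewrite E E'.
(* A vector killed by [jac F x] is fixed by [jac g x], which at least halves [rnorm]. *)
have JU x : U x -> jac F x \in unitmx.
  move=> [xr _]; rewrite -row_free_unit -kermx_eq0; apply/rowV0P => v.
  move=> /sub_kermxP vJ; apply: rnorm_eq0; apply/eqP.
  have [Vx Jg] := rP x (lt_trans xr r4).
  have : rnorm (v *m jac g x) <= 2^-1 * rnorm v.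
    apply: rnorm_mulmx => i; apply: (@le_trans _ _ (\sum_(j < N) (4 * (N%:R + 1))^-1)).
      by apply: ler_sum => j _; exact: Jg.
    rewrite sumr_const card_ord -[X in X <= _]mulr_natl.
    have N1 : 0 < N%:R + 1 :> R by rewrite ltr_wpDl.
    rewrite ler_pdivrMr ?mulr_gt0//; have : 0 <= N%:R :> R by [].
    lra.
  rewrite g_jac// mulmxBr mulmx1 mulmxA vJ mul0mx subr0 => h.
  by rewrite eq_le rnorm_ge0 andbT; lra.
have Gd y b : W y -> wdiff (fun z => G z 0 b) y
    (fun c => invmx (jac F (G y)) c b) (fun=> 0).
  move=> Wy; have [Ux Fx] := GP _ Wy; set x := G y in Ux Fx *.
  have Vx : V x by case: Ux => xr _; exact: ballV.
  set J := invmx (jac F x).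
  pose rho h c := F (x + h) 0 c - F x 0 c -
    wlin (fun a => dz a (fun z => F z 0 c) x) (fun a => dzbar a (fun z => F z 0 c) x) h.
  have rho_small : osmall (fun h => \sum_c (- J c b) * rho h c).
    by apply: osmall_sum => c; apply: osmallZ; exact: smooth_wd (Fh c).1 Vx.
  have [d1 d10 dW] := open_rnorm Wo Wy.
  have K2 : 0 < 2 * K by rewrite mulr_gt0.
  move=> e e0; have [d d0 H] := rho_small (e / (2 * K)) (divr_gt0 e0 K2).
  exists (Num.min d1 (d / (2 * K))) => [|k]; first by rewrite lt_min d10 divr_gt0.
  rewrite lt_min ltr_pdivlMr// => /andP[k1 k2].
  have Wyk : W (y + k) by apply: dW; rewrite addrAC subrr add0r.
  have hk : rnorm (G (y + k) - x) <= 2 * K * rnorm k.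
    by have := GL _ _ Wyk Wy; rewrite addrAC subrr add0r.
  have := H (G (y + k) - x) (le_lt_trans hk _); rewrite mulrC => /(_ k2).
  move=> Hh; apply: (@le_trans _ _ (e / (2 * K) * rnorm (G (y + k) - x))); last first.
    apply: le_trans (ler_wpM2l _ hk) _; first by rewrite ltW// divr_gt0.
    by rewrite mulrA divfK// gt_eqF.
  apply: le_trans Hh; rewrite le_eqVlt; apply/orP; left; apply/eqP; congr cnorm.
  (* For the increment [G (y + k) - x] of the argument, [F] grows by [k]: its linear part plus
     [rho]. Solving for the increment gives the differential of [G], with an error controlled by
     [rho]. *)
  have kE : k = (G (y + k) - x) *m jac F x + \row_c rho (G (y + k) - x) c.
    apply/rowP => c; rewrite [RHS]mxE; set S := (_ *m _) 0 c.
    have wl : wlin (fun a => dz a (fun z => F z 0 c) x)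
        (fun a => dzbar a (fun z => F z 0 c) x) (G (y + k) - x) = S.
      rewrite /S mxE; apply: eq_bigr => j _; rewrite (Fh c).2// mulr0 addr0.
      by congr (_ * _); rewrite mxE.
    rewrite mxE /rho wl (addrC x) subrK Fx (GP _ Wyk).2 addrC subrK mxE.
    by rewrite addrAC subrr add0r.
  have hE : (G (y + k) - x) = k *m J - (\row_c rho (G (y + k) - x) c) *m J.
    exact: E8 (JU _ Ux) kE.
  have subE (u v : 'rV[C]_N) : (u - v) 0 b = u 0 b - v 0 b by rewrite !mxE.
  have wl2 : wlin (fun c => J c b) (fun=> 0) k = (k *m J) 0 b.
    by rewrite [RHS]mxE; apply: eq_bigr => c _; rewrite mulr0 addr0.
  have rl h : ((\row_c rho h c) *m J) 0 b = \sum_c rho h c * J c b.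
    by rewrite mxE; apply: eq_bigr => c _; rewrite mxE.
  have E1 := congr1 (fun v : 'rV[C]_N => v 0 b) hE; rewrite /= !subE in E1.
  rewrite wl2 E1 rl addrAC subrr add0r -sumrN; apply: eq_bigr => c _.
  by rewrite mulNr mulrC.
exists U, W, G; split=> //.
- by move=> x [/ballV].
- by split; rewrite ?subrr ?rnorm0// /W /= subrr mul0mx rnorm0 divr_gt0.
split=> // [x [xr WFx]|b]; first by split=> //; exact: GF.
split=> [k|y a Wy]; last exact: (wdiff_unique a (Gd y b Wy)).2.
have Vsub x : U x -> V x by case=> /ballV.
have Jinv : msmooth U (fun x => invmx (jac F x)).
  apply: (msmooth_inv Uo JU) => i j.
  have h : smooth U (dz i (fun z => F z 0 j)).
    by move=> q; apply: CW_sub (smooth_dz i (Fh j).1 q).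
  by apply: (smooth_ext Uo _ h) => x _; rewrite mxE.
(* Bootstrap: the derivative of [G] is [invmx (jac F)] evaluated along [G], so each class of [G]
   yields the next one. *)
elim: k b => [|k IH] b.
  by move=> y Wy; exact: wdiff_continuous (Gd y b Wy).
apply: (CW_S Wo (fun y Wy => Gd y b Wy)) => a; last exact: CW_cst.
apply: (CW_comp (W := U) Wo _ IH (Jinv a b k)).
by move=> y /GP[].
Qed.

End HolomorphicInverse.

(** * Curvature and adapted charts *)

Section Charts.
Variable R : realType.
Local Notation C := (Cplx R).

Lemma open_chart_preimage (T : topologicalType) N (c : chart R T N) (W : set T) :
  open W -> open (ch_cod c `&` ch_from c @^-1` W).
Proof.
move=> Wo; rewrite openE => z [cz Wz].
have h1 : nbhs z (ch_cod c) by apply: open_nbhs_nbhs; split=> //; exact: ch_cod_open.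
have h2 : nbhs z (ch_from c @^-1` W).
  by apply: (ch_from_cont cz); exact: open_nbhs_nbhs.
exact: filterI h1 h2.
Qed.

Lemma transition_holomorphic N (X : complexManifold R N) (c c' : chart R X N) b :
  atlas c -> atlas c' ->
  holomorphic (ch_cod c `&` ch_from c @^-1` ch_dom c')
    (fun z => ch_to c' (ch_from c z) 0 b).
Proof.
move=> ac ac'; have [h _] := atlas_compat ac ac'.
by apply/holoP; [apply: open_chart_preimage; exact: ch_dom_open | exact: h].
Qed.

Lemma smooth_on_chart N (X : complexManifold R N) (W : set X) f (c : chart R X N) :
  open W -> smooth_on W f -> atlas c ->
  smooth (ch_cod c `&` ch_from c @^-1` W) (fun z => f (ch_from c z)).
Proof.
move=> Wo fs ac; apply/Cinf_smooth; first exact: open_chart_preimage.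
exact: fs.
Qed.

Lemma cplx_hessianE N (f : 'rV[C]_N -> C) x a b :
  cplx_hessian f x a b = dz a (dzbar b f) x.
Proof. by rewrite mxE. Qed.

Lemma cplx_hessian_near N (V : set 'rV[C]_N) f g x : open V -> V x ->
  (forall y, V y -> f y = g y) -> smooth V f ->
  cplx_hessian g x = cplx_hessian f x.
Proof.
move=> Vo Vx fg fs; apply/matrixP => a b.
rewrite [LHS]cplx_hessianE [RHS]cplx_hessianE.
have h y : V y -> dzbar b g y = dzbar b f y.
  move=> Vy; have Vn : nbhs y V by exact: open_nbhs_nbhs.
  have hn : nbhs y [set z | f z = g z] by apply: filterS Vn.
  exact: (dz_near b hn (smooth_wd fs Vy)).2.
have Vn : nbhs x V by exact: open_nbhs_nbhs.
have hn : nbhs x [set z | dzbar b f z = dzbar b g z].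
  by apply: filterS Vn => z /h.
exact: (dz_near a hn (smooth_wd (smooth_dzbar b fs) Vx)).1.
Qed.

Lemma cplx_hessianD N (V : set 'rV[C]_N) f g x : open V -> V x ->
  smooth V f -> smooth V g ->
  cplx_hessian (fun y => f y + g y) x = cplx_hessian f x + cplx_hessian g x.
Proof.
move=> Vo Vx fs gs; apply/matrixP => a b.
rewrite [LHS]cplx_hessianE [RHS]mxE [X in _ = X + _]cplx_hessianE.
rewrite [X in _ = _ + X]cplx_hessianE.
have Vn : nbhs x V by exact: open_nbhs_nbhs.
have hn : nbhs x [set z | dzbar b f z + dzbar b g z = dzbar b (fun y => f y + g y) z].
  apply: filterS Vn => z Vz /=.
  by rewrite (dzD b (smooth_wd fs Vz) (smooth_wd gs Vz)).2.
have fd := smooth_wd (smooth_dzbar b fs) Vx.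
have gd := smooth_wd (smooth_dzbar b gs) Vx.
by rewrite (dz_near a hn (wdiffW (wdiffD fd gd))).1 (dzD a fd gd).1.
Qed.

Lemma cplx_hessianN N (V : set 'rV[C]_N) f x : open V -> V x -> smooth V f ->
  cplx_hessian f x = 0 -> cplx_hessian (fun y => - f y) x = 0.
Proof.
move=> Vo Vx fs f0.
have Ns : smooth V (fun y => - f y) by move=> k; exact: CWN.
have := cplx_hessianD Vo Vx fs Ns; rewrite f0 add0r => <-.
have s0 := smooth_cst Vo (0 : C).
have E y : V y -> 0 = f y + - f y by rewrite subrr.
rewrite (cplx_hessian_near Vo Vx E s0); apply/matrixP => a b.
rewrite cplx_hessianE [RHS]mxE.
have Vn : nbhs x V by exact: open_nbhs_nbhs.
have hn : nbhs x [set z | (0 : C) = dzbar b (fun=> 0) z].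
  by apply: filterS Vn => z _ /=; rewrite (dz_cst 0 b z).2.
by rewrite (dz_near a hn (wdiffW (wdiff_cst 0 x))).1 (dz_cst 0 a x).1.
Qed.

Section Curvature.
Variables (N : nat) (X : complexManifold R N) (L : lineBundle X) (h : hermMetric L).
Implicit Types (e : localFrame L) (c : chart R X N).

Lemma frame_norm_gt0 e x : frames e -> fr_dom e x ->
  exists2 r : R, 0 < r & h x (fr_sec e x) (fr_sec e x) = toC r.
Proof.
move=> fe ex; apply: gt0_toC; rewrite dnorm_gt0.
by case: (frame_basis fe ex).
Qed.

Lemma weight_smooth e c : frames e -> atlas c ->
  smooth (ch_cod c `&` ch_from c @^-1` fr_dom e)
    (fun z => weight h e (ch_from c z)).
Proof.
move=> fe ac; have eo := frame_open fe.
have Vo := open_chart_preimage (c := c) eo.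
have us := smooth_on_chart eo (herm_smooth h fe) ac.
have [ls _] := smooth_ln Vo (fun z Vz => frame_norm_gt0 fe Vz.2) us.
move=> k; apply: (CW_ext Vo _ (CWN Vo (ls k))) => z _.
by rewrite /weight toCN.
Qed.

Lemma weight_real e x : (weight h e x)^* = weight h e x.
Proof. exact: conj_toC. Qed.

Lemma curvature_herm e c x : frames e -> atlas c -> ch_dom c x -> fr_dom e x ->
  adjmx (curvature h e c x) = curvature h e c x.
Proof.
move=> fe ac cx ex; have Vo := open_chart_preimage (c := c) (frame_open fe).
apply: (cplx_hessian_herm Vo (weight_smooth fe ac)).
  by split; [exact: ch_toP | rewrite /preimage /= ch_toK].
by move=> y _; exact: weight_real.
Qed.

Lemma curvature_change e c c' x : frames e -> atlas c -> atlas c' ->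
  ch_dom c x -> ch_dom c' x -> fr_dom e x ->
  curvature h e c x = transition_jac c c' x *m curvature h e c' x
                        *m adjmx (transition_jac c c' x).
Proof.
move=> fe ac ac' cx c'x ex.
pose F z := ch_to c' (ch_from c z).
pose V := ch_cod c `&` ch_from c @^-1` (ch_dom c' `&` fr_dom e).
pose W := ch_cod c' `&` ch_from c' @^-1` fr_dom e.
have Vo : open V.
  by apply: open_chart_preimage; apply: openI; [exact: ch_dom_open | exact: frame_open].
have Wo : open W by apply: open_chart_preimage; exact: frame_open.
have VW z : V z -> W (F z).
  move=> [cz [c'z ez]]; split; first exact: ch_toP.
  by rewrite /preimage /F /= ch_toK.
have Fh b : holomorphic V (fun z => F z 0 b).
  have [hs hd] := transition_holomorphic b ac ac'.
  split=> [k|z a [cz [c'z _]]]; last exact: hd.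
  by apply: CW_sub (hs k) => z [cz [c'z _]].
have Vx : V (ch_to c x).
  by split; [exact: ch_toP | rewrite /preimage /= ch_toK].
have gs := weight_smooth fe ac'.
have Fx : F (ch_to c x) = ch_to c' x by rewrite /F ch_toK.
have E z : V z -> weight h e (ch_from c' (F z)) = weight h e (ch_from c z).
  by move=> [cz [c'z _]]; rewrite /F ch_toK.
rewrite /curvature (cplx_hessian_near Vo Vx E); last exact: (smooth_comp Vo VW Fh gs).
rewrite (cplx_hessian_comp Vo VW Fh gs Vx) Fx.
by [].
Qed.

(** A nowhere zero holomorphic transition function [s] adds [- ln |s|^2] to the weight, and this has
    zero complex Hessian. *)
Lemma curvature_frame e e' c x : frames e -> frames e' -> atlas c ->
  ch_dom c x -> fr_dom e x -> fr_dom e' x ->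
  curvature h e' c x = curvature h e c x.
Proof.
move=> fe fe' ac cx ex e'x.
have [s hs sE] := frame_compat fe fe'.
pose V := ch_cod c `&` ch_from c @^-1` (fr_dom e `&` fr_dom e').
have Wo : open (fr_dom e `&` fr_dom e').
  by apply: openI; exact: frame_open.
have Vo : open V by exact: open_chart_preimage.
have Vx : V (ch_to c x).
  by split; [exact: ch_toP | rewrite /preimage /= ch_toK].
pose f z := s (ch_from c z).
have fh : holomorphic V f by apply/holoP => //; exact: hs.
have f0 z : V z -> f z != 0.
  move=> [cz [ez e'z]]; have [+ _] := frame_basis fe' e'z.
  by rewrite sE//; apply: contraNneq; rewrite /f => ->; rewrite scale0r.
have [ls lh] := smooth_lnV Vo f0 fh.
have ws : smooth V (fun z => weight h e (ch_from c z)).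
  by move=> k; apply: CW_sub (weight_smooth fe ac k) => z [cz [ez _]].
pose l z := toC (ln (reC (f z * (f z)^*))).
have Ns : smooth V (fun z => - l z) by move=> k; exact: CWN.
have E z : V z -> weight h e (ch_from c z) + - l z = weight h e' (ch_from c z).
  move=> [cz [ez e'z]]; rewrite /weight /l /f sE// dnormZ normCK.
  have [r r0 ->] := frame_norm_gt0 fe ez.
  have fz : s (ch_from c z) != 0 by apply: f0.
  have [q q0 ->] : exists2 q : R, 0 < q &
      s (ch_from c z) * (s (ch_from c z))^* = toC q.
    by apply: gt0_toC; rewrite -normCK exprn_gt0// normr_gt0.
  rewrite -toCM !re_toC lnM ?posrE// -toCN -toCD; congr toC.
  by rewrite opprD addrC.
rewrite /curvature (cplx_hessian_near Vo Vx E); last exact: smoothD.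
rewrite (cplx_hessianD Vo Vx ws Ns).
by rewrite (cplx_hessianN Vo Vx ls (lh _ Vx)) addr0.
Qed.

End Curvature.
End Charts.

(** * Coordinates adapted to a submersion *)

Section AdaptedCharts.
Variable R : realType.
Local Notation C := (Cplx R).
Variables (m n : nat) (X : complexManifold R (m + n)) (Y : complexManifold R m).
Variable p : X -> Y.

Lemma holo_lsubmx (V : set 'rV[C]_(m + n)) b : open V ->
  holomorphic V (fun z => lsubmx z 0 b).
Proof.
move=> Vo; apply: (holo_ext Vo) (holo_coord Vo (lshift n b)) => z _.
by rewrite mxE.
Qed.

Lemma jacE N M (F : 'rV[C]_N -> 'rV[C]_M) x a b :
  jac F x a b = dz a (fun y => F y 0 b) x.
Proof. by rewrite /jac mxE. Qed.

Lemma ulE (J : 'M[C]_(m + n)) a b : ulsubmx J a b = J (lshift n a) (lshift n b).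
Proof. by rewrite !mxE. Qed.

Lemma dlE (J : 'M[C]_(m + n)) a b : dlsubmx J a b = J (rshift m a) (lshift n b).
Proof. by rewrite !mxE. Qed.

(** The base coordinates of [c'] are functions of those of [c] alone, through the transition from
    [d] to [d']; their derivatives along the fibre coordinates vanish. *)
Lemma adapted_transition (c c' : chart R X (m + n)) (d d' : chart R Y m) x :
  adapted p c d -> adapted p c' d' -> ch_dom c x -> ch_dom c' x ->
  exists K M, transition_jac c c' x = block_mx (transition_jac d d' (p x)) K 0 M.
Proof.
move=> [ac ad cdP] [ac' ad' cdP'] cx c'x.
pose V := ch_cod c `&` ch_from c @^-1` ch_dom c'.
pose W := ch_cod d `&` ch_from d @^-1` ch_dom d'.
have Vo : open V by apply: open_chart_preimage; exact: ch_dom_open.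
have Wo : open W by apply: open_chart_preimage; exact: ch_dom_open.
pose F z := ch_to c' (ch_from c z); pose T y := ch_to d' (ch_from d y).
set z0 := ch_to c x.
have Vz0 : V z0 by split; [exact: ch_toP | rewrite /preimage /= ch_toK].
have dl z : V z -> ch_from d (lsubmx z) = p (ch_from c z) /\ W (lsubmx z).
  move=> [cz c'z]; have [dz dE] := cdP _ (ch_fromP cz).
  rewrite ch_fromK// in dE; rewrite dE ch_toK//; split=> //; split.
    exact: ch_toP.
  by rewrite /preimage /= ch_toK//; case: (cdP' _ c'z).
have FT z b : V z -> T (lsubmx z) 0 b = F z 0 (lshift n b).
  move=> Vz; have [E _] := dl z Vz; case: (Vz) => cz c'z.
  have [_ dE] := cdP' _ c'z; rewrite /T E -dE.
  by rewrite mxE.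
have Th b : holomorphic W (fun y => T y 0 b) by exact: transition_holomorphic.
have Lh b : holomorphic V (fun z => lsubmx z 0 b) by exact: holo_lsubmx.
have z0E : lsubmx z0 = ch_to d (p x) by case: (cdP _ cx).
have JE a b : transition_jac c c' x a (lshift n b) =
    \sum_i dz i (fun y => T y 0 b) (ch_to d (p x)) * (a == lshift n i)%:R.
  rewrite jacE.
  have Vn : nbhs z0 V by exact: open_nbhs_nbhs.
  have hn : nbhs z0 [set z | T (lsubmx z) 0 b = F z 0 (lshift n b)].
    by apply: filterS Vn => z Vz; exact: FT.
  have VW z : V z -> W (lsubmx z) by move=> /dl[].
  have Ts := smooth_comp Vo VW Lh (Th b).1.
  rewrite (dz_near a hn (smooth_wd Ts Vz0)).1.
  rewrite (dz_comp VW Lh a (Th b).1 Vz0).1 z0E; apply: eq_bigr => i _.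
  congr (_ * _).
  have -> : (fun y : 'rV[C]_(m + n) => lsubmx y 0 i) = (fun y => y 0 (lshift n i)).
    by apply/funext => y; rewrite mxE.
  exact: (wdiff_unique a (wdiff_coord z0 (lshift n i))).1.
have [tau [{}JE jE]] : exists tau : 'I_m -> 'I_m -> C,
    (forall a b, transition_jac c c' x a (lshift n b) =
       \sum_i tau i b * (a == lshift n i)%:R) /\
    (forall a b, transition_jac d d' (p x) a b = tau a b).
  exists (fun i b => dz i (fun y => T y 0 b) (ch_to d (p x))).
  by split=> [a b|a b]; [exact: JE | exact: jacE].
move: (transition_jac c c' x) (transition_jac d d' (p x)) JE jE => J j JE jE.
exists (ursubmx J), (drsubmx J); rewrite -{1}[J]submxK; congr block_mx.
  apply/matrixP => a b; rewrite ulE JE (bigD1 a)//= eqxx mulr1 big1 ?addr0//.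
  by move=> i ia; rewrite (inj_eq (@lshift_inj _ _)) eq_sym (negPf ia) mulr0.
apply/matrixP => a b; rewrite dlE JE big1 ?[RHS]mxE// => i _.
by rewrite eq_rlshift mulr0.
Qed.

(** In the bases given by Gaussian elimination, the columns of [P] are the first [m] basis vectors,
    and the last [n] complete them. *)
Lemma complete_columns (P : 'M[C]_(m + n, m)) :
  (forall u : 'rV[C]_m, exists v, v *m P = u) ->
  exists Q : 'M[C]_(m + n, n), row_mx P Q \in unitmx.
Proof.
move=> Ps; have Pr : \rank P = m.
  apply/eqP; rewrite -[_ == _]/(row_full P); apply/row_fullP.
  have /choice[B HB] (i : 'I_m) : exists v : 'rV[C]_(m + n), v *m P = delta_mx 0 i.
    exact: Ps.
  exists (\matrix_i B i); apply/row_matrixP => i.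
  by rewrite row_mul rowK HB row1.
have := mulmx_ebase P; rewrite Pr pid_mx_col => PE.
exists (col_ebase P *m col_mx 0 1%:M).
rewrite -{1}PE -mulmxA -mul_mx_row unitmx_mul col_ebase_unit /=.
rewrite mul_col_mx mul1mx mul0mx.
rewrite -block_mxEh unitmxE det_ublock det1 mulr1 -unitmxE.
exact: row_ebase_unit.
Qed.

Hypotheses (ph : holo_map p) (ps : forall x, surjective_differential p x).

(* The coordinates of [p] in [d], completed by linear forms, are coordinates near
   [x] by the inverse function theorem. *)
Lemma adapted_exists (d : chart R Y m) x : atlas d -> ch_dom d (p x) ->
  exists2 c, adapted p c d & ch_dom c x.
Proof.
move=> ad dpx; have [c0 ac0 c0x] := atlas_cover x.
have [pc phd] := ph.
pose V := ch_cod c0 `&` ch_from c0 @^-1` (p @^-1` ch_dom d).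
have Wo : open (p @^-1` ch_dom d).
  by apply: open_comp; [move=> y _; exact: pc | exact: ch_dom_open].
have Vo : open V by exact: open_chart_preimage.
set z0 := ch_to c0 x.
have Vz0 : V z0 by split; [exact: ch_toP | rewrite /preimage /= ch_toK].
pose f := chart_expr p c0 d.
have fh b : holomorphic V (fun z => f z 0 b) by apply/holoP => //; exact: phd.
have [Q PQu] := complete_columns (ps ac0 ad c0x dpx).
pose Phi z := row_mx (f z) (z *m Q).
have Phh b : holomorphic V (fun z => Phi z 0 b).
  case: (split_ordP b) => b' ->.
    by apply: (holo_ext Vo) (fh b') => z _; rewrite row_mxEl.
  have h : holomorphic V (fun z => \sum_c z 0 c * Q c b').
    apply: (holo_sum Vo) => c; apply: (holoM Vo); first exact: holo_coord.
    exact: holo_cst.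
  by apply: (holo_ext Vo) h => z _; rewrite row_mxEr mxE.
have PhJ : jac Phi z0 \in unitmx.
  suff -> : jac Phi z0 = row_mx (jac f z0) Q by [].
  apply/matrixP => a b; rewrite [LHS]jacE; case: (split_ordP b) => b' ->.
    have -> : (fun z => Phi z 0 (lshift n b')) = (fun z => f z 0 b').
      by apply/funext => z; rewrite row_mxEl.
    by rewrite [RHS]row_mxEl [RHS]jacE.
  rewrite [RHS]row_mxEr.
  have -> : (fun z => Phi z 0 (rshift m b')) = (fun z => \sum_c z 0 c * Q c b').
    by apply/funext => z; rewrite row_mxEr mxE.
  have cd c : wdifferentiable (fun z : 'rV[C]_(m + n) => z 0 c * Q c b') z0.
    exact: wdiffW (wdiffM (wdiff_coord z0 c) (wdiff_cst (Q c b') z0)).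
  rewrite (wdiff_unique a (wdiff_sum _ cd)).1 (bigD1 a)//= big1.
    rewrite (wdiff_unique a (wdiffM (wdiff_coord z0 a) (wdiff_cst (Q a b') z0))).1.
    by rewrite eqxx mul1r mulr0 !addr0.
  move=> c ca.
  rewrite (wdiff_unique a (wdiffM (wdiff_coord z0 c) (wdiff_cst (Q c b') z0))).1.
  by rewrite eq_sym (negPf ca) mul0r mulr0 addr0.
have [U [W [G [Uo Wo' UV Uz0 [PhiP GP Gh]]]]] := holomorphic_inverse Vo Vz0 Phh PhJ.
pose D := ch_dom c0 `&` ch_to c0 @^-1` U.
have Do : open D.
  rewrite openE => y [c0y Uy].
  have h1 : nbhs y (ch_dom c0) by apply: open_nbhs_nbhs; split=> //; exact: ch_dom_open.
  have h2 : nbhs y (ch_to c0 @^-1` U).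
    by apply: (ch_to_cont c0y); exact: open_nbhs_nbhs.
  exact: filterI h1 h2.
have toP y : D y -> W (Phi (ch_to c0 y)) by move=> [_ /PhiP[]].
have GU w : W w -> U (G w) by case/GP.
have Gcod w : W w -> ch_cod c0 (G w) by move=> /GU/UV[].
have fromP w : W w -> D (ch_from c0 (G w)).
  move=> Ww; split; first by apply: ch_fromP; exact: Gcod.
  by rewrite /preimage /= ch_fromK; [exact: GU | exact: Gcod].
have toK y : D y -> ch_from c0 (G (Phi (ch_to c0 y))) = y.
  by move=> [c0y /PhiP[_ ->]]; rewrite ch_toK.
have fromK w : W w -> Phi (ch_to c0 (ch_from c0 (G w))) = w.
  by move=> Ww; rewrite ch_fromK; [case: (GP _ Ww) | exact: Gcod].
have to_cont y : D y -> {for y, continuous (fun y => Phi (ch_to c0 y))}.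
  move=> [c0y Uy]; apply: (@continuous_comp _ _ _ (ch_to c0) Phi).
    exact: ch_to_cont.
  by apply: continuous_row => b; exact: CW_continuous ((Phh b).1 0%N) (UV _ Uy).
have from_cont w : W w -> {for w, continuous (fun w => ch_from c0 (G w))}.
  move=> Ww; apply: (@continuous_comp _ _ _ G (ch_from c0)).
    by apply: continuous_row => b; exact: CW_continuous ((Gh b).1 0%N) Ww.
  by apply: ch_from_cont; exact: Gcod.
pose c := Chart Do Wo' toP fromP toK fromK to_cont from_cont.
have ac : atlas c.
  (* By maximality of the atlas only compatibility is to be checked; through [c0], the two
     transitions are composites with [G] and with [Phi]. *)
  apply: atlas_maximal => c' ac'; split=> b.
    pose V1 := W `&` (fun w => ch_from c0 (G w)) @^-1` ch_dom c'.
    have V1o : open V1.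
      by apply: (open_chart_preimage (c := c)); exact: ch_dom_open.
    pose V2 := ch_cod c0 `&` ch_from c0 @^-1` ch_dom c'.
    have V2o : open V2 by apply: open_chart_preimage; exact: ch_dom_open.
    apply/(holoP _ V1o).
    apply: (@holo_comp _ _ _ V1 V2 G V1o _ _ (fun z => ch_to c' (ch_from c0 z) 0 b)).
    - by move=> w [Ww c'w]; split=> //; exact: Gcod.
    - move=> i; have [gs gd] := Gh i; split=> [k|w a [Ww _]]; last exact: gd.
      by apply: CW_sub (gs k) => w [].
    - exact: transition_holomorphic.
  pose V1 := ch_cod c' `&` ch_from c' @^-1` D.
  have V1o : open V1 by exact: open_chart_preimage.
  apply/(holoP _ V1o).
  apply: (@holo_comp _ _ _ V1 V (fun z => ch_to c0 (ch_from c' z)) V1o _ _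
    (fun z => Phi z 0 b)) => //.
  - by move=> z [c'z [c0z Uz]]; exact: UV.
  - move=> i; have [gs gd] := transition_holomorphic i ac' ac0.
    split=> [k|z a [c'z [c0z _]]]; last exact: gd.
    by apply: CW_sub (gs k) => z [c'z [c0z _]].
exists c; last by split.
split=> // y [c0y Uy]; have [_] := UV _ Uy; rewrite /preimage /= ch_toK// => dy.
split=> //; rewrite -[LHS]/(lsubmx (Phi (ch_to c0 y))) row_mxKl.
by rewrite /f /chart_expr ch_toK.
Qed.

End AdaptedCharts.

(** * The equivalences *)

Section Pointwise.
Variable R : realType.
Local Notation C := (Cplx R).
Variables (m n : nat) (X : complexManifold R (m + n)) (Y : complexManifold R m).
Variables (p : X -> Y) (L : lineBundle X) (h : hermMetric L).
Hypothesis hp : positive_on_fibres p h.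
Implicit Types (c : chart R X (m + n)) (d : chart R Y m) (e : localFrame L).

Lemma adapted_atlas c d : adapted p c d -> atlas c.
Proof. by case. Qed.

Lemma curvature_H_herm c d e x : adapted p c d -> frames e ->
  ch_dom c x -> fr_dom e x -> adjmx (curvature_H h e c x) = curvature_H h e c x.
Proof.
move=> cd fe cx ex; apply: horizontal_part_herm; last exact: hp cd fe _ cx ex.
by apply: curvature_herm => //; case: cd.
Qed.

Lemma num_pos_curvature c d e x : adapted p c d -> frames e ->
  ch_dom c x -> fr_dom e x ->
  num_pos_eigenvalues (curvature h e c x) =
  (num_pos_eigenvalues (curvature_H h e c x) + n)%N.
Proof.
move=> cd fe cx ex; apply: num_pos_eigenvalues_schur; last exact: hp cd fe _ cx ex.
by apply: curvature_herm => //; case: cd.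
Qed.

Section Equivalences.
Hypotheses (ph : holo_map p) (ps : forall x, surjective_differential p x).
Hypothesis Xk : kahler_manifold X.

(** The transformation rule of the Kaehler form exhibits the Jacobian as a factor of an invertible
    matrix. *)
Lemma transition_jac_unit c c' x : atlas c -> atlas c' ->
  ch_dom c x -> ch_dom c' x -> transition_jac c c' x \in unitmx.
Proof.
move=> ac ac' cx c'x; have [g gk] := Xk.
have := posdef_unit (kahler_posdef gk ac cx).
by rewrite (kahler_change gk ac ac' cx c'x) !unitmx_mul => /andP[/andP[]].
Qed.

Lemma adapted_chart x : exists c d, adapted p c d /\ ch_dom c x.
Proof.
have [d ad dx] := atlas_cover (p x).
by have [c cd cx] := adapted_exists ph ps ad dx; exists c, d.
Qed.

Lemma curvature_pos_ge_H k :
  curvature_pos_ge h (n + k) <-> curvature_H_pos_ge p h k.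
Proof.
split=> H x c; last first.
  (* The given chart is arbitrary: it is exchanged for an adapted one, which acts on the curvature
     matrix by a congruence. *)
  move=> e ac fe cx ex; have [c' [d [cd c'x]]] := adapted_chart x.
  have ac' := adapted_atlas cd.
  rewrite (curvature_change h fe ac ac' cx c'x ex).
  rewrite num_pos_eigenvalues_congr; last first.
  - exact: curvature_herm.
  - exact: transition_jac_unit.
  by rewrite (num_pos_curvature cd)// addnC leq_add2r; exact: H cd fe c'x ex.
move=> d e cd fe cx ex; have := H x c e (adapted_atlas cd) fe cx ex.
by rewrite (num_pos_curvature cd fe cx ex) addnC leq_add2r.
Qed.

Lemma eigen_sums_H_pos k (beta : horizontalForm p) : (1 <= k <= m)%N ->
  positive_form beta -> eigen_sums_pos h beta (m - k + 1) ->
  curvature_H_pos_ge p h k.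
Proof.
move=> km bp bs x c d e cd fe cx ex; have [ac ad cdP] := cd.
apply: (@sums_pos_num_pos _ _ _ (beta d x)) => //.
- by apply: bp => //; case: (cdP _ cx).
- exact: curvature_H_herm cd fe cx ex.
- exact: bs cd fe cx ex.
Qed.

Lemma eigen_sums_wedge_H (beta : horizontalForm p) : (0 < m)%N ->
  positive_form beta ->
  eigen_sums_pos h beta m <-> wedge_H_pos h beta.
Proof.
move=> m0 bp.
have key x c d e : adapted p c d -> frames e -> ch_dom c x -> fr_dom e x ->
    sums_pos m (rel_eigenvalues (beta d x) (curvature_H h e c x)) <->
    positive_top (wedge (form11 (curvature_H h e c x))
                        (ext_pow (form11 (beta d x)) (m - 1))).
  move=> cd fe cx ex; have [ac ad cdP] := cd.
  have bdx : posdef (beta d x) by apply: bp => //; case: (cdP _ cx).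
  have [c0 c00 ->] := wedge_top_adj (curvature_H h e c x) (beta d x) m0.
  have E1 := sums_pos_tr (curvature_H h e c x) bdx.
  have E2 := positive_top_vol m (c0 * \tr (\adj (beta d x) *m curvature_H h e c x)).
  by rewrite pmulr_rgt0// in E2; apply: (iff_trans E1); exact: iff_sym.
split=> H x c d e cd fe cx ex; apply/(key x c d e) => //; exact: H cd fe cx ex.
Qed.

Lemma eigen_sums_wedge (beta : horizontalForm p) : (0 < m)%N ->
  positive_form beta ->
  eigen_sums_pos h beta m <-> wedge_pos h beta.
Proof.
move=> m0 bp.
have key x c d e : adapted p c d -> frames e -> ch_dom c x -> fr_dom e x ->
    sums_pos m (rel_eigenvalues (beta d x) (curvature_H h e c x)) <->
    positive_top (wedge (ext_pow (form11 (curvature h e c x)) n.+1)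
      (ext_pow (form11 (block_mx (beta d x) 0 0 0 : 'M[C]_(m + n))) (m - 1))).
  move=> cd fe cx ex; have [ac ad cdP] := cd.
  have bdx : posdef (beta d x) by apply: bp => //; case: (cdP _ cx).
  have Dp := hp cd fe cx ex.
  have [c0 c00 ->] := wedge_top_schur (beta d x) m0 (posdef_unit Dp).
  have E1 := sums_pos_tr (curvature_H h e c x) bdx.
  have E2 := positive_top_vol (m + n) (c0 * (\det (drsubmx (curvature h e c x)) *
    \tr (\adj (beta d x) *m curvature_H h e c x))).
  rewrite pmulr_rgt0// pmulr_rgt0 ?posdef_det_gt0// in E2.
  by apply: (iff_trans E1); exact: iff_sym.
split=> H x c d e cd fe cx ex; apply/(key x c d e) => //; exact: H cd fe cx ex.
Qed.

Lemma transition_jac_id N (Z : complexManifold R N) (d : chart R Z N) z :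
  ch_dom d z -> transition_jac d d z = 1%:M.
Proof.
move=> dz_; apply/matrixP => a b; rewrite jacE [RHS]mxE.
have Vn : nbhs (ch_to d z) (ch_cod d).
  by apply: open_nbhs_nbhs; split; [exact: ch_cod_open | exact: ch_toP].
have hn : nbhs (ch_to d z) [set y : 'rV[C]_N | y 0 b = (ch_to d (ch_from d y)) 0 b].
  by apply: filterS Vn => y dy /=; rewrite ch_fromK.
have cw := wdiff_coord (ch_to d z) b.
by rewrite (dz_near a hn (wdiffW cw)).1 (wdiff_unique a cw).1.
Qed.

Lemma curvature_H_change c c' d d' e e' x : adapted p c d -> adapted p c' d' ->
  frames e -> frames e' -> ch_dom c x -> ch_dom c' x -> fr_dom e x -> fr_dom e' x ->
  curvature_H h e c x = transition_jac d d' (p x) *m curvature_H h e' c' x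
                          *m adjmx (transition_jac d d' (p x)).
Proof.
move=> cd cd' fe fe' cx c'x ex e'x.
have ac := adapted_atlas cd; have ac' := adapted_atlas cd'.
have [K [M JE]] := adapted_transition cd cd' cx c'x.
apply: (@horizontal_part_congr _ _ _ _ _ _ K M).
- by rewrite -JE (curvature_frame h fe fe' ac' c'x ex e'x); exact: curvature_change.
- exact: posdef_unit (hp cd fe cx ex).
- exact: posdef_unit (hp cd' fe' c'x e'x).
Qed.

Lemma kahler_H_change g c c' d d' x : is_kahler_form g ->
  adapted p c d -> adapted p c' d' -> ch_dom c x -> ch_dom c' x ->
  horizontal_part (g c x) = transition_jac d d' (p x) *m horizontal_part (g c' x)
                          *m adjmx (transition_jac d d' (p x)).
Proof.
move=> gk cd cd' cx c'x.
have ac := adapted_atlas cd; have ac' := adapted_atlas cd'.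
have [K [M JE]] := adapted_transition cd cd' cx c'x.
apply: (@horizontal_part_congr _ _ _ _ _ _ K M).
- by rewrite -JE (kahler_change gk ac ac' cx c'x).
- exact: posdef_unit (posdef_drsubmx (kahler_posdef gk ac cx)).
- exact: posdef_unit (posdef_drsubmx (kahler_posdef gk ac' c'x)).
Qed.

End Equivalences.
End Pointwise.

Section SmoothMatrices.
Variable R : realType.
Local Notation C := (Cplx R).

Lemma msmooth_mxsub N (V : set 'rV[C]_N) p q p' q' (f : 'I_p' -> 'I_p)
    (g : 'I_q' -> 'I_q) (A : 'rV[C]_N -> 'M[C]_(p, q)) : open V ->
  msmooth V A -> msmooth V (fun x => mxsub f g (A x)).
Proof.
move=> Vo As i j; apply: smooth_ext (As (f i) (g j)) => // x _.
by rewrite mxE.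
Qed.

(** Written with [mxsub], the four blocks are covered by a single smoothness lemma. *)
Lemma horizontal_part_mxsub m n (A : 'M[C]_(m + n)) :
  horizontal_part A = mxsub (@lshift m n) (@lshift m n) A -
    mxsub (@lshift m n) (@rshift m n) A *m
    invmx (mxsub (@rshift m n) (@rshift m n) A) *m
    mxsub (@rshift m n) (@lshift m n) A.
Proof.
have -> : mxsub (@lshift m n) (@lshift m n) A = ulsubmx A.
  by apply/matrixP => i j; rewrite !mxE.
have -> : mxsub (@lshift m n) (@rshift m n) A = ursubmx A.
  by apply/matrixP => i j; rewrite !mxE.
have -> : mxsub (@rshift m n) (@lshift m n) A = dlsubmx A.
  by apply/matrixP => i j; rewrite !mxE.
have -> : mxsub (@rshift m n) (@rshift m n) A = drsubmx A.
  by apply/matrixP => i j; rewrite !mxE.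
by [].
Qed.

Lemma drsubmx_mxsub m n (A : 'M[C]_(m + n)) :
  drsubmx A = mxsub (@rshift m n) (@rshift m n) A.
Proof. by apply/matrixP => i j; rewrite !mxE. Qed.

Lemma msmooth_horizontal N (V : set 'rV[C]_N) m n
    (A : 'rV[C]_N -> 'M[C]_(m + n)) : open V ->
  (forall x, V x -> drsubmx (A x) \in unitmx) ->
  msmooth V A -> msmooth V (fun x => horizontal_part (A x)).
Proof.
move=> Vo Au As; apply: (msmooth_ext Vo) => [x _|].
  by rewrite horizontal_part_mxsub.
apply: (msmoothD Vo); first exact: msmooth_mxsub.
apply: (msmoothN Vo); apply: (msmoothM Vo); last exact: msmooth_mxsub.
apply: (msmoothM Vo); first exact: msmooth_mxsub.
apply: (msmooth_inv Vo); last exact: msmooth_mxsub.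
by move=> x Vx; rewrite -drsubmx_mxsub; exact: Au.
Qed.

Lemma msmooth_deform N (V : set 'rV[C]_N) m (Lam : C) k
    (G H : 'rV[C]_N -> 'M[C]_m) : open V ->
  (forall x, V x -> G x \in unitmx) -> msmooth V G -> msmooth V H ->
  msmooth V (fun x => deform Lam k (G x) (H x)).
Proof.
move=> Vo Gu Gs Hs; apply: (msmoothM Vo) => //; apply: (msmoothX Vo).
apply: (msmoothD Vo); first exact: msmooth_cst.
apply: (msmoothN Vo); apply: (msmoothM Vo) => //.
exact: (msmooth_inv Vo).
Qed.

Lemma msmooth_near (T : topologicalType) N (c : chart R T N) p q
    (V : set 'rV[C]_N) (A : 'rV[C]_N -> 'M[C]_(p, q)) x0 (eps : C) :
  ch_dom c x0 -> V (ch_to c x0) -> msmooth V A -> 0 < eps ->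
  \forall x \near x0, forall i j,
    `|A (ch_to c x) i j - A (ch_to c x0) i j| <= eps.
Proof.
move=> cx Vx As /gt0_toC[r r0 ->].
apply: filter_forall => i; apply: filter_forall => j.
have Ac := CW_continuous (As i j 0%N) Vx.
have Bn : nbhs (A (ch_to c x0) i j)
    [set w | `|w - A (ch_to c x0) i j| <= toC r].
  by apply/nbhs_cnorm; exists r => // w wr /=; rewrite normC_cnorm leC ltW.
exact: (ch_to_cont cx) (Ac _ Bn).
Qed.

End SmoothMatrices.

(** * Construction of the positive horizontal form *)

Section PositiveMetric.
Variable R : realType.
Local Notation C := (Cplx R).
Variables (m n k : nat) (X : complexManifold R (m + n)) (Y : complexManifold R m).
Variables (p : X -> Y) (L : lineBundle X) (h : hermMetric L).
Variable g : chart R X (m + n) -> X -> 'M[C]_(m + n).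
Hypotheses (hp : positive_on_fibres p h) (ph : holo_map p).
Hypotheses (ps : forall x, surjective_differential p x) (gk : is_kahler_form g).
Implicit Types (c : chart R X (m + n)) (d : chart R Y m) (e : localFrame L).

Local Notation kahler_H c x := (horizontal_part (g c x)).
Local Notation charted c e := (ch_cod c `&` ch_from c @^-1` fr_dom e).

Lemma kahler_H_posdef c d x : adapted p c d -> ch_dom c x -> posdef (kahler_H c x).
Proof.
move=> cd cx; apply: posdef_horizontal_part; apply: (kahler_posdef gk) => //.
exact: adapted_atlas cd.
Qed.

Lemma charted_open c e : frames e -> open (charted c e).
Proof. by move=> fe; apply: open_chart_preimage; exact: frame_open. Qed.

Lemma charted_mem c e x : ch_dom c x -> fr_dom e x -> charted c e (ch_to c x).
Proof. by move=> cx ex; split; [exact: ch_toP | rewrite /preimage /= ch_toK]. Qed.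

Lemma kahler_H_smooth c d e : adapted p c d -> frames e ->
  msmooth (charted c e) (fun w => kahler_H c (ch_from c w)).
Proof.
move=> cd fe; have ac := adapted_atlas cd; have Vo := charted_open (c := c) fe.
apply: (msmooth_horizontal Vo) => [w [cw _]|i j].
  apply: posdef_unit; apply: posdef_drsubmx; apply: (kahler_posdef gk ac).
  exact: ch_fromP.
have h1 := smooth_on_chart (ch_dom_open c) (kahler_smooth gk ac i j) ac.
by move=> q; apply: CW_sub (h1 q) => w [cw _]; split=> //; exact: ch_fromP.
Qed.

Lemma curvature_H_smooth c d e : adapted p c d -> frames e ->
  msmooth (charted c e) (fun w => curvature_H h e c (ch_from c w)).
Proof.
move=> cd fe; have ac := adapted_atlas cd; have Vo := charted_open (c := c) fe.
apply: (msmooth_horizontal Vo) => [w [cw ew]|i j].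
  apply: posdef_unit; apply: (hp cd fe) => //; exact: ch_fromP.
have ws := smooth_dz i (smooth_dzbar j (weight_smooth h fe ac)).
apply: (smooth_ext Vo _ ws) => w [cw _].
by rewrite /curvature ch_fromK// [RHS]cplx_hessianE.
Qed.

(** The estimate is obtained in one chart and one frame and carried to all others by
    [pinched_congr]. Joint nearness in [x] and [M] is the form in which [compact_near_coveringP]
    uses it. *)
Lemma pinched_near x0 : curvature_H_pos_ge p h k ->
  \forall x \near (x0 : mfd_space X) & M \near \oo, forall c d e, adapted p c d -> frames e ->
    ch_dom c x -> fr_dom e x -> pinched k M (kahler_H c x) (curvature_H h e c x).
Proof.
move=> Hk; have [c [d [cd cx]]] := adapted_chart ph ps x0.
have [e fe ex] := frame_cover L x0.
have Gp := kahler_H_posdef cd cx.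
have Hh := curvature_H_herm hp cd fe cx ex.
have [eps eps0 He] := pinched_open Gp Hh (Hk _ _ _ _ cd fe cx ex).
have Vx := charted_mem cx ex.
have Gn := msmooth_near cx Vx (kahler_H_smooth cd fe) eps0.
have Hn := msmooth_near cx Vx (curvature_H_smooth cd fe) eps0.
have cn : nbhs x0 (ch_dom c) by apply: open_nbhs_nbhs; split=> //; exact: ch_dom_open.
have en : nbhs x0 (fr_dom e) by apply: open_nbhs_nbhs; split=> //; exact: frame_open.
have [q epsq] : exists q : nat, eps^-1 <= q%:R.
  have [r r0 ->] : exists2 r : R, 0 < r & eps^-1 = toC r.
    by apply: gt0_toC; rewrite invr_gt0.
  exists (Num.truncn r).+1; rewrite -[_%:R]/(1 *+ _) -toC1 -toCMn leC.
  by apply: ltW; exact: truncnS_gt.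
have Fx : Filter (nbhs (x0 : mfd_space X)) := nbhs_filter _.
have F := filterI (filterI cn en) (filterI Gn Hn).
refine (ex_intro2 _ _ (_, _) (conj (F Fx Fx Fx) (nbhs_infty_ge q)) _).
move=> [x M] [/= [[cx' ex'] [Gx Hx]] qM] c' d' e' cd' fe' c'x e'x.
rewrite !ch_toK// in Gx Hx.
have P : pinched k M (kahler_H c x) (curvature_H h e c x).
  have Mq : eps^-1 <= M%:R by apply: le_trans epsq _; rewrite ler_nat.
  exact: (He _ _ M (kahler_H_posdef cd cx') (curvature_H_herm hp cd fe cx' ex') Gx Hx Mq).
have Xk : kahler_manifold X by exists g.
rewrite (kahler_H_change gk cd' cd c'x cx').
rewrite (curvature_H_change hp cd' cd fe' fe c'x cx' e'x ex').
apply: pinched_congr P.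
have := posdef_unit (kahler_H_posdef cd' c'x).
by rewrite (kahler_H_change gk cd' cd c'x cx') !unitmx_mul => /andP[/andP[]].
Qed.

Lemma pinched_uniform : compact [set: X] -> curvature_H_pos_ge p h k ->
  exists2 M : nat, (0 < M)%N & forall x c d e, adapted p c d -> frames e ->
    ch_dom c x -> fr_dom e x -> pinched k M (kahler_H c x) (curvature_H h e c x).
Proof.
move=> /compact_near_coveringP Xc Hk.
pose P (M : nat) x := forall c d e, adapted p c d -> frames e ->
    ch_dom c x -> fr_dom e x -> pinched k M (kahler_H c x) (curvature_H h e c x).
have PM := Xc _ \oo P eventually_filter (fun x _ => pinched_near x Hk).
have [M [M0 MP]] := filter_ex (filterI (nbhs_infty_ge 1) PM).
by exists M => // x; exact: MP.
Qed.

(* The form built pointwise by [deform] from arbitrary choices of an adapted chart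
   and of a frame; [deform_congr] makes it independent of these choices. *)
Lemma deformed_form (Lam : C) (N : nat) : exists beta : horizontalForm p,
  forall c d e x, adapted p c d -> frames e -> ch_dom c x -> fr_dom e x ->
  beta d x = deform Lam N (kahler_H c x) (curvature_H h e c x).
Proof.
have Xk : kahler_manifold X by exists g.
have /choice[ce ceP] : forall dx : chart R Y m * X,
    exists ce : chart R X (m + n) * localFrame L,
    atlas dx.1 -> ch_dom dx.1 (p dx.2) ->
    [/\ adapted p ce.1 dx.1, frames ce.2, ch_dom ce.1 dx.2 & fr_dom ce.2 dx.2].
  move=> [d x] /=; have [e fe ex] := frame_cover L x.
  have [[ad dx]|nd] := pselect (atlas d /\ ch_dom d (p x)).
    by have [c cd cx] := adapted_exists ph ps ad dx; exists (c, e).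
  (* Pairs outside the domain receive an arbitrary chart as default. *)
  by have [c ac cx] := atlas_cover x; exists (c, e) => ad dx; case: nd.
pose beta d x := deform Lam N (kahler_H (ce (d, x)).1 x)
  (curvature_H h (ce (d, x)).2 (ce (d, x)).1 x).
(* For [d = d'] this gives independence of the choices; for the choice made at [d'] it gives the
   change of coordinates. *)
have beta_change d d' c' e' x : atlas d -> ch_dom d (p x) -> adapted p c' d' ->
    frames e' -> ch_dom c' x -> fr_dom e' x ->
    beta d x = transition_jac d d' (p x) *m
      deform Lam N (kahler_H c' x) (curvature_H h e' c' x)
      *m adjmx (transition_jac d d' (p x)).
  move=> ad dx cd' fe' c'x e'x; have [cd fe cx ex] := ceP (d, x) ad dx.
  move: cd fe cx ex; rewrite /beta /=; move: (ce (d, x)) => [c e] /= cd fe cx ex.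
  have Gu := posdef_unit (kahler_H_posdef cd cx).
  have GE := kahler_H_change gk cd cd' cx c'x.
  have HE := curvature_H_change hp cd cd' fe fe' cx c'x ex e'x.
  rewrite GE HE; apply: deform_congr.
    by move: Gu; rewrite GE !unitmx_mul => /andP[/andP[]].
  exact: posdef_unit (kahler_H_posdef cd' c'x).
have betaE c d e x : adapted p c d -> frames e -> ch_dom c x -> fr_dom e x ->
    beta d x = deform Lam N (kahler_H c x) (curvature_H h e c x).
  move=> cd fe cx ex; have [_ ad cdP] := cd; have [dx _] := cdP _ cx.
  by rewrite (beta_change d d c e)// transition_jac_id// adjmx1 mulmx1 mul1mx.
have beta_smooth d : atlas d -> forall i j,
    smooth_on (p @^-1` ch_dom d) (fun x => beta d x i j).
  move=> ad i j c' ac'.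
  have po : open (p @^-1` ch_dom d).
    by apply: open_comp; [move=> y _; exact: ph.1 | exact: ch_dom_open].
  apply/Cinf_smooth; first exact: open_chart_preimage.
  (* The choice [ce] varies with the point without any continuity; near each point [betaE] replaces
     it by a fixed chart and frame. *)
  apply: smooth_local => z [c'z dz_].
  have [c cd cx] := adapted_exists ph ps ad dz_.
  have [e fe ex] := frame_cover L (ch_from c' z).
  pose U := ch_cod c' `&` ch_from c' @^-1` (ch_dom c `&` fr_dom e).
  have Uo : open U.
    by apply: open_chart_preimage; apply: openI; [exact: ch_dom_open | exact: frame_open].
  have Wo := charted_open (c := c) fe.
  exists U; split=> //.
  have UW w : U w -> charted c e (ch_to c (ch_from c' w)).
    by move=> [c'w [cw ew]]; exact: charted_mem.
  have Fh b : holomorphic U (fun w => ch_to c (ch_from c' w) 0 b).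
    have [hs hd] := transition_holomorphic b ac' (adapted_atlas cd).
    split=> [q|w a [c'w [cw _]]]; last exact: hd.
    by apply: CW_sub (hs q) => w [c'w [cw _]].
  have Gu w : charted c e w -> kahler_H c (ch_from c w) \in unitmx.
    by move=> [cw _]; apply: posdef_unit; apply: (kahler_H_posdef cd); exact: ch_fromP.
  have aux D : msmooth (charted c e) D ->
      (forall w, U w -> D (ch_to c (ch_from c' w)) = beta d (ch_from c' w)) ->
      smooth U (fun w => beta d (ch_from c' w) i j).
    move=> Ds DE; have := smooth_comp Uo UW Fh (Ds i j).
    by apply: (smooth_ext Uo) => w Uw; rewrite DE.
  apply: (aux _ (msmooth_deform Lam N Wo Gu (kahler_H_smooth cd fe) (curvature_H_smooth cd fe))).
  move=> w [c'w [cw ew]]; cbv beta; rewrite (ch_toK cw).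
  exact: esym (betaE c d e _ cd fe cw ew).
have bchange d d' : atlas d -> atlas d' -> forall x, ch_dom d (p x) -> ch_dom d' (p x) ->
    beta d x = transition_jac d d' (p x) *m beta d' x
                 *m adjmx (transition_jac d d' (p x)).
  move=> ad ad' x dx d'x; have [cd' fe' c'x e'x] := ceP (d', x) ad' d'x.
  exact: beta_change.
by exists (HorizontalForm beta_smooth bchange).
Qed.

Lemma curvature_H_pos_form : compact [set: X] -> (1 <= k <= m)%N ->
  curvature_H_pos_ge p h k ->
  exists2 beta : horizontalForm p,
    positive_form beta & eigen_sums_pos h beta (m - k + 1).
Proof.
move=> Xc km Hk; have [M M0 MP] := pinched_uniform Xc Hk.
have [N HN] := deform_exponent C (m - k) M0.
have [beta bE] := deformed_form M%:R N.
have key c d e x : adapted p c d -> frames e -> ch_dom c x -> fr_dom e x ->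
    posdef (beta d x) /\
    sums_pos (m - k + 1) (rel_eigenvalues (beta d x) (curvature_H h e c x)).
  move=> cd fe cx ex; have [S [dd [[Su dr GE HE] [dM dk]]]] := MP _ _ _ _ cd fe cx ex.
  rewrite (bE c d e x)//; apply: (deformed_metric Su dr GE HE km dM _ dk HN).
  by rewrite invr_gt0 ltr0Sn.
exists beta => [d ad x dx|x c d e cd fe cx ex]; last by case: (key c d e x).
have [e fe ex] := frame_cover L x; have [c cd cx] := adapted_exists ph ps ad dx.
by case: (key c d e x).
Qed.

End PositiveMetric.

Theorem mainTheorem3 (R : realType) (m n k : nat)
    (X : complexManifold R (m + n)) (Y : complexManifold R m) (p : X -> Y)
    (L : lineBundle X) (h : hermMetric L) :
  holo_map p ->
  (forall y : Y, exists x : X, p x = y) ->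
  proper_map p ->
  (forall x : X, surjective_differential p x) ->
  kahler_manifold X ->
  compact [set: Y] ->
  positive_on_fibres p h ->
  (1 <= k <= m)%N ->
  [/\ curvature_pos_ge h (n + k) <-> curvature_H_pos_ge p h k,
      curvature_H_pos_ge p h k <->
        (exists2 beta : horizontalForm p,
           positive_form beta & eigen_sums_pos h beta (m - k + 1)) &
      k = 1%N ->
        forall beta : horizontalForm p, positive_form beta ->
          (eigen_sums_pos h beta (m - k + 1) <-> wedge_H_pos h beta) /\
          (eigen_sums_pos h beta (m - k + 1) <-> wedge_pos h beta)].
Proof.
move=> ph _ pproper ps Xk Yc hp km.
have [g gk] := Xk.
have Xc : compact [set: X] by have := pproper _ Yc; rewrite preimage_setT.
split.
- exact: curvature_pos_ge_H.
- split=> [Hk|[beta bp bs]]; first exact: (curvature_H_pos_form hp ph ps gk).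
  exact: eigen_sums_H_pos bs.
move=> k1 beta bp; have m0 : (0 < m)%N by move: km; rewrite k1.
have -> : (m - k + 1 = m)%N by rewrite k1 subnK.
by split; [exact: eigen_sums_wedge_H | exact: eigen_sums_wedge].
Qed.
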